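(* Let $N\in\mathbb N$, let $\mathbf s=\{s_i\}_{i=0}^{2n_N-1}$ be a regular sequence of real numbers with set of normal indices $\mathcal N(\mathbf s)=\{n_j\}_{j=1}^N$ ($n_1<\dots<n_N$), let $\kappa,k\in\mathbb Z_+$, and let $m_j(z)$ and $l_j$ $(1\le j\le N)$ be the polynomials and nonzero real numbers defined by the Schur recursion described in the context. Then: (1) The (nondegenerate even) moment problem $MP_\kappa^k(\mathbf s,2n_N-1)$ is solvable (i.e. $\mathcal M_\kappa^k(\mathbf s,2n_N-1)\ne\emptyset$) if and only if $$\kappa_N:=\nu_-(S_{n_N})\le\kappa\quad\text{and}\quad k_N^+:=\nu_-(S^+_{n_N})\le k .$$ (2) $f\in\mathcal M_\kappa^k(\mathbf s,2n_N-1)$ if and only if $f$ admits the representation $f=T_{W_{2N}}[\tau]$, where $$W_{2N}(z):=M_1(z)L_1\cdots M_N(z)L_N$$ and $\tau$ satisfies $$\tau\in\mathbf N_{\kappa-\kappa_N}^{k-k_N^+}\quad\text{and}\quad \tau(z)=o(1),\quad z\widehat\to\infty .$$ (3) The representation $f=T_{W_{2N}}[\tau]$ can be rewritten as the continued fraction expansion $$f(z)=\cfrac{1}{-zm_1(z)+\cfrac{1}{l_1+\cdots+\cfrac{1}{-zm_N(z)+\cfrac{1}{l_N+\tau(z)}}}}.$$ (4) The indices $\kappa_N$ and $k_N^+$ can be found by $$\kappa_N=\sum_{j=1}^N\kappa_-(zm_j),\qquad k_N^+=\sum_{j=1}^N\kappa_-(m_j)+\sum_{j=1}^{N}\kapp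a_-(zl_j).$$
   Context: Classes. A function $f$, meromorphic on $\mathbb C\setminus\mathbb R$ with $f(\bar z)=\overline{f(z)}$ and domain of holomorphy $\mathfrak h_f$, belongs to $\mathbf N_\kappa$ ($\kappa\in\mathbb Z_+=\mathbb N\cup\{0\}$) if for all finite sets $z_1,\dots,z_n\in\mathbb C_+\cap\mathfrak h_f$ the form $\sum_{i,j}\frac{f(z_i)-\overline{f(z_j)}}{z_i-\bar z_j}\xi_i\bar\xi_j$ has at most $\kappa$ negative squares, and for some choice exactly $\kappa$. $\mathbf N_\kappa^k$ is the set of $f\in\mathbf N_\kappa$ with $zf(z)\in\mathbf N_k$ (classes with a negative index are empty). For a real polynomial $P$, $\kappa_-(P)$ is the number $\kappa$ with $P\in\mathbf N_\kappa$. $z\widehat\to\infty$ means $z\to\infty$ nontangentially, i.e. inside sectors $\varepsilon<\arg z<\pi-\varepsilon$, $\varepsilon>0$. Problem. For a real sequence $\mathbf s=\{s_j\}_{j=0}^\ell$, $\mathcal M_\kappa^k(\mathbf s,\ell)$, the solution set of $MP_\kappa^k(\mathbf s,\ell)$, is the set of $f\in\mathbf N_\kappa^k$ with $f(z)=-\frac{s_0}{z}-\cdots-\frac{s_\ell}{z^{\ell+1}}+o\left(\frac1{z^{\ell+1}}\right)$ for $z=iy$, $y\uparrow\infty$. Matrices. $S_n=(s_{i+j})_{i,j=0}^{n-1}$, $S_n^+=(s_{i+j+1})_{i,j=0}^{n-1}$, $D_n=\det S_n$, $D_n^+=\det S_n^+$; $\nu_-(S)$ is the number of negative eigenvalues of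 $S$. $n\ge1$ is a normal index of $\mathbf s$ if $D_n\ne0$. The sequence $\mathbf s=\{s_i\}_{i=0}^{2n_N-1}$ is regular if $D^+_{n_j}\ne0$ for all $j=1,\dots,N$. The even problem $MP_\kappa^k(\mathbf s,2n_N-1)$ is nondegenerate if $D_{n_N}\ne0$ and $D^+_{n_N}\ne0$. Toeplitz notation. $T(c_0,\dots,c_n)$ is the upper triangular $(n+1)\times(n+1)$ matrix with entries $c_{j-i}$ for $i\le j$ and $0$ for $i>j$. Schur recursion (here $\ell=2n_N-1$). Put $n_0=0$, $\mathbf s^{(0)}=\mathbf s$. Given $\mathbf s^{(j-1)}=\{s_i^{(j-1)}\}_{i=0}^{\ell-2n_{j-1}}$, let $\nu=n_j-n_{j-1}$ (then $s^{(j-1)}_0=\dots=s^{(j-1)}_{\nu-2}=0$, $s^{(j-1)}_{\nu-1}\ne0$), $D_\nu^{(j-1)}=\det(s^{(j-1)}_{i+p})_{i,p=0}^{\nu-1}$, $(D_\nu^{(j-1)})^+=\det(s^{(j-1)}_{i+p+1})_{i,p=0}^{\nu-1}$. Then, for $1\le j\le N$, $$m_j(z)=\frac{(-1)^{\nu+1}}{D_\nu^{(j-1)}}\Delta_j(z)=\sum_{i=0}^{\nu-1}m_i^{(j)}z^i,\qquad l_j=(-1)^{\nu+1}s^{(j-1)}_{\nu-1}\frac{D_\nu^{(j-1)}}{(D_\nu^{(j-1)})^+},$$ where $\Delta_j(z)$ is the determinant of the $\nu\times\nu$ matrix whose first $\nu-1$ rows are $(s^{(j-1)}_{i+1},s^{(j-1)}_{i+2},\dots,s^{(j-1)}_{i+\nu})$,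 $i=0,\dots,\nu-2$, and whose last row is $(1,z,\dots,z^{\nu-1})$. For $1\le j\le N-1$ the sequences $\{\mathfrak s_i^{(j)}\}_{i=-1}^{\ell-2n_j}$ and $\mathbf s^{(j)}=\{s_i^{(j)}\}_{i=0}^{\ell-2n_j}$ are determined by $$T(m^{(j)}_{\nu-1},\dots,m^{(j)}_0,-\mathfrak s^{(j)}_{-1},\dots,-\mathfrak s^{(j)}_{\ell-2n_j})\,T(s^{(j-1)}_{\nu-1},\dots,s^{(j-1)}_{\ell-2n_{j-1}})=I,$$ $$T(l_j,-s_0^{(j)},\dots,-s^{(j)}_{\ell-2n_j})\,T(\mathfrak s^{(j)}_{-1},\dots,\mathfrak s^{(j)}_{\ell-2n_j})=I .$$ Transforms. $M_j(z)=\begin{pmatrix}1&0\\-zm_j(z)&1\end{pmatrix}$, $L_j=\begin{pmatrix}1&l_j\\0&1\end{pmatrix}$, and for $W=(w_{ij})_{i,j=1}^2$, $T_W[\tau]=\dfrac{w_{11}\tau+w_{12}}{w_{21}\tau+w_{22}}$. *)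

(* Defs.v *)
From HB Require Import structures.
From mathcomp Require Import all_boot all_order all_algebra.
From mathcomp Require Import all_classical all_reals all_analysis.
From mathcomp Require Import polyrcf complex.
Set Implicit Arguments.
Unset Strict Implicit.
Unset Printing Implicit Defensive.
Import Order.TTheory GRing.Theory Num.Theory.
Import numFieldNormedType.Exports.
Local Open Scope classical_set_scope.
Local Open Scope complex_scope.
Local Open Scope ring_scope.

Section Sphere.
Variable C : fieldType.

(* [option C] is the Riemann sphere, with [None] the point at infinity. *)
Definition sphere_add (a : C) (w : option C) : option C := omap (+%R a) w.

Definition sphere_inv (w : option C) : option C :=
  if w is Some a then (if a == 0 then None else Some a^-1) else Some 0.

(* Multiplication by a number that has to be nonzero. *)
Definition sphere_scale (a : C) (w : option C) : option C := omap ( *%R a) w.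

(* The linear fractional transformation of the sphere given by an invertible
   matrix: numerator and denominator do not vanish simultaneously. *)
Definition moebius (W : 'M[C]_2) (w : option C) : option C :=
  if w is Some t then
    let den := W 1 0 * t + W 1 1 in
    if den == 0 then None else Some ((W 0 0 * t + W 0 1) / den)
  else if W 1 0 == 0 then None else Some (W 0 0 / W 1 0).

Definition mx2 (a b c d : C) : 'M[C]_2 :=
  \matrix_(i < 2, j < 2)
    if i == 0 then (if j == 0 then a else b) else (if j == 0 then c else d).

End Sphere.

Section Nevanlinna.
Variable R : realType.
Local Notation C := R[i].

Definition nonreal (z : C) : Prop := complex.Im z != 0.
Definition upper (z : C) : Prop := 0 < complex.Im z.

Definition fin_part (w : option C) : C := odflt 0 w.

Definition holomorphic_at (f : C -> option C) (z : C) : Prop :=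
  \forall w \near (z : C^o),
    f w != None /\ derivable ((fin_part \o f) : C^o -> C^o) w 1.

(* f has a pole at z: f is finite in a punctured neighbourhood of z, and 1/f,
   with the value 0 at z, is holomorphic at z. *)
Definition pole_at (f : C -> option C) (z : C) : Prop :=
  [/\ f z = None,
      \forall w \near (z : C^o)^', f w != None
    & holomorphic_at (fun w => sphere_inv (f w)) z].

(* A meromorphic function on the nonreal numbers takes the value [None] at its
   poles, so that its domain of holomorphy is the set where it is finite and
   two such functions are equal iff they agree at each nonreal point.  Its
   values at the real points are irrelevant throughout. *)
Definition meromorphic (f : C -> option C) : Prop :=
  forall z, nonreal z -> holomorphic_at f z \/ pole_at f z.

Definition real_symmetric (f : C -> option C) : Prop :=
  forall z, nonreal z -> f z^* = omap (@conjc R) (f z).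

(* The Hermitian form xi |-> \sum_(i, j) A i j * xi_i * (xi_j)^* has q negative
   squares: in the coordinates eta = xi *m P it is \sum_i d_i * `|eta_i| ^+ 2,
   with exactly q negative d_i (q does not depend on P and d, by Sylvester's
   law of inertia). *)
Definition negative_squares (n : nat) (A : 'M[C]_n) (q : nat) : Prop :=
  exists (P : 'M[C]_n) (d : 'rV[R]_n),
    [/\ P \in unitmx,
        A = P *m diag_mx (map_mx (real_complex R) d)
              *m map_mx (@conjc R) P^T
      & #|[set i | d 0 i < 0]%SET| = q].

Definition pick_matrix (f : C -> option C) (n : nat) (z : 'I_n -> C) :
    'M[C]_n :=
  \matrix_(i, j) ((fin_part (f (z i)) - (fin_part (f (z j)))^*)
                    / (z i - (z j)^*)).

Definition pick_points (f : C -> option C) (n : nat) (z : 'I_n -> C) : Prop :=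
  injective z /\ forall i, upper (z i) /\ f (z i) != None.

Definition gen_nevanlinna (kappa : nat) (f : C -> option C) : Prop :=
  [/\ meromorphic f,
      real_symmetric f,
      forall (n : nat) (z : 'I_n -> C), pick_points f z ->
        exists2 q, (q <= kappa)%N & negative_squares (pick_matrix f z) q
    & exists (n : nat) (z : 'I_n -> C),
        pick_points f z /\ negative_squares (pick_matrix f z) kappa].

Definition gen_nevanlinna_int (kappa : int) (f : C -> option C) : Prop :=
  if kappa is Posz q then gen_nevanlinna q f else False.

(* The class N_kappa^k, which is empty when an index is negative. *)
Definition gen_stieltjes (kappa k : int) (f : C -> option C) : Prop :=
  gen_nevanlinna_int kappa f /\
  gen_nevanlinna_int k (fun z => sphere_scale z (f z)).

Definition poly_eval (P : {poly R}) (z : C) : C :=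
  (map_poly (real_complex R) P).[z].

(* The unique kappa such that the polynomial P belongs to N_kappa. *)
Definition kappa_minus (P : {poly R}) : nat :=
  xget 0%N [set kappa : nat | gen_nevanlinna kappa (Some \o poly_eval P)].

(* f(z) = - s_0 / z - ... - s_l / z ^ (l + 1) + o(1 / z ^ (l + 1)) for z = iy
   and y -> +oo, where l + 1 is the size of s. *)
Definition moment_expansion (s : seq R) (f : C -> option C) : Prop :=
  forall e : R, 0 < e -> \forall y \near +oo,
    exists2 w : C, f (0 +i* y) = Some w &
      `| w + \sum_(j < size s) (s`_j)%:C / (0 +i* y) ^+ j.+1 |
        <= e%:C * `| (0 +i* y) ^- size s |.

(* The set of solutions of the moment problem MP_kappa^k(s, l), where l + 1 is
   the size of s. *)
Definition moment_solutions (kappa k : nat) (s : seq R) :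
    set (C -> option C) :=
  [set f | gen_stieltjes kappa%:Z k%:Z f /\ moment_expansion s f].

(* f(z) = o(1) as z -> oo inside each sector e < arg z < pi - e. *)
Definition nontangential_o1 (f : C -> option C) : Prop :=
  forall e : R, 0 < e -> forall d : R, 0 < d ->
  exists M : R, forall r t : R, M < r -> e < t < pi - e ->
    exists2 w : C, f ((r * cos t) +i* (r * sin t)) = Some w & `|w| <= d%:C.

End Nevanlinna.

Section Hankel.
Variable R : realType.
Local Notation C := R[i].

(* The number of negative eigenvalues, counted with multiplicity. *)
Definition nu_minus (n : nat) (A : 'M[R]_n) : nat :=
  (\sum_(x <- rootsR (char_poly A) | (x < 0)%R) mup x (char_poly A))%N.

Definition hankel (s : seq R) (n : nat) : 'M[R]_n :=
  \matrix_(i < n, j < n) s`_(i + j).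

Definition hankel_plus (s : seq R) (n : nat) : 'M[R]_n :=
  \matrix_(i < n, j < n) s`_(i + j).+1.

(* {n_1 < ... < n_N} is the set of the normal indices of s, and s consists of
   s_0, ..., s_(2 n_N - 1).  For convenience n_0 = 0. *)
Definition normal_indices (s : seq R) (N : nat) (n : nat -> nat) : Prop :=
  [/\ n 0%N = 0%N,
      forall j, (j < N)%N -> (n j < n j.+1)%N,
      size s = (2 * n N)%N
    & forall i, (1 <= i <= n N)%N ->
        \det (hankel s i) != 0 <-> exists2 j, (1 <= j <= N)%N & n j = i].

Definition regular (s : seq R) (N : nat) (n : nat -> nat) : Prop :=
  forall j, (1 <= j <= N)%N -> \det (hankel_plus s (n j)) != 0.

Definition toeplitz (c : nat -> R) (n : nat) : 'M[R]_n.+1 :=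
  \matrix_(i < n.+1, j < n.+1) if (i <= j)%N then c (j - i)%N else 0.

(* The entry a_i of the sequence a_0, ..., a_n determined by
   T(a_0, ..., a_n) T(c_0, ..., c_n) = I, read off from the first row of the
   inverse matrix. *)
Definition toeplitz_inv (c : nat -> R) (n i : nat) : R :=
  invmx (toeplitz c n) ord0 (inord i).

Lemma toeplitz_invE (a c : nat -> R) (n : nat) :
  toeplitz a n *m toeplitz c n = 1%:M ->
  forall i, (i <= n)%N -> a i = toeplitz_inv c n i.
Proof.
move=> ac i lein; rewrite /toeplitz_inv.
have [_ cu] := mulmx1_unit ac.
have <- : toeplitz a n = invmx (toeplitz c n).
  by rewrite -[LHS]mulmx1 -(mulmxV cu) mulmxA ac mul1mx.
by rewrite !mxE inordK //= subn0.
Qed.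

(* In the Schur step, s is s^(j-1) and nu = n_j - n_(j-1). *)
Definition schur_Delta (s : seq R) (nu : nat) : {poly R} :=
  \det (\matrix_(i < nu, p < nu)
          if (i.+1 < nu)%N then (s`_(i.+1 + p))%:P else 'X^p).

Definition schur_m (s : seq R) (nu : nat) : {poly R} :=
  ((-1) ^+ nu.+1 / \det (hankel s nu)) *: schur_Delta s nu.

Definition schur_l (s : seq R) (nu : nat) : R :=
  (-1) ^+ nu.+1 * s`_nu.-1 * (\det (hankel s nu) / \det (hankel_plus s nu)).

(* The size of s^(j-1) is l - 2 n_(j-1) + 1, that of s^(j) is
   size s - 2 nu = l - 2 n_j + 1.  The entry of index i of [schur_frak s nu] is
   the entry of index i - 1 of the Gothic sequence; the identity
   T(m_(nu-1), ..., m_0, - frak_(-1), ...) T(s_(nu-1), s_nu, ...) = I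
   puts it at the place nu + i of the first row of the inverse. *)
Definition schur_frak (s : seq R) (nu : nat) : seq R :=
  mkseq (fun i => - toeplitz_inv (fun p => s`_(nu.-1 + p)) (size s - nu)
                      (nu + i))
        (size s - 2 * nu).+1.

(* From T(l_j, - s_0^(j), ...) T(frak_(-1), ...) = I. *)
Definition schur_next (s : seq R) (nu : nat) : seq R :=
  mkseq (fun i => - toeplitz_inv (nth 0 (schur_frak s nu)) (size s - 2 * nu)
                      i.+1)
        (size s - 2 * nu).

Fixpoint schur_seq (s : seq R) (n : nat -> nat) (j : nat) : seq R :=
  if j is j'.+1 then schur_next (schur_seq s n j') (n j - n j') else s.

(* The polynomials m_j and the numbers l_j are indexed by 1 <= j <= N. *)
Definition mpol (s : seq R) (n : nat -> nat) (j : nat) : {poly R} :=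
  schur_m (schur_seq s n j.-1) (n j - n j.-1).

Definition lnum (s : seq R) (n : nat -> nat) (j : nat) : R :=
  schur_l (schur_seq s n j.-1) (n j - n j.-1).

Definition Mmx (s : seq R) (n : nat -> nat) (j : nat) (z : C) : 'M[C]_2 :=
  mx2 1 0 (- (z * poly_eval (mpol s n j) z)) 1.

Definition Lmx (s : seq R) (n : nat -> nat) (j : nat) : 'M[C]_2 :=
  mx2 1 (lnum s n j)%:C 0 1.

(* The product is ordered: M_1 L_1 M_2 L_2 ... M_N L_N. *)
Definition Wmx (s : seq R) (n : nat -> nat) (N : nat) (z : C) : 'M[C]_2 :=
  \prod_(1 <= j < N.+1) (Mmx s n j z *m Lmx s n j).

(* 1 / (- z m_1 + 1 / (l_1 + ... + 1 / (- z m_N + 1 / (l_N + t)))) *)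
Definition cfrac (s : seq R) (n : nat -> nat) (N : nat) (z : C)
    (t : option C) : option C :=
  foldr (fun j w =>
           sphere_inv (sphere_add (- (z * poly_eval (mpol s n j) z))
             (sphere_inv (sphere_add (lnum s n j)%:C w))))
        t (iota 1 N).

End Hankel.

(* Main.v *)
Require Import Defs.
From mathcomp Require Import all_boot all_order all_algebra.
From mathcomp Require Import all_classical all_reals all_analysis.
From mathcomp Require Import polyrcf complex.
From mathcomp Require Import ring lra zify.
Import Order.TTheory GRing.Theory Num.Theory.
Import numFieldNormedType.Exports.
Local Open Scope classical_set_scope.
Local Open Scope ring_scope.

Set Implicit Arguments.
Unset Strict Implicit.
Unset Printing Implicit Defensive.

(** A solution f and its parameter tau are linked by N steps
      f_(j-1) = 1 / (- z m_j + 1 / (l_j + f_j)),   f_0 = f,   f_N = tau,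
    and everything is shown for one step and iterated along the chain.

    Indices.  A step consists of adding the number l, applying w |-> - 1 / w,
    adding the polynomial z m, and applying w |-> - 1 / w again.  The map
    f |-> - 1 / f acts on the kernel by a congruence and keeps the index
    ([neg_index_ninv]).  Adding a polynomial P to a function that is o(z) on the
    imaginary axis raises the index by kappa_-(P) ([neg_index_padd]): the form of
    P lives on points near infinity, where the other kernel is negligible.  The
    function z f(z) undergoes the same kind of step with the polynomials m and
    z l.  Hence a step raises the two indices by kappa_-(z m) and by
    kappa_-(m) + kappa_-(z l) ([solves_step]), and it can be undone
    ([solves_unstep]).  In order that - 1 / f be meromorphic the zeros of f have
    to be isolated.  They are even finite in number in the upper half-plane,
    because m zeros together with m points where f is not zero give m negative
    squares ([has_negs_zeros]).

    Expansions.  In the variable u = 1 / z the Schur recursion is one congruence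
    modulo a power of u between the generating polynomials of two consecutive
    sequences ([schur_step_data]).  It shows that f_(j-1) has the expansion given
    by the sequence s^(j-1) if and only if f_j has the one given by s^(j)
    ([expands_stepW], [expands_step_inv]).  It also shows, through Pade
    approximation, that the Hankel determinants of the two sequences vanish for
    corresponding orders ([pade_step]), so that the recursion can go on.  After
    the last step the condition that remains is tau(i y) -> 0.  For a function of
    bounded index this is the nontangential condition, as each far point of a
    sector where |tau| is not small adds a negative square ([has_negs_far],
    [bounded_nontangential]).

    The numbers kappa_N and k_N^+.  The chain that ends with tau = 0 has the
    prescribed moments and the sums in the formulas as its indices.  Moments bound
    the number of negative eigenvalues of the Hankel matrix by the index
    ([has_negs_hankel]).  The same bound holds for the opposite function, whose
    chain has the blocks (- m_j, - l_j).  As kappa_-(P) + kappa_-(- P) <= deg P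
    and the degrees add up to n_N, which is the number of all eigenvalues, all
    these inequalities are equalities ([nu_minus_hankel]).  Finally the problem is
    solvable as soon as both index differences are nonnegative, since parameters
    with arbitrary indices exist ([parameter_exists]). *)

(** * Negative squares of Hermitian matrices *)

Section HermitianForms.
Local Open Scope complex_scope.
Variable R : realType.
Local Notation C := R[i].
Local Notation cj := (@conjc R).

Definition adj m n (A : 'M[C]_(m, n)) : 'M[C]_(n, m) := map_mx (@conjc R) A^T.

Lemma adjM m n p (A : 'M[C]_(m, n)) (B : 'M[C]_(n, p)) :
  adj (A *m B) = adj B *m adj A.
Proof. by rewrite /adj trmx_mul map_mxM. Qed.

Lemma adjN m n (A : 'M[C]_(m, n)) : adj (- A) = - adj A.
Proof. by apply/matrixP => i j; rewrite !mxE rmorphN. Qed.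

Lemma adjK m n (A : 'M[C]_(m, n)) : adj (adj A) = A.
Proof. by apply/matrixP => i j; rewrite !mxE conjcK. Qed.

Definition form n (A : 'M[C]_n) (x : 'rV_n) : C := (x *m A *m adj x) 0 0.

Definition tolerance (m : nat) : C := (2 * m.+1)%:R^-1.

(** Such a matrix is still negative definite. Asking for an approximate
    identity instead of an exact one makes the number of negative squares
    visibly stable under limits, and a limit is the source of almost all the
    negative squares below. *)
Definition almost_neg1 m (G : 'M[C]_m) :=
  forall i j, `|G i j + (i == j)%:R| <= tolerance m.

Lemma formM m n (A : 'M[C]_n) (B : 'M[C]_(m, n)) (y : 'rV_m) :
  form A (y *m B) = form (B *m A *m adj B) y.
Proof. by rewrite /form adjM !mulmxA. Qed.

Lemma formE n (A : 'M[C]_n) (x : 'rV_n) :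
  form A x = \sum_i \sum_j x 0 i * A i j * cj (x 0 j).
Proof.
rewrite /form !mxE exchange_big /=; apply: eq_bigr => j _.
by rewrite !mxE mulr_suml; apply: eq_bigr => i _.
Qed.

(** By the inequality between geometric and arithmetic means the deviation from
    - |y| ^ 2 is at most (m / (2 (m + 1))) |y| ^ 2. *)
Lemma form_almost_neg1 m (G : 'M[C]_m) (y : 'rV_m) :
  almost_neg1 G -> 0 <= form G y -> y = 0.
Proof.
move=> Gneg G0; set t := tolerance m; pose N := \sum_i `|y 0 i| ^+ 2.
have N0 : 0 <= N by apply: sumr_ge0 => i _; rewrite exprn_ge0.
have le1 : `|form G y + N| <= t * m%:R * N.
  have -> : form G y + N =
      \sum_i \sum_j y 0 i * (G i j + (i == j)%:R) * cj (y 0 j).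
    rewrite formE /N -big_split /=; apply: eq_bigr => i _; symmetry.
    rewrite (eq_bigr (fun j => y 0 i * G i j * cj (y 0 j) +
        (if j == i then `|y 0 i| ^+ 2 else 0))); last first.
      move=> j _; rewrite mulrDr mulrDl [j == i]eq_sym; congr (_ + _).
      case: eqP => [->|_]; last by rewrite mulr0 mul0r.
      by rewrite mulr1 sqr_normc.
    by rewrite big_split /= -big_mkcond /= big_pred1_eq.
  have -> : t * m%:R * N =
      \sum_(i < m) \sum_(j < m) t * ((`|y 0 i| ^+ 2 + `|y 0 j| ^+ 2) / 2).
    transitivity (\sum_(i < m) t * ((`|y 0 i| ^+ 2 *+ m + N) / 2)).
      rewrite -mulr_sumr -mulr_suml big_split /= sumr_const card_ord.
      rewrite -mulrA; congr (_ * _).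
      rewrite -/N sumrMnl -/N.
      rewrite -mulr2n -[_ *+ 2]mulr_natr mulfK ?pnatr_eq0 //.
      by rewrite mulr_natl.
    apply: eq_bigr => i _; rewrite -mulr_sumr -mulr_suml big_split /=.
    by rewrite sumr_const card_ord.
  apply: (le_trans (ler_norm_sum _ _ _)); apply: ler_sum => i _.
  apply: (le_trans (ler_norm_sum _ _ _)); apply: ler_sum => j _.
  rewrite !normrM normcJ mulrAC [leLHS]mulrC.
  apply: ler_pM => //; rewrite ?mulr_ge0 //.
  have : 0 <= (`|y 0 i| - `|y 0 j|) ^+ 2.
    by apply: real_exprn_even_ge0; rewrite // rpredB // ger0_real.
  by rewrite sqrrB addrAC subr_ge0 -mulr_natl ler_pdivlMr ?ltr0n // mulrC.
have t1 : t * m%:R < 1.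
  rewrite mulrC ltr_pdivrMr ?ltr0n // mul1r ltr_nat.
  by rewrite mul2n -addnn addSn ltnS leq_addr.
have : N <= t * m%:R * N.
  by apply: le_trans le1; rewrite ger0_norm ?addr_ge0 // lerDr.
rewrite -subr_ge0 -{2}[N]mul1r -mulrBl => h.
have /eqP : N = 0.
  move: N0; rewrite le_eqVlt => /predU1P[<-//|Npos].
  by move: h; rewrite pmulr_lge0 // subr_ge0 => /(lt_le_trans t1); rewrite ltxx.
rewrite psumr_eq0 => [/allP z|i _]; last by rewrite exprn_ge0.
apply/rowP => i; rewrite !mxE; apply/eqP.
by have := z i; rewrite mem_index_enum sqrf_eq0 normr_eq0; apply.
Qed.

Definition has_neg n (A : 'M[C]_n) m :=
  exists B : 'M[C]_(m, n), almost_neg1 (B *m A *m adj B).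

Lemma kernel_vector m n (A : 'M[C]_(m, n)) : (n < m)%N ->
  exists2 y : 'rV_m, y != 0 & y *m A = 0.
Proof.
move=> nm; have /rowV0Pn[y /sub_kermxP yA y0] : kermx A != 0.
  rewrite -mxrank_eq0 mxrank_ker subn_eq0 -ltnNge.
  by rewrite (leq_ltn_trans (rank_leq_col A)).
by exists y.
Qed.

(** A dimension count: if k < m, some nonzero combination of the m negative
    directions satisfies the k linear conditions Q. *)
Lemma has_neg_le n (A : 'M[C]_n) m k (Q : 'M[C]_(n, k)) :
  (forall x : 'rV_n, x *m Q = 0 -> 0 <= form A x) -> has_neg A m -> (m <= k)%N.
Proof.
move=> AQ [B Bneg]; rewrite leqNgt; apply/negP => km.
have [y y0 yBQ] := kernel_vector (B *m Q) km.
have := AQ (y *m B); rewrite -mulmxA => /(_ yBQ); rewrite formM.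
by move=> /(form_almost_neg1 Bneg) /eqP; rewrite (negPf y0).
Qed.

Lemma form_real n (A : 'M[C]_n) (x : 'rV_n) : adj A = A ->
  form A x \is Num.real.
Proof.
move=> Aherm; rewrite /form; apply/CrealP.
have -> (z : C) : Num.conj z = (cj z) by [].
have : adj (x *m A *m adj x) = x *m A *m adj x.
  by rewrite !adjM adjK Aherm mulmxA.
by move=> /matrixP /(_ 0 0); rewrite mxE mxE.
Qed.

(** A subspace on which A is negative meets one on which A is positive only at
    the origin. *)
Lemma has_negD n (A : 'M[C]_n) m m' : adj A = A ->
  has_neg A m -> has_neg (- A) m' -> (m + m' <= n)%N.
Proof.
move=> Aherm [B Bneg] [B' Bneg']; rewrite leqNgt; apply/negP => lt.
have [y y0 yB] := kernel_vector (col_mx B B') lt.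
have eqf : form (- A) (rsubmx y *m B') = - form A (lsubmx y *m B).
  have -> : rsubmx y *m B' = - (lsubmx y *m B).
    apply/eqP; rewrite -addr_eq0 addrC -mul_row_col hsubmxK; exact/eqP.
  by rewrite /form adjN !(mulNmx, mulmxN) !opprK mxE.
have l_eq0 : 0 <= form A (lsubmx y *m B) -> lsubmx y = 0.
  by rewrite formM => /(form_almost_neg1 Bneg).
have r_eq0 : 0 <= form (- A) (rsubmx y *m B') -> rsubmx y = 0.
  by rewrite formM => /(form_almost_neg1 Bneg').
have form0 (D : 'M[C]_n) : form D 0 = 0 by rewrite /form !mul0mx mxE.
suff [l0 r0] : lsubmx y = 0 /\ rsubmx y = 0.
  by move/eqP: y0; apply; rewrite -[y]hsubmxK l0 r0 row_mx0.
have /orP[ge0|le0] := form_real (lsubmx y *m B) Aherm.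
  have l0 := l_eq0 ge0; split=> //; apply: r_eq0.
  by rewrite eqf l0 mul0mx form0 oppr0.
have r0 : rsubmx y = 0 by apply: r_eq0; rewrite eqf oppr_ge0.
split=> //; apply: l_eq0; rewrite -[form _ _]opprK -eqf r0 mul0mx form0.
by rewrite oppr0.
Qed.

Lemma form_diag n (P : 'M[C]_n) (d : 'rV[R]_n) (x : 'rV_n) :
  form (P *m diag_mx (map_mx (real_complex R) d) *m adj P) x =
  \sum_i (d 0 i)%:C * `|(x *m P) 0 i| ^+ 2.
Proof.
rewrite -formM formE; apply: eq_bigr => i _.
rewrite (bigD1 i) //= big1 ?addr0 => [|j ji].
  by rewrite !mxE eqxx mulr1n mulrAC sqr_normc mulrC mulrA.
by rewrite !mxE eq_sym (negPf ji) mulr0n mulr0 mul0r.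
Qed.

Lemma diag_ker n (P : 'M[C]_n) (d : 'rV[R]_n) :
  exists Q : 'M[C]_(n, #|[set i | (d 0 i < 0)%R]%SET|),
    forall x : 'rV_n, x *m Q = 0 ->
      0 <= form (P *m diag_mx (map_mx (real_complex R) d) *m adj P) x.
Proof.
set D := [set i | _]%SET.
exists (colsub (fun j : 'I_#|D| => enum_val j) P) => x xQ.
rewrite form_diag; apply: sumr_ge0 => i _.
have [di|di] := ltP (d 0 i) 0; last first.
  by rewrite mulr_ge0 ?exprn_ge0 // ler0c.
have iD : i \in D by rewrite inE.
suff -> : (x *m P) 0 i = 0 by rewrite normr0 expr0n mulr0.
move: xQ => /matrixP /(_ 0 (enum_rank_in iD i)); rewrite !mxE => {2}<-.
by apply: eq_bigr => k _; rewrite !mxE enum_rankK_in.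
Qed.

Lemma diag_no_neg n (P : 'M[C]_n) (d : 'rV[R]_n) m :
  has_neg (P *m diag_mx (map_mx (real_complex R) d) *m adj P) m ->
  (m <= #|[set i | (d 0 i < 0)%R]%SET|)%N.
Proof. by have [Q hQ] := diag_ker P d; apply: has_neg_le hQ. Qed.

Lemma diag_has_neg n (P : 'M[C]_n) (d : 'rV[R]_n) m : P \in unitmx ->
  (m <= #|[set i | (d 0 i < 0)%R]%SET|)%N ->
  exists B : 'M[C]_(m, n),
    B *m (P *m diag_mx (map_mx (real_complex R) d) *m adj P) *m adj B = - 1%:M.
Proof.
set D := [set i | _]%SET => Pu mD.
pose f (k : 'I_m) : 'I_n := enum_val (widen_ord mD k).
have fD k : d 0 (f k) < 0.
  by have := enum_valP (widen_ord mD k); rewrite inE.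
pose E : 'M[C]_(m, n) :=
  \matrix_(k, i) ((Num.sqrt (- d 0 (f k)))^-1 *+ (f k == i))%:C.
exists (E *m invmx P); rewrite adjM !mulmxA mulmxKV //.
rewrite -[X in X *m adj E]mulmxA -[adj P *m _]adjM mulVmx //.
have -> : adj (1%:M : 'M[C]_n) = 1%:M.
  by apply/matrixP => i j; rewrite !mxE eq_sym conjc_nat.
rewrite mulmx1; apply/matrixP => k l; rewrite !mxE (bigD1 (f k)) //=.
rewrite big1 ?addr0 => [|i ik]; last first.
  rewrite !mxE; suff -> : \sum_j E k j * (diag_mx (map_mx (real_complex R) d)) j i = 0.
    by rewrite mul0r.
  rewrite big1 // => j _; rewrite !mxE.
  have [fkj|jk] := eqVneq (f k) j; last by rewrite mulr0n mul0r.
  by move: ik; rewrite eq_sym fkj => /negPf ->; rewrite mulr0n mulr0.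
rewrite !mxE (bigD1 (f k)) //= big1 ?addr0 => [|i ik]; last first.
  by rewrite !mxE eq_sym (negPf ik) mulr0n mul0r.
rewrite !mxE !eqxx !mulr1n.
have -> : (f l == f k) = (k == l).
  apply/eqP/eqP => [|->//].
  by move=> /enum_val_inj /(congr1 val) /= lk; apply: val_inj.
have cr (x : R) : x -i* 0 = x%:C by rewrite oppr0.
case: eqP => [<-|_]; last first.
  by rewrite !mulr0n cr mulr0 oppr0.
rewrite !mulr1n cr -!rmorphM -[1]/(1%:C) -rmorphN; congr (_%:C).
rewrite mulrAC -invfM -expr2 sqr_sqrtr ?oppr_ge0 ?ltW // mulrC.
by rewrite invrN mulrN divff // lt_eqF.
Qed.

Lemma hermitian_diag n (A : 'M[C]_n) : adj A = A ->
  exists (P : 'M[C]_n) (d : 'rV[R]_n), [/\ P \in unitmx, adj P = invmx P &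
    A = P *m diag_mx (map_mx (real_complex R) d) *m adj P].
Proof.
move=> Aherm.
have Ah : A \is hermsymmx.
  apply/is_hermitianmxP; rewrite expr0 scale1r -{1}Aherm /adj.
  by apply/matrixP => i j; rewrite !mxE.
have /orthomx_spectralP Aeq := hermitian_normalmx Ah.
have dre := hermitian_spectral_diag_real Ah.
have Uu := spectral_unit A.
have adjU : adj (invmx (spectralmx A)) = spectralmx A.
  rewrite invmx_unitary ?spectral_unitarymx //.
  by apply/matrixP => i j; rewrite !mxE; exact: conjcK.
exists (invmx (spectralmx A)), (map_mx (@complex.Re R) (spectral_diag A)).
split; [by rewrite unitmx_inv|by rewrite adjU invmxK|].
rewrite -map_mx_comp.
have -> : map_mx (real_complex R \o @complex.Re R) (spectral_diag A) =
    spectral_diag A.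
  apply/matrixP => i j; rewrite mxE /= RRe_real //.
  exact: (mxOverP dre).
by rewrite adjU; exact: Aeq.
Qed.

(** This is Sylvester's law of inertia, in the form in which it is used: the
    number of negative squares of A is the largest m with [has_neg A m]. *)
Lemma negative_squaresP n (A : 'M[C]_n) q : negative_squares A q ->
  forall m, has_neg A m <-> (m <= q)%N.
Proof.
move=> [P [d [Pu -> <-]]] m; split; first exact: diag_no_neg.
move=> /(diag_has_neg Pu)[B BE]; exists B => i j.
by rewrite -/(adj P) BE !mxE addNr normr0 invr_ge0 ler0n.
Qed.

Lemma hermitian_negative_squares n (A : 'M[C]_n) : adj A = A ->
  exists q, negative_squares A q.
Proof.
move=> /hermitian_diag[P [d [Pu _ Aeq]]].
by exists #|[set i | (d 0 i < 0)%R]%SET|, P, d; split.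
Qed.

Lemma has_neg_exact n (A : 'M[C]_n) m : adj A = A -> has_neg A m ->
  exists B : 'M[C]_(m, n), B *m A *m adj B = - 1%:M.
Proof.
move=> /hermitian_diag[P [d [Pu _ ->]]] /diag_no_neg; exact: diag_has_neg.
Qed.

(** Each form is nonnegative on a subspace whose codimension is its number of
    negative squares, and the sum is nonnegative on the intersection. *)
Lemma has_neg_sum n (A A' : 'M[C]_n) m b b' : adj A = A -> adj A' = A' ->
  (forall k, has_neg A k -> (k <= b)%N) ->
  (forall k, has_neg A' k -> (k <= b')%N) ->
  has_neg (A + A') m -> (m <= b + b')%N.
Proof.
have ker (D : 'M[C]_n) c : adj D = D -> (forall k, has_neg D k -> (k <= c)%N) ->
    exists2 q, (q <= c)%N & exists Q : 'M[C]_(n, q),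
      forall x : 'rV_n, x *m Q = 0 -> 0 <= form D x.
  move=> /hermitian_diag[P [d [Pu _ ->]]] Dc.
  exists #|[set i | (d 0 i < 0)%R]%SET|; last exact: diag_ker.
  have [B BE] := diag_has_neg Pu (leqnn #|[set i | (d 0 i < 0)%R]%SET|).
  apply: Dc; exists B => i j.
  by rewrite BE !mxE addNr normr0 invr_ge0 ler0n.
move=> hA hA' /(ker _ _ hA)[q qb [Q hQ]] /(ker _ _ hA')[q' qb' [Q' hQ']] h.
apply: leq_trans (leq_add qb qb').
apply: (has_neg_le (Q := row_mx Q Q') _ h) => x; rewrite mul_mx_row -[0]hsubmxK => /eq_row_mx[].
rewrite !linear0 => xQ xQ'.
have -> : form (A + A') x = form A x + form A' x.
  by rewrite /form mulmxDr mulmxDl mxE.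
by rewrite addr_ge0 ?hQ ?hQ'.
Qed.

End HermitianForms.

(** * The number of negative squares of a function *)

Section NegativeIndex.
Local Open Scope complex_scope.
Variable R : realType.
Local Notation C := R[i].
Local Notation cj := (@conjc R).
Local Notation sfun := (C -> option C).

Definition kernel (f : sfun) (z w : C) : C :=
  (fin_part (f z) - cj (fin_part (f w))) / (z - cj w).

Definition gram (K : C -> C -> C) (T : finType) (z : T -> C) (b c : T -> C) :
    C :=
  \sum_x \sum_y b x * K (z x) (z y) * cj (c y).

(** The points may be repeated and the families are indexed by arbitrary finite
    types, so that two families can be united without any renumbering. *)
Definition has_negs (f : sfun) (m : nat) :=
  exists (I T : finType) (z : T -> C) (B : I -> T -> C),
    [/\ #|I| = m, forall x, upper (z x) /\ f (z x) != None
      & forall i j, `|gram (kernel f) z (B i) (B j) + (i == j)%:R|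
                      <= tolerance R m].

Definition neg_index (f : sfun) (kappa : nat) :=
  forall m, has_negs f m <-> (m <= kappa)%N.

Lemma kernelC f z w : cj (kernel f z w) = kernel f w z.
Proof.
rewrite /kernel rmorphM /= fmorphV /= !rmorphB /= !conjcK.
by rewrite -opprB -[cj z - w]opprB invrN mulrNN.
Qed.

Lemma pick_matrix_herm f n (z : 'I_n -> C) :
  adj (pick_matrix f z) = pick_matrix f z.
Proof. by apply/matrixP => i j; rewrite !mxE -[RHS]kernelC. Qed.

Lemma gram_ord (K : C -> C -> C) n (z : 'I_n -> C) m (B : 'M[C]_(m, n)) i j :
  (B *m (\matrix_(k, l) K (z k) (z l)) *m adj B) i j =
  gram K z (B i) (B j).
Proof.
rewrite !mxE /gram exchange_big /=; apply: eq_bigr => l _.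
by rewrite !mxE mulr_suml; apply: eq_bigr => k _; rewrite !mxE.
Qed.

(** Repeated points can be merged by adding up their coefficients. *)
Lemma gram_map (K : C -> C -> C) (T U : finType) (g : T -> U) (z : U -> C)
    (b c : T -> C) :
  gram K (z \o g) b c =
  gram K z (fun u => \sum_(x | g x == u) b x)
           (fun u => \sum_(x | g x == u) c x).
Proof.
rewrite /gram (partition_big g xpredT) //=; apply: eq_bigr => u _.
transitivity (\sum_(x | g x == u) \sum_v \sum_(y | g y == v)
    b x * K (z u) (z v) * (cj (c y))).
  apply: eq_bigr => x /eqP gx; rewrite (partition_big g xpredT) //=.
  by apply: eq_bigr => v _; apply: eq_bigr => y /eqP gy; rewrite gx gy.
rewrite exchange_big /=; apply: eq_bigr => v _.
rewrite rmorph_sum mulr_sumr exchange_big; apply: eq_bigr => y _.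
by rewrite !mulr_suml.
Qed.

Lemma has_negs_pick f m : has_negs f m <->
  exists n (z : 'I_n -> C), pick_points f z /\ has_neg (pick_matrix f z) m.
Proof.
split=> [[I [T [z [B [Im zf Bneg]]]]]|[n [z [[_ zf] [B Bneg]]]]]; last first.
  exists 'I_m, 'I_n, z, (fun i => B i); split=> //; first by rewrite card_ord.
  by move=> i j; rewrite -gram_ord; exact: Bneg.
pose s := undup (codom z).
have zs x : z x \in s by rewrite mem_undup codom_f.
pose z' (k : 'I_(size s)) := s`_k.
pose g x : 'I_(size s) := Ordinal (eq_ind _ is_true (zs x) _ (esym (index_mem _ _))).
have zE : z = z' \o g by apply: funext => x; rewrite /= /z' nth_index.
exists (size s), z'; split; first split.
- move=> k l /eqP; rewrite /z' nth_uniq ?undup_uniq //.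
  by move=> /eqP; exact: val_inj.
- move=> k; have /codomP[x zx] : z' k \in codom z.
    by rewrite -mem_undup mem_nth.
  by rewrite zx.
case: m / Im Bneg => Bneg.
exists (\matrix_(i, k) \sum_(x | g x == k) B (enum_val i) x) => i j.
have -> : pick_matrix f z' = \matrix_(k, l) kernel f (z' k) (z' l) by [].
have := Bneg (enum_val i) (enum_val j).
rewrite (inj_eq enum_val_inj) gram_ord zE gram_map; congr (`|_ + _| <= _).
by rewrite /gram; apply: eq_bigr => k _; apply: eq_bigr => l _; rewrite !mxE.
Qed.

Lemma has_negs_exact f m : has_negs f m ->
  exists (T : finType) (z : T -> C) (B : 'I_m -> T -> C),
    (forall x, upper (z x) /\ f (z x) != None) /\
    forall i j, gram (kernel f) z (B i) (B j) = - (i == j)%:R.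
Proof.
move=> /has_negs_pick[n [z [[_ zf] hn]]].
have [B BE] := has_neg_exact (pick_matrix_herm f z) hn.
exists 'I_n, z, (fun i => B i); split=> // i j.
by rewrite -gram_ord -/(pick_matrix f z) BE !mxE.
Qed.

Lemma has_negs0 f : has_negs f 0.
Proof.
apply/has_negs_pick; exists 0%N, (fun _ => 0); split.
  by split=> [[]|[]].
by exists 0; case.
Qed.

Lemma has_negs_le f m m' : (m' <= m)%N -> has_negs f m -> has_negs f m'.
Proof.
move=> mm' /has_negs_exact[T [z [B [zf BE]]]].
exists 'I_m', T, z, (fun i => B (widen_ord mm' i)); split=> //.
  by rewrite card_ord.
move=> i j; rewrite BE -(inj_eq val_inj) /= (inj_eq val_inj) addNr normr0.
by rewrite invr_ge0 ler0n.
Qed.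

Lemma neg_index_uniq f k k' : neg_index f k -> neg_index f k' -> k = k'.
Proof.
move=> hk hk'; apply/eqP; rewrite eqn_leq.
by rewrite -(rwP andP); split; [apply/hk'/hk|apply/hk/hk'].
Qed.

Lemma neg_index_exists f b : (forall m, has_negs f m -> (m <= b)%N) ->
  exists k, neg_index f k.
Proof.
move=> hb.
have ex0 : exists m, `[< has_negs f m >].
  by exists 0%N; apply/asboolP/has_negs0.
have hb' m : `[< has_negs f m >] -> (m <= b)%N by move=> /asboolP /hb.
case: (ex_maxnP ex0 hb') => k /asboolP hk kmax.
exists k => m; split=> [hm|/has_negs_le]; last by apply.
by apply: kmax; apply/asboolP.
Qed.

(** The exact diagonalizations of the definition are traded for [neg_index],
    which only compares numbers of approximate negative squares. *)
Lemma gen_nevanlinnaE kappa f : gen_nevanlinna kappa f <->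
  [/\ meromorphic f, real_symmetric f & neg_index f kappa].
Proof.
split=> [[fm fs fle [n [z [zf fk]]]]|[fm fs fi]]; split=> //.
- move=> m; split.
    move=> /has_negs_pick[p [w [wf wm]]].
    have [q qk /negative_squaresP wq] := fle p w wf.
    by apply: leq_trans qk; apply/wq.
  move=> mk; apply/has_negs_pick; exists n, z; split=> //.
  exact/(negative_squaresP fk).
- move=> n z zf.
  have [q hq] := hermitian_negative_squares (pick_matrix_herm f z).
  exists q => //; apply/fi/has_negs_pick; exists n, z; split=> //.
  exact/(negative_squaresP hq).
- have /has_negs_pick[n [z [zf hn]]] : has_negs f kappa by apply/fi.
  exists n, z; split=> //.
  have [q hq] := hermitian_negative_squares (pick_matrix_herm f z).
  suff -> : kappa = q by [].
  apply/eqP; rewrite eqn_leq; apply/andP; split.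
    exact/(negative_squaresP hq).
  apply/fi/has_negs_pick; exists n, z; split=> //.
  exact/(negative_squaresP hq).
Qed.

End NegativeIndex.

(** * Limits of complex functions, meromorphic functions on the sphere *)

Section ComplexLimits.
Local Open Scope complex_scope.
Variable R : realType.
Local Notation C := R[i].
Local Notation cj := (@conjc R).
Variables (U : Type) (F : set_system U).
Context {FF : Filter F}.

Definition cvgc (u : U -> C) (l : C) := (u : U -> C^o) @ F --> (l : C^o).

Lemma cvg_conjc (u : U -> C) (l : C) : cvgc u l ->
  cvgc (fun x => cj (u x)) (cj l).
Proof.
move=> /cvgrPdist_le ul; apply/cvgrPdist_le => e e0.
by apply: filterS (ul e e0) => x; rewrite -rmorphB normcJ.
Qed.

Lemma conjcM (x y : C) : cj (x * y) = cj x * cj y.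
Proof. exact: rmorphM. Qed.

Lemma posc_real (e : C) : 0 < e -> e = (complex.Re e)%:C /\ 0 < complex.Re e.
Proof.
move=> e0; have re : (complex.Re e)%:C = e by rewrite RRe_real // gtr0_real.
by split=> //; rewrite -ltcR re.
Qed.

Lemma normcR (x : R) : `|x%:C| = `|x|%:C.
Proof. by rewrite normc_def /= expr0n addr0 sqrtr_sqr. Qed.

Lemma cvg_realc (u : U -> R) (l : R) : u @ F --> l ->
  cvgc (fun x => (u x)%:C) l%:C.
Proof.
move=> /cvgrPdist_le ul; apply/cvgrPdist_le => e /posc_real[-> e0].
by apply: filterS (ul _ e0) => x; rewrite -rmorphB normcR lecR.
Qed.

Lemma cvgc_cst l : cvgc (fun=> l) l.
Proof. exact: cvg_cst. Qed.

Lemma cvgcD u v l m : cvgc u l -> cvgc v m -> cvgc (fun x => u x + v x) (l + m).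
Proof. exact: (@cvgD _ (C^o)). Qed.

Lemma cvgcN u l : cvgc u l -> cvgc (fun x => - u x) (- l).
Proof. exact: (@cvgN _ (C^o)). Qed.

Lemma cvgcB u v l m : cvgc u l -> cvgc v m -> cvgc (fun x => u x - v x) (l - m).
Proof. exact: (@cvgB _ (C^o)). Qed.

Lemma cvgcM u v l m : cvgc u l -> cvgc v m -> cvgc (fun x => u x * v x) (l * m).
Proof. exact: cvgM. Qed.

Lemma cvgcV u l : l != 0 -> cvgc u l -> cvgc (fun x => (u x)^-1) l^-1.
Proof. exact: cvgV. Qed.

Lemma cvgcX u l k : cvgc u l -> cvgc (fun x => u x ^+ k) (l ^+ k).
Proof.
move=> ul; elim: k => [|k IH]; first by rewrite expr0; exact: cvgc_cst.
rewrite exprS; have -> : (fun x => u x ^+ k.+1) = (fun x => u x * u x ^+ k).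
  by apply: funext => x; rewrite exprS.
exact: cvgcM.
Qed.

Lemma cvgc_eq u v l : (\forall x \near F, u x = v x) -> cvgc u l -> cvgc v l.
Proof. by move=> uv; apply: cvg_trans; apply: near_eq_cvg. Qed.

Lemma cvgc_le u l (e : R) : cvgc u l -> 0 < e ->
  \forall x \near F, `|u x - l| <= e%:C.
Proof.
move=> /cvgrPdist_le ul e0; have e0' : 0 < e%:C by rewrite ltcR.
by apply: filterS (ul _ e0') => x; rewrite distrC.
Qed.

Lemma cvgc_neq u l a : cvgc u l -> l != a -> \forall x \near F, u x != a.
Proof.
move=> /cvgrPdist_lt ul la.
have e0 : 0 < `|l - a| by rewrite normr_gt0 subr_eq0.
by apply: filterS (ul _ e0) => x; case: eqP => // ->; rewrite ltxx.
Qed.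

Lemma cvg_sumc (I : finType) (u : I -> U -> C) (l : I -> C) :
  (forall i, cvgc (u i) (l i)) -> cvgc (fun x => \sum_i u i x) (\sum_i l i).
Proof.
move=> ul; have := (@cvg_big (C^o) I +%R 0 xpredT (@add_continuous (C^o))
  U F (index_enum I) u l FF (fun i _ => ul i)).
by [].
Qed.

End ComplexLimits.
Arguments cvgc_cst {R U F FF} l.

Section Halfplanes.
Local Open Scope complex_scope.
Variable R : realType.
Local Notation C := R[i].
Local Notation cj := (@conjc R).

Lemma normc_ge_Im (x : C) : `|complex.Im x|%:C <= `|x|.
Proof.
have := normc_ge_Re (x * 'i); rewrite normrM (normc_def (0 +i* 1)) /= expr0n expr1n add0r sqrtr1 mulr1.
by rewrite ReiNIm normrN.
Qed.

Lemma near_Im (z : C) (e : R) : 0 < e ->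
  \forall w \near (z : C^o), `|complex.Im z - complex.Im w| < e.
Proof.
move=> e0; have e0' : 0 < e%:C by rewrite ltcR.
have zz : (id : C^o -> C^o) @ (z : C^o) --> (z : C^o) by apply: cvg_id.
move/cvgrPdist_lt: zz => /(_ _ e0').
apply: filterS => w; rewrite -ltcR => /(le_lt_trans _); apply.
by rewrite -raddfB /= normc_ge_Im.
Qed.

Lemma near_nonreal (z : C) : nonreal z ->
  \forall w \near (z : C^o), nonreal w.
Proof.
move=> z0; have e0 : 0 < `|complex.Im z| by rewrite normr_gt0.
apply: filterS (near_Im z e0) => w; rewrite /nonreal.
by case: eqP => // ->; rewrite subr0 ltxx.
Qed.

Lemma near_upper (z : C) : upper z -> \forall w \near (z : C^o), upper w.
Proof.
move=> z0; apply: filterS (near_Im z z0) => w; rewrite /upper => h.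
by have := le_lt_trans (ler_norm _) h; rewrite ltrBlDl ltrDr.
Qed.

Lemma upper_nonreal (z : C) : upper z -> nonreal z.
Proof. by move=> /gt_eqF; rewrite /nonreal => ->. Qed.

Lemma nonreal_neq0 (z : C) : nonreal z -> z != 0.
Proof. by apply: contra => /eqP ->. Qed.

Lemma nonreal_conj (z : C) : nonreal z -> nonreal (cj z).
Proof. by case: z => a b; rewrite /nonreal /= oppr_eq0. Qed.

Lemma upper_subJ (z w : C) : upper z -> upper w -> z - cj w != 0.
Proof.
case: z w => [a b] [c d]; rewrite /upper /= => b0 d0.
rewrite eq_complex /= opprK negb_and; apply/orP; right.
by rewrite gt_eqF // addr_gt0.
Qed.

Lemma cvg_up (z : C) :
  ((fun t : R => z + 0 +i* t) : R -> C^o) @ 0^'+ --> (z : C^o).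
Proof.
have -> : (fun t : R => z + 0 +i* t) = (fun t : R => z + 'i * t%:C).
  by apply: funext => t; congr (z + _); simpc.
rewrite -[X in _ --> (X : C^o)]addr0 -(mulr0 'i).
apply: (@cvgD _ (C^o)); first exact: cvg_cst.
apply: (@cvgM C _ 0^'+ _ (fun=> 'i) (fun t => t%:C)); first exact: cvg_cst.
by apply: cvg_realc; apply: cvg_within.
Qed.

Lemma near_up (P : C -> Prop) (z : C) : (\forall w \near (z : C^o)^', P w) ->
  \forall t \near (0 : R)^'+, P (z + 0 +i* t).
Proof.
move=> zP0; have zP : \forall t \near (0 : R)^'+, z + 0 +i* t != z -> P (z + 0 +i* t).
  exact: cvg_up zP0.
have pos : \forall t \near (0 : R)^'+, 0 < t by apply: nbhs_right_gt.
apply: filterS2 zP pos => t /= h t0; apply: h.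
rewrite -subr_eq0 addrAC subrr add0r eq_complex /= negb_and.
by rewrite orbC gt_eqF.
Qed.

End Halfplanes.

Section Meromorphic.
Local Open Scope complex_scope.
Variable R : realType.
Local Notation C := R[i].
Local Notation cj := (@conjc R).
Local Notation sfun := (C -> option C).
Implicit Types (f g : sfun) (h p : C -> C) (z w : C) (s t : option C).

(** Unlike 1 / f, the function - 1 / f has the same index as f. *)
Definition ninv s : option C :=
  if s is Some a then (if a == 0 then None else Some (- a^-1)) else Some 0.

Lemma ninvK : involutive ninv.
Proof.
case=> [a|] /=; last by rewrite eqxx.
have [->//|a0] := eqVneq a 0; rewrite /= oppr_eq0 invr_eq0 (negPf a0).
by rewrite invrN invrK opprK.
Qed.

Lemma sphere_addNK a : cancel (@sphere_add C a) (sphere_add (- a)).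
Proof. by case=> //= b; rewrite addKr. Qed.

Lemma sphere_invN s : sphere_inv (ninv s) = sphere_scale (-1) s.
Proof.
case: s => [a|] /=; last by rewrite eqxx.
have [->|a0] := eqVneq a 0; first by rewrite /= mulr0.
by rewrite /= oppr_eq0 invr_eq0 (negPf a0) invrN invrK mulN1r.
Qed.

Lemma ninvE s : ninv s = sphere_scale (-1) (sphere_inv s).
Proof.
by case: s => [a|] //=; rewrite ?mulr0 //; case: eqP; rewrite //= mulN1r.
Qed.

Lemma near_all (P : C -> Prop) z : (forall w, P w) ->
  \forall w \near (z : C^o), P w.
Proof. by move=> h; apply: filterS (@filterT _ (nbhs (z : C^o)) _). Qed.

Lemma holomorphic_atI f p z :
  (\forall w \near (z : C^o), f w = Some (p w) /\
     derivable (p : C^o -> C^o) w 1) -> holomorphic_at f z.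
Proof.
move=> h; have := near_join h; apply: filterS2 (h) => w [fw pw] hw.
split; first by rewrite fw.
apply: near_eq_derivable pw; apply: filterS hw => v [fv _] /=.
by rewrite /= fv.
Qed.

Lemma holomorphic_atE f z : holomorphic_at f z ->
  \forall w \near (z : C^o), f w = Some (fin_part (f w)) /\
     derivable (@fin_part R \o f : C^o -> C^o) w 1.
Proof. by apply: filterS => w [fw dw]; split=> //; case: (f w) fw. Qed.

Lemma derivable_cvg p z : derivable (p : C^o -> C^o) z 1 ->
  (p : C^o -> C^o) @ (z : C^o) --> (p z : C^o).
Proof. by move=> /derivable1_diffP /differentiable_continuous. Qed.

Lemma holomorphic_cvg f z : holomorphic_at f z ->
  (@fin_part R \o f : C^o -> C^o) @ (z : C^o) --> (fin_part (f z) : C^o).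
Proof. by move=> /nbhs_singleton[_ /derivable_cvg]. Qed.

Lemma near_neq p z a : (p : C^o -> C^o) @ (z : C^o) --> (p z : C^o) ->
  p z != a -> \forall w \near (z : C^o), p w != a.
Proof.
move=> pz pza; have e0 : 0 < `|p z - a| by rewrite normr_gt0 subr_eq0.
move/cvgrPdist_lt: pz => /(_ _ e0); apply: filterS => w; case: eqP => // ->.
by rewrite ltxx.
Qed.

Lemma holomorphic_at_eq f g z : (\forall w \near (z : C^o), f w = g w) ->
  holomorphic_at f z -> holomorphic_at g z.
Proof.
move=> fg /holomorphic_atE fh; apply: (@holomorphic_atI _ (@fin_part R \o f)).
by apply: filterS2 fg fh => w <-.
Qed.

Lemma near_dnbhs (P : C -> Prop) z : (\forall w \near (z : C^o), P w) ->
  \forall w \near (z : C^o)^', P w.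
Proof. by move=> h; apply: filterS h => w Pw _. Qed.

Lemma meromorphic_eq f g : (forall z, nonreal z -> f z = g z) ->
  meromorphic f -> meromorphic g.
Proof.
move=> fg fm z z0.
have fgz : \forall w \near (z : C^o), f w = g w.
  by apply: filterS (near_nonreal z0) => w /fg.
case: (fm z z0) => [fh|[fz fw fi]]; [left|right].
  exact: holomorphic_at_eq fh.
split; first by rewrite -fg.
- by apply: filterS2 (near_dnbhs fgz) fw => w ->.
- by apply: holomorphic_at_eq fi; apply: filterS fgz => w ->.
Qed.

Lemma meromorphic_near f z : meromorphic f -> nonreal z ->
  \forall w \near (z : C^o)^', f w != None.
Proof.
move=> fm /fm[/holomorphic_atE fh|[]//]; apply: near_dnbhs.
by apply: filterS fh => w [-> _].
Qed.

Lemma meromorphic_hol f z : meromorphic f -> nonreal z -> f z != None ->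
  holomorphic_at f z.
Proof.
move=> fm z0; case: (fm z z0) => [fh _|[fz _ _]]; first exact: fh.
by rewrite fz eqxx.
Qed.

Lemma holomorphic_scale f h z :
  (\forall w \near (z : C^o), derivable (h : C^o -> C^o) w 1) ->
  holomorphic_at f z -> holomorphic_at (fun w => sphere_scale (h w) (f w)) z.
Proof.
move=> hd /holomorphic_atE fh.
apply: (@holomorphic_atI _ (fun w => h w * fin_part (f w))).
by apply: filterS2 hd fh => w hw [-> fd]; split; [by []|exact: (derivableM hw fd)].
Qed.

Lemma holomorphic_inv f z : holomorphic_at f z -> f z != Some 0 ->
  holomorphic_at (fun w => sphere_inv (f w)) z.
Proof.
move=> fh fz.
have fz0 : fin_part (f z) != 0.
  by have [fE _] := nbhs_singleton (holomorphic_atE fh); move: fz; rewrite fE.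
have fw0 := near_neq (holomorphic_cvg fh) fz0.
apply: (@holomorphic_atI _ (fun w => (fin_part (f w))^-1)).
apply: filterS2 fw0 (holomorphic_atE fh) => w /= w0 [fw fd].
by split; [rewrite {1}fw /= (negPf w0)|exact: (derivableV w0 fd)].
Qed.

Lemma meromorphic_scale f h :
  (forall z, derivable (h : C^o -> C^o) z 1) ->
  (forall z, nonreal z -> h z != 0) -> meromorphic f ->
  meromorphic (fun z => sphere_scale (h z) (f z)).
Proof.
move=> hd h0 fm z z0.
case: (fm z z0) => [fh|[fz fw fi]]; [left|right].
  have hdz : \forall w \near (z : C^o), derivable (h : C^o -> C^o) w 1.
    exact: near_all hd.
  exact: holomorphic_scale hdz fh.
split; first by rewrite fz.
  by apply: filterS fw => w /=; case: (f w).
have hi : holomorphic_at (fun w => sphere_scale (h w)^-1 (sphere_inv (f w))) z.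
  apply: holomorphic_scale fi.
  have := near_neq (derivable_cvg (hd z)) (h0 z z0).
  by apply: filterS => w hw; exact: derivableV.
apply: holomorphic_at_eq hi.
apply: filterS (near_nonreal z0) => w /h0 hw0.
case: (f w) => [a|] /=; last by rewrite mulr0.
by rewrite mulf_eq0 (negPf hw0) /=; case: eqP => //= _; rewrite invfM.
Qed.

(** At a pole of f, with p = 1 / f, one has 1 / (h + f) = p / (1 + h p), where
    1 + h p is close to 1. *)
Lemma meromorphic_add f h :
  (forall z, derivable (h : C^o -> C^o) z 1) -> meromorphic f ->
  meromorphic (fun z => sphere_add (h z) (f z)).
Proof.
move=> hd fm z z0.
case: (fm z z0) => [/holomorphic_atE fh|[fz fw /holomorphic_atE fi]].
  left; apply: (@holomorphic_atI _ (fun w => h w + fin_part (f w))).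
  by apply: filterS fh => w [-> fd]; split; [by []|exact: (derivableD (hd w) fd)].
right; split; first by rewrite fz.
  by apply: filterS fw => w /=; case: (f w).
pose p w := fin_part (sphere_inv (f w)); pose q w := 1 + h w * p w.
have pz : p z = 0 by rewrite /p fz.
have qd w : derivable (p : C^o -> C^o) w 1 -> derivable (q : C^o -> C^o) w 1.
  move=> pd; have c1 : derivable (cst 1 : C^o -> C^o) w 1.
    exact: derivable_cst.
  exact: (derivableD c1 (derivableM (hd w) pd)).
have pdz : derivable (p : C^o -> C^o) z 1 by case: (nbhs_singleton fi).
have qz : q z != 0 by rewrite /q pz mulr0 addr0 oner_eq0.
apply: (@holomorphic_atI _ (fun w => p w / q w)).
apply: filterS2 (near_neq (derivable_cvg (qd z pdz)) qz) fi => w qw [fE pd].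
split; last exact: (derivableM pd (derivableV qw (qd w pd))).
move: fE qw; rewrite /q /p; case: (f w) => [a|] /=; last by rewrite mul0r.
case: eqP => //= /eqP a0 _ qa.
have -> : h w + a = (1 + h w / a) * a by field.
by rewrite mulf_eq0 (negPf a0) (negPf qa) /= invfM mulrC.
Qed.

(** For a meromorphic function that does not vanish identically this is the
    identity theorem; here it will follow from the boundedness of the index. *)
Definition isolated_zeros f :=
  forall z, nonreal z -> \forall w \near (z : C^o)^', f w != Some 0.

Lemma meromorphic_ninv f : meromorphic f -> isolated_zeros f ->
  meromorphic (ninv \o f).
Proof.
move=> fm fz z z0.
have inv_hol g : holomorphic_at g z ->
    holomorphic_at (fun w => sphere_scale (-1) (g w)) z.
  apply: holomorphic_scale.
  have cdz : \forall w \near (z : C^o), derivable ((fun=> -1) : C^o -> C^o) w 1.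
    by apply: near_all => w; exact: derivable_cst.
  exact: cdz.
case: (fm z z0) => [fh|[fzN fw fi]]; last first.
  left; apply: holomorphic_at_eq (inv_hol _ fi).
  by apply: near_all => w /=; rewrite ninvE.
have [fz0|fz0] := eqVneq (f z) (Some 0); last first.
  left; apply: holomorphic_at_eq (inv_hol _ (holomorphic_inv fh fz0)).
  by apply: near_all => w /=; rewrite ninvE.
right; split; first by rewrite /= fz0 /= eqxx.
  apply: filterS (fz z z0) => w /=; case: (f w) => [a|] //=.
  by case: ifP => // /eqP ->; rewrite eqxx.
apply: holomorphic_at_eq (inv_hol _ fh).
by apply: near_all => w /=; rewrite sphere_invN.
Qed.

Lemma isolated_zeros_ninv f : meromorphic f -> isolated_zeros (ninv \o f).
Proof.
move=> fm z z0; apply: filterS (meromorphic_near fm z0) => w /=.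
case: (f w) => [a|] //= _; case: ifP => // /negbT a0.
by apply/eqP => -[] /eqP; rewrite oppr_eq0 invr_eq0 (negPf a0).
Qed.

Lemma derivable_poly (P : {poly R}) z :
  derivable (poly_eval P : C^o -> C^o) z 1.
Proof.
rewrite /poly_eval; elim/poly_ind: (map_poly _ P) => [|p c IH].
  have -> : horner (0 : {poly C}) = cst 0 by apply: funext => x; rewrite horner0.
  exact: derivable_cst.
have -> : horner (p * 'X + c%:P) = (fun x => p.[x] * x + c).
  by apply: funext => x; rewrite hornerMXaddC.
have cc : derivable (cst c : C^o -> C^o) z 1 by exact: derivable_cst.
have ci : derivable (id : C^o -> C^o) z 1 by exact: derivable_id.
exact: (derivableD (derivableM IH ci) cc).
Qed.

Lemma meromorphic_poly (P : {poly R}) : meromorphic (Some \o poly_eval P).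
Proof.
move=> z _; left; apply: (@holomorphic_atI _ (poly_eval P)).
by apply: near_all => w; split; [by []|exact: derivable_poly].
Qed.

Lemma poly_evalJ (P : {poly R}) z : poly_eval P (cj z) = cj (poly_eval P z).
Proof.
rewrite /poly_eval -horner_map /= -map_poly_comp /=; congr (_.[_]).
by apply: eq_map_poly => x /=; rewrite oppr0.
Qed.

Lemma real_symmetric_ninv f : real_symmetric f -> real_symmetric (ninv \o f).
Proof.
move=> fs z z0 /=; rewrite fs //; case: (f z) => [a|]; last first.
  by rewrite /= oppr0.
by rewrite /ninv /= conjc_eq0; case: ifP => //= _; rewrite rmorphN /= fmorphV.
Qed.

Lemma real_symmetric_add f (P : {poly R}) : real_symmetric f ->
  real_symmetric (fun z => sphere_add (poly_eval P z) (f z)).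
Proof.
move=> fs z z0 /=; rewrite fs // poly_evalJ; case: (f z) => [a|] //=.
by rewrite rmorphD.
Qed.

Lemma real_symmetric_eq f g : (forall z, nonreal z -> f z = g z) ->
  real_symmetric f -> real_symmetric g.
Proof. by move=> fg fs z z0; rewrite -!fg ?fs //; exact: nonreal_conj. Qed.

End Meromorphic.

(** * Invariance of the index under f |-> - 1 / f *)

Section IndexTransformations.
Local Open Scope complex_scope.
Variable R : realType.
Local Notation C := R[i].
Local Notation cj := (@conjc R).
Local Notation sfun := (C -> option C).
Implicit Types (f g : sfun).

Definition bounded_index f b := forall m, has_negs f m -> (m <= b)%N.

Lemma neg_index_bounded f k : neg_index f k -> bounded_index f k.
Proof. by move=> fk m /fk. Qed.

(** Approximate negative squares at one stage of the limit are enough, hence no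
    uniformity in the choice of points and coefficients is needed. *)
Lemma has_negs_lim (U : Type) (F : set_system U) (FF : ProperFilter F) f
    (I T : finType) (z : U -> T -> C) (B : U -> I -> T -> C) :
  (forall x, \forall u \near F, upper (z u x) /\ f (z u x) != None) ->
  (forall i j, cvgc F (fun u => gram (kernel f) (z u) (B u i) (B u j))
     (- (i == j)%:R)) ->
  has_negs f #|I|.
Proof.
move=> zf Bneg.
have zf' : \forall u \near F, forall x, upper (z u x) /\ f (z u x) != None.
  exact: filter_forall.
have Bneg' : \forall u \near F, forall ij : I * I,
    `|gram (kernel f) (z u) (B u ij.1) (B u ij.2) + (ij.1 == ij.2)%:R|
      <= tolerance R #|I|.
  apply: filter_forall => -[i j] /=.
  have t0 : 0 < tolerance R #|I| by rewrite invr_gt0 ltr0n.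
  have /cvgrPdist_le /(_ _ t0) := Bneg i j.
  by apply: filterS => u; rewrite -normrN opprB opprK.
have [u [zu Bu]] := filter_ex (filterI zf' Bneg').
by exists I, T, (z u), (B u); split=> // i j; exact: (Bu (i, j)).
Qed.

Lemma has_negs_eq f g m : (forall z, upper z -> f z = g z) ->
  has_negs f m -> has_negs g m.
Proof.
move=> fg [I [T [z [B [Im zf Bneg]]]]]; exists I, T, z, B; split=> //.
  by move=> x; rewrite -fg //; case: (zf x).
move=> i j; rewrite -(_ : gram (kernel f) z (B i) (B j) = gram (kernel g) z (B i) (B j)) //.
apply: eq_bigr => x _; apply: eq_bigr => y _; rewrite /kernel !fg //.
  by case: (zf y).
by case: (zf x).
Qed.

Lemma neg_index_eq f g k : (forall z, upper z -> f z = g z) ->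
  neg_index f k -> neg_index g k.
Proof.
move=> fg fk m; split=> [/(has_negs_eq (fun z zu => esym (fg z zu))) /fk//|].
by move=> /fk /(has_negs_eq fg).
Qed.

Definition bigram (K : C -> C -> C) (T U : finType) (z : T -> C) (b : T -> C)
    (w : U -> C) (c : U -> C) : C :=
  \sum_x \sum_y b x * K (z x) (w y) * cj (c y).

Lemma gram_sum (K : C -> C -> C) (T U : finType) (z : T + U -> C)
    (b c : T + U -> C) :
  gram K z b c =
  bigram K (z \o inl) (b \o inl) (z \o inl) (c \o inl) +
  bigram K (z \o inl) (b \o inl) (z \o inr) (c \o inr) +
  (bigram K (z \o inr) (b \o inr) (z \o inl) (c \o inl) +
  bigram K (z \o inr) (b \o inr) (z \o inr) (c \o inr)).
Proof.
rewrite /gram /bigram big_sumType -!big_split /=.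
by congr (_ + _); apply: eq_bigr => x _; rewrite big_sumType.
Qed.

Lemma bigramC f (T U : finType) (z b : T -> C) (w c : U -> C) :
  bigram (kernel f) w c z b = cj (bigram (kernel f) z b w c).
Proof.
rewrite /bigram rmorph_sum exchange_big; apply: eq_bigr => x _ /=.
rewrite rmorph_sum; apply: eq_bigr => y _. 
by rewrite -[RHS]/(cj (_ * _ * _)) conjcM conjcM kernelC conjcK; ring.
Qed.

Lemma cvg_bigram (V : Type) (F : set_system V) {FF : Filter F}
    (T U : finType) (k : V -> T -> U -> C) (b : V -> T -> C) (c : V -> U -> C)
    (k0 : T -> U -> C) (b0 : T -> C) (c0 : U -> C) :
  (forall x y, cvgc F (fun v => k v x y) (k0 x y)) ->
  (forall x, cvgc F (fun v => b v x) (b0 x)) ->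
  (forall y, cvgc F (fun v => c v y) (c0 y)) ->
  cvgc F (fun v => \sum_x \sum_y b v x * k v x y * cj (c v y))
    (\sum_x \sum_y b0 x * k0 x y * cj (c0 y)).
Proof.
move=> hk hb hc; apply: cvg_sumc => x; apply: cvg_sumc => y.
exact: cvgcM (cvgcM (hb x) (hk x y)) (cvg_conjc (hc y)).
Qed.

Lemma cvg_kernel (V : Type) (F : set_system V) {FF : Filter F} f
    (z w : V -> C) (z0 w0 : C) : upper z0 -> upper w0 ->
  cvgc F z z0 -> cvgc F w w0 ->
  cvgc F (fun v => fin_part (f (z v))) (fin_part (f z0)) ->
  cvgc F (fun v => fin_part (f (w v))) (fin_part (f w0)) ->
  cvgc F (fun v => kernel f (z v) (w v)) (kernel f z0 w0).
Proof.
move=> zu wu zz ww fz fw; apply: cvgcM.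
  exact: cvgcB fz (cvg_conjc fw).
exact: cvgcV (upper_subJ zu wu) (cvgcB zz (cvg_conjc ww)).
Qed.

(** The exceptional set of Q, for instance the set of zeros of f, can be
    avoided since the kernel is continuous off the poles: the points are moved
    upwards by a small amount. *)
Lemma has_negs_move f (Q : C -> Prop) m : meromorphic f ->
  (forall z, upper z -> \forall w \near (z : C^o)^', Q w) ->
  has_negs f m -> exists (I T : finType) (z : T -> C) (B : I -> T -> C),
    [/\ #|I| = m, forall x, [/\ upper (z x), f (z x) != None & Q (z x)]
      & forall i j, `|gram (kernel f) z (B i) (B j) + (i == j)%:R|
                      <= tolerance R m].
Proof.
move=> fm hQ /has_negs_exact[T [z [B [zf BE]]]].
pose zt (t : R) x := z x + 0 +i* t.
have zc x : ((fun t => zt t x) : R -> C^o) @ 0^'+ --> (z x : C^o) by apply: cvg_up.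
have fc x : ((fun t => fin_part (f (zt t x))) : R -> C^o) @ 0^'+
    --> (fin_part (f (z x)) : C^o).
  have [zu zn] := zf x.
  exact: (cvg_comp _ _ (zc x)
    (holomorphic_cvg (meromorphic_hol fm (upper_nonreal zu) zn))).
have P1 : \forall t \near (0 : R)^'+, forall x,
    [/\ upper (zt t x), f (zt t x) != None & Q (zt t x)].
  apply: filter_forall => x; have [zu zn] := zf x.
  have h1 := near_up (near_dnbhs (near_upper zu)).
  have h2 := near_up (meromorphic_near fm (upper_nonreal zu)).
  by apply: filterS3 h1 h2 (near_up (hQ _ zu)) => t; split.
have P2 : \forall t \near (0 : R)^'+, forall ij : 'I_m * 'I_m,
    `|gram (kernel f) (zt t) (B ij.1) (B ij.2) + (ij.1 == ij.2)%:R|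
      <= tolerance R m.
  apply: filter_forall => -[i j] /=.
  have t0 : 0 < tolerance R m by rewrite invr_gt0 ltr0n.
  have : ((fun t => gram (kernel f) (zt t) (B i) (B j)) : R -> C^o) @ 0^'+
      --> (- (i == j)%:R : C^o).
    rewrite -BE; apply: cvg_bigram => [x y|x|y]; do ?exact: cvg_cst.
    exact: cvg_kernel (zf x).1 (zf y).1 (zc x) (zc y) (fc x) (fc y).
  move/cvgrPdist_le => /(_ _ t0).
  by apply: filterS => t; rewrite -normrN opprB opprK.
have [t [z1 B1]] := @filter_ex R (0 : R)^'+ _ _ (filterI P1 P2).
exists 'I_m, T, (zt t), B; split=> //; first by rewrite card_ord.
by move=> i j; exact: (B1 (i, j)).
Qed.

(** The kernel of - 1 / f is that of f divided by f(z) and by the conjugate of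
    f(w), a congruence as long as the points are not zeros of f. *)
Lemma has_negs_ninv f m : meromorphic f -> isolated_zeros f ->
  has_negs f m -> has_negs (@ninv R \o f) m.
Proof.
move=> fm fz fneg.
have [I [T [z [B [Im zf Bneg]]]]] :=
  has_negs_move fm (fun z zu => fz z (upper_nonreal zu)) fneg.
have zE x : f (z x) = Some (fin_part (f (z x))) /\ fin_part (f (z x)) != 0.
  by have [_] := zf x; case: (f (z x)) => [a|] // _ a0; split=> //.
have zS x : exists2 a, f (z x) = Some a & a != 0.
  by have [fx x0] := zE x; exists (fin_part (f (z x))).
exists I, T, z, (fun i x => B i x * fin_part (f (z x))); split=> //.
  move=> x; have [zu _ _] := zf x; split=> //=.
  by have [-> /negPf /= ->] := zE x.
move=> i j; rewrite -(_ : gram (kernel f) z (B i) (B j) =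
   gram (kernel (@ninv R \o f)) z _ _) //.
apply: eq_bigr => x _; apply: eq_bigr => y _.
rewrite /kernel /=; have [xu _ _] := zf x; have [yu _ _] := zf y.
have [a fx x0] := zS x; have [b fy y0] := zS y.
rewrite fx fy /= (negPf x0) (negPf y0) /= conjcM rmorphN fmorphV /=.
have d0 := upper_subJ xu yu.
have b0 : cj b != 0 by rewrite conjc_eq0.
by field; rewrite d0 x0 b0.
Qed.

Lemma neg_index_ninv f k : meromorphic f -> isolated_zeros f ->
  neg_index f k -> neg_index (@ninv R \o f) k.
Proof.
move=> fm fz fk m; split=> [h|/fk]; last exact: has_negs_ninv.
have h' := has_negs_ninv (meromorphic_ninv fm fz) (isolated_zeros_ninv fm) h.
apply/fk; apply: has_negs_eq h' => z _ /=; exact: ninvK.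
Qed.

Lemma bounded_index_ninv f b : meromorphic f -> isolated_zeros f ->
  bounded_index f b -> bounded_index (@ninv R \o f) b.
Proof.
move=> fm fz fb m h.
have h' := has_negs_ninv (meromorphic_ninv fm fz) (isolated_zeros_ninv fm) h.
by apply: fb; apply: has_negs_eq h' => z _ /=; exact: ninvK.
Qed.

Lemma cvg_invy : cvgc +oo (fun t : R => (t^-1)%:C) 0.
Proof.
apply: cvg_realc; apply/gtr0_cvgV0; last exact: cvg_id.
exact: nbhs_pinfty_gt.
Qed.

(** A linear relation c between the rows yields the polynomial \sum_k c_k
    \prod_(l != k) ('X - x_l), which has degree less than m and the m roots
    y_j. So it is zero, and its values at the points x_k give c = 0. *)
Lemma cauchy_unit m (x y : 'I_m -> C) : injective x -> injective y ->
  (forall i j, x i != y j) ->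
  (\matrix_(i, j) (x i - y j)^-1 : 'M[C]_m) \in unitmx.
Proof.
move=> xi yi xy; rewrite -row_free_unit -kermx_eq0; apply/eqP/row_matrixP => r.
set c := row r _; rewrite row0.
have : c *m (\matrix_(i, j) (x i - y j)^-1 : 'M[C]_m) = 0.
  by rewrite -row_mul mulmx_ker row0.
move=> /rowP c0; pose q k : {poly C} := \prod_(l | l != k) ('X - (x l)%:P).
pose p : {poly C} := \sum_k c 0 k *: q k.
have ps : (size p <= m)%N.
  apply: (leq_trans (size_sum _ _ _)); apply/bigmax_leqP => k _.
  apply: (leq_trans (size_scale_leq _ _)).
  apply: (leq_trans (size_poly_prod_leq _ _)).
  rewrite (eq_bigr (fun=> 2%N)) => [|l _]; last by rewrite size_XsubC.
  rewrite sum_nat_const cardC1 card_ord; case: m k {xi yi xy c c0 q p r x y} => [[]//|m] _ /=.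
  by rewrite muln2 -addnn -addnS addKn.
have py j : p.[y j] = 0.
  have s0 : \sum_k c 0 k * (x k - y j)^-1 = 0.
    have := c0 j; rewrite [RHS]mxE mxE => {2}<-.
    by apply: eq_bigr => k _; rewrite [X in _ = _ * X]mxE.
  rewrite horner_sum.
  transitivity (\prod_l (y j - x l) * - \sum_k c 0 k * (x k - y j)^-1); last first.
    by rewrite s0 oppr0 mulr0.
  rewrite -sumrN mulr_sumr; apply: eq_bigr => k _.
  rewrite hornerZ horner_prod [in RHS](bigD1 k) //=.
  under eq_bigr do rewrite hornerXsubC.
  have d : x k - y j != 0 by rewrite subr_eq0.
  have -> : y j - x k = - (x k - y j) by rewrite opprB.
  by field.
have p0 : p = 0.
  apply: (@roots_geq_poly_eq0 _ p (codom y)).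
  - by apply/allP => _ /codomP[j ->]; apply/rootP; exact: py.
  - by rewrite map_inj_uniq ?enum_uniq.
  - by rewrite size_codom card_ord.
apply/rowP => k; rewrite [RHS]mxE.
have : p.[x k] = 0 by rewrite p0 horner0.
rewrite horner_sum (bigD1 k) //= big1 ?addr0 => [|l lk]; last first.
  rewrite hornerZ horner_prod (bigD1 k) ?[k == l]eq_sym //=.
  by rewrite hornerXsubC subrr mul0r mulr0.
rewrite hornerZ horner_prod => /eqP; rewrite mulf_eq0 => /orP[/eqP//|].
move=> /prodf_eq0[l lk]; rewrite hornerXsubC subr_eq0.
by rewrite (inj_eq xi) eq_sym (negPf lk).
Qed.

(** The zeros of f span a neutral subspace, on which the form vanishes. Its
    pairing with the points w_j, where f is not zero, is a Cauchy matrix with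
    columns multiplied by nonzero numbers, hence nondegenerate; this forces m
    negative squares, whatever the form is on the points w_j. *)
Lemma has_negs_zeros f m (zs ws : 'I_m -> C) : injective zs -> injective ws ->
  (forall i, upper (zs i) /\ f (zs i) = Some 0) ->
  (forall i, upper (ws i) /\ exists2 a, f (ws i) = Some a & a != 0) ->
  has_negs f m.
Proof.
move=> zi wi zf wf.
pose y i := cj (ws i).
have y_inj : injective y.
  by move=> i j /(congr1 (@conjc R)); rewrite !conjcK => /wi.
have zy i j : zs i != y j.
  by rewrite -subr_eq0 upper_subJ; case: (zf i); case: (wf j).
pose a i := fin_part (f (ws i)).
have a0 i : a i != 0 by rewrite /a; case: (wf i) => _ [b -> b0].
have Xu := cauchy_unit zi y_inj zy.
set X := (\matrix_(i, j) _) in Xu.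
pose W := invmx X.
pose z (x : 'I_m + 'I_m) := match x with inl i => zs i | inr i => ws i end.
(* The vector t / 2 times the dual basis of the neutral subspace plus 1 / t
   times a point w_k: the mixed terms add up to - 1 and the square of the
   second part has size 1 / t ^ 2. *)
pose B (t : R) (k : 'I_m) (x : 'I_m + 'I_m) : C :=
  match x with inl i => (t / 2)%:C * (cj (a k))^-1 * W k i
             | inr i => (k == i)%:R * (t^-1)%:C end.
rewrite -(card_ord m).
apply: (@has_negs_lim _ (+oo : set_system R) _ f _ _ (fun=> z) B).
  move=> x; apply: nearW => _; case: x => i /=; first by case: (zf i) => ? ->.
  by case: (wf i) => ? [b -> _].
move=> i j.
have half t k l :
    bigram (kernel f) (z \o inl) (B t k \o inl) (z \o inr) (B t l \o inr)
     = (t / 2 * t^-1)%:C * - (k == l)%:R.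
  transitivity (\sum_q (t / 2)%:C * (cj (a k))^-1 * W k q *
      kernel f (zs q) (ws l) * (t^-1)%:C).
    apply: eq_bigr => q _ /=; rewrite (bigD1 l) //= big1 ?addr0 => [|p pl].
      by rewrite eqxx mul1r conjc_real.
    by rewrite eq_sym (negPf pl) mul0r conjc0 mulr0.
  transitivity ((t / 2 * t^-1)%:C * (cj (a l) / cj (a k)) *
      - \sum_q W k q * X q l).
    rewrite -sumrN mulr_sumr; apply: eq_bigr => q _.
    have [_ zq] := zf q.
    by rewrite /kernel !mxE zq sub0r -/(a l) -/(y l) rmorphM /=; ring.
  have /matrixP /(_ k l) := mulVmx Xu; rewrite [LHS]mxE [RHS]mxE => ->.
  have [->|_] := eqVneq k l; last by rewrite oppr0 !mulr0.
  by rewrite divff ?conjc_eq0 // mulr1.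
have last_part t k l :
    bigram (kernel f) (z \o inr) (B t k \o inr) (z \o inr) (B t l \o inr)
     = (t^-1)%:C * (t^-1)%:C * kernel f (ws k) (ws l).
  rewrite /bigram (bigD1 k) //= [X in _ + X]big1 ?addr0 => [|p pk]; last first.
    by apply: big1 => q _; rewrite eq_sym (negPf pk) !mul0r.
  rewrite (bigD1 l) //= [X in _ + X]big1 ?addr0 => [|p pl]; last first.
    by rewrite [l == p]eq_sym (negPf pl) conjcM conjc_nat mul0r mulr0.
  by rewrite !eqxx !mul1r conjc_real; ring.
have first_part t k l :
    bigram (kernel f) (z \o inl) (B t k \o inl) (z \o inl) (B t l \o inl) = 0.
  apply: big1 => p _; apply: big1 => q _ /=; rewrite /kernel.
  have [_ ->] := zf p; have [_ ->] := zf q.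
  have -> : cj (fin_part (Some 0)) = 0 by exact: conjc0.
  by rewrite subrr mul0r mulr0 mul0r.
have gramE t : t != 0 -> gram (kernel f) z (B t i) (B t j) =
    - (i == j)%:R + (t^-1)%:C * (t^-1)%:C * kernel f (ws i) (ws j).
  move=> t0; rewrite gram_sum first_part half last_part bigramC half.
  rewrite conjcM conjc_real rmorphN /= conjc_nat [j == i]eq_sym.
  have -> : t / 2 * t^-1 = 2^-1 by field.
  rewrite rmorphV ?unitfE ?pnatr_eq0 //= rmorph_nat; field.
  by rewrite fmorph_eq0.
have ti := cvg_invy.
have td : cvgc +oo (fun t : R => - (i == j)%:R +
    (t^-1)%:C * (t^-1)%:C * kernel f (ws i) (ws j)) (- (i == j)%:R).
  rewrite -[X in cvgc _ _ X]addr0 -(mul0r (kernel f (ws i) (ws j))).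
  rewrite -{1}(mul0r 0).
  exact: cvgcD (cvgc_cst _) (cvgcM (cvgcM ti ti) (cvgc_cst _)).
apply: (cvgc_eq _ td).
have pos : \forall t \near +oo, (0 : R) < t.
  exact: nbhs_pinfty_gt (num_real 0).
by apply: filterS pos => t t0; rewrite gramE // gt_eqF.
Qed.

(** By [has_negs_zeros] a function of bounded index with neither zeros nor
    poles far up on the imaginary axis has finitely many zeros in the upper
    half-plane. This replaces the identity theorem. *)
Lemma bounded_isolated_zeros f b : meromorphic f -> real_symmetric f ->
  bounded_index f b ->
  (\forall y \near +oo, f (0 +i* y) != None /\ f (0 +i* y) != Some 0) ->
  isolated_zeros f.
Proof.
move=> fm fs fb /= fy.
have up z : upper z -> \forall w \near (z : C^o)^', f w != Some 0.
  move=> zu; pose Z := [set w : C | upper w /\ f w = Some 0].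
  have finZ : finite_set Z.
    apply: contrapT => /(@infinite_set_fset _ _ b.+1)[B BZ Bb].
    have [M My] : exists M : R, 0 < M /\ forall y, M < y ->
        f (0 +i* y) != None /\ f (0 +i* y) != Some 0.
      case: fy => M [Mr My]; exists (Num.max M 1); split.
        by rewrite lt_max ltr01 orbT.
      by move=> y; rewrite gt_max => /andP[/My].
    suff : has_negs f b.+1 by move/fb; rewrite ltnn.
    have szB : (b.+1 <= size (finmap.enum_fset B))%N by [].
    apply: (@has_negs_zeros f _ (fun i => (finmap.enum_fset B)`_i)
      (fun i => 0 +i* (M + 1 + i%:R))).
    - move=> i j /eqP; rewrite nth_uniq ?finmap.fset_uniq ?(leq_trans _ szB) //.
      by move/eqP/val_inj.
    - by move=> i j [] /addrI /eqP; rewrite eqr_nat => /eqP /val_inj.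
    - move=> i; apply: BZ; apply: mem_nth.
      by rewrite (leq_trans _ szB).
    - move=> i; have yM : M < M + 1 + i%:R by rewrite -addrA ltrDl ltr_wpDr.
      split; first by rewrite /upper /= (lt_trans My.1).
      have [] := My.2 _ yM; case: (f _) => // a _ a0; exists a => //.
  have [s sZ] : exists s : seq C, Z = [set` s] by apply/finite_seqP.
  have : \forall w \near (z : C^o)^', w \notin s.
    elim: {sZ} s => [|x s IH]; first by apply: near_dnbhs; exact: near_all.
    have xz : \forall w \near (z : C^o)^', w != x.
      have [->|zx] := eqVneq z x.
        by rewrite /dnbhs /within /=; exact: near_all.
      have zz : (id : C^o -> C^o) @ (z : C^o) --> (z : C^o) by apply: cvg_id.
      exact: near_dnbhs (near_neq zz zx).
    by apply: filterS2 IH xz => w ws wx; rewrite inE negb_or wx.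
  apply: filterS2 (near_dnbhs (near_upper zu)) => w wu ws.
  apply/eqP => fw; move/negP: ws; apply.
  by have : Z w by []; rewrite sZ.
move=> z; rewrite /nonreal neq_lt => /orP[zl|]; last exact: up.
have zJu : upper (cj z) by case: z zl => a c; rewrite /upper /= oppr_gt0.
have cz : (cj : C^o -> C^o) @ (z : C^o) --> (cj z : C^o).
  have zz : (id : C^o -> C^o) @ (z : C^o) --> (z : C^o) by apply: cvg_id.
  exact: (cvg_conjc zz).
have cz' : \forall w \near (z : C^o), cj w != cj z -> f (cj w) != Some 0.
  by have := up _ zJu; rewrite /dnbhs /within /= => /cz.
have znr : nonreal z by rewrite /nonreal lt_eqF.
rewrite /dnbhs /within /=.
apply: filterS2 (near_nonreal znr) cz' => w wr h wz.
have : f (cj w) != Some 0 by apply: h; rewrite (inj_eq (can_inj (@conjcK R))).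
rewrite fs //; case: (f w) => [a|] //=; apply: contra => /eqP[->].
by rewrite conjc0.
Qed.

End IndexTransformations.

(** * Polynomials, and adding a polynomial to a function *)

Section PolynomialKernels.
Local Open Scope complex_scope.
Variable R : realType.
Local Notation C := R[i].
Local Notation cj := (@conjc R).
Local Notation sfun := (C -> option C).
Implicit Types (f g : sfun) (P : {poly R}).

Lemma horner_sub (K : comNzRingType) (p : {poly K}) n (x y : K) :
  (size p <= n.+1)%N -> p.[x] - p.[y] =
  (x - y) * \sum_(a < n) \sum_(b < n) p`_(a + b).+1 * x ^+ a * y ^+ b.
Proof.
move=> sp; pose G a b : K := p`_(a + b) * x ^+ a * y ^+ b.
have G0 a b : (n < a + b)%N -> G a b = 0.
  by move=> ab; rewrite /G nth_default ?mul0r // (leq_trans sp).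
have -> : (x - y) * \sum_(a < n) \sum_(b < n) p`_(a + b).+1 * x ^+ a * y ^+ b =
    \sum_(a < n) \sum_(b < n) G a.+1 b - \sum_(a < n) \sum_(b < n) G a b.+1.
  rewrite mulr_sumr -sumrB; apply: eq_bigr => a _.
  rewrite mulr_sumr -sumrB; apply: eq_bigr => b _.
  by rewrite /G addSn addnS !exprS; ring.
have -> : p.[x] = \sum_(a < n) G a 0 + G n 0%N.
  rewrite (horner_coef_wide _ sp) big_ord_recr /=; congr (_ + _).
    by apply: eq_bigr => a _; rewrite /G addn0 mulr1.
  by rewrite /G addn0 mulr1.
have -> : p.[y] = \sum_(b < n) G 0%N b + G 0%N n.
  rewrite (horner_coef_wide _ sp) big_ord_recr /=; congr (_ + _).
    by apply: eq_bigr => a _; rewrite /G mulr1.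
  by rewrite /G mulr1.
case: n sp G0 => [|n] sp G0; first by rewrite !big_ord0 !subrr.
have -> : \sum_(a < n.+1) \sum_(b < n.+1) G a.+1 b =
   \sum_(a < n) \sum_(b < n.+1) G a.+1 b + G n.+1 0%N.
  rewrite big_ord_recr /=; congr (_ + _); rewrite big_ord_recl big1 ?addr0 //.
  by move=> b _; rewrite G0 //= addSn addnS !ltnS leq_addr.
have -> : \sum_(a < n.+1) \sum_(b < n.+1) G a b.+1 =
   \sum_(a < n.+1) \sum_(b < n) G a b.+1 + G 0%N n.+1.
  under eq_bigr do rewrite big_ord_recr /=.
  rewrite big_split /=; congr (_ + _); rewrite big_ord_recl big1 ?addr0 //.
  by move=> b _; rewrite G0 //= addSn ltnS leq_addl.
have -> : \sum_(a < n) \sum_(b < n.+1) G a.+1 b =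
  \sum_(a < n) G a.+1 0%N + \sum_(a < n) \sum_(b < n) G a.+1 b.+1.
  by rewrite -big_split; apply: eq_bigr => a _; rewrite big_ord_recl.
rewrite [\sum_(a < n.+1) \sum_(b < n) _]big_ord_recl.
rewrite [\sum_(a < n.+1) G a 0%N]big_ord_recl [\sum_(b < n.+1) G 0%N b]big_ord_recl /=.
by ring.
Qed.

Definition moment (T : finType) (z b : T -> C) p : C := \sum_x b x * z x ^+ p.

Definition pfun P : sfun := Some \o poly_eval P.

Lemma coef_toC P k : (map_poly (real_complex R) P)`_k = (P`_k)%:C.
Proof. by rewrite coef_map. Qed.

Lemma kernel_poly P n z w : (size P <= n.+1)%N -> upper z -> upper w ->
  kernel (pfun P) z w =
  \sum_(a < n) \sum_(b < n) (P`_(a + b).+1)%:C * z ^+ a * (cj w) ^+ b.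
Proof.
move=> sP zu wu; rewrite /kernel /= -poly_evalJ (@horner_sub _ _ n); last first.
  by rewrite size_map_poly.
rewrite mulrAC divff ?mul1r ?upper_subJ //.
by apply: eq_bigr => a _; apply: eq_bigr => b _; rewrite coef_toC.
Qed.

(** A kernel separated in this way turns the form into a form in the moments of
    the coefficients. *)
Lemma sum_sep (T : finType) n (q : nat -> nat -> C) (u : T -> nat -> C)
    (b c : T -> C) :
  \sum_x \sum_y b x * (\sum_(p < n) \sum_(r < n) q p r * u x p * cj (u y r)) *
    cj (c y) =
  \sum_(p < n) \sum_(r < n)
    q p r * (\sum_x b x * u x p) * cj (\sum_y c y * u y r).
Proof.
transitivity (\sum_x \sum_y \sum_(p < n) \sum_(r < n)
   b x * (q p r * u x p * cj (u y r)) * cj (c y)).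
  apply: eq_bigr => x _; apply: eq_bigr => y _.
  rewrite mulr_sumr mulr_suml; apply: eq_bigr => p _.
  by rewrite mulr_sumr mulr_suml.
under eq_bigr do rewrite exchange_big /=.
rewrite exchange_big; apply: eq_bigr => p _.
under eq_bigr do rewrite exchange_big /=.
rewrite exchange_big; apply: eq_bigr => r _.
have -> : cj (\sum_y c y * u y r) = \sum_y cj (c y) * cj (u y r).
  by rewrite rmorph_sum; apply: eq_bigr => y _; rewrite rmorphM.
rewrite -mulrA big_distrlr mulr_sumr; apply: eq_bigr => x _ /=.
by rewrite mulr_sumr; apply: eq_bigr => y _; ring.
Qed.

Lemma gram_poly P n (T : finType) (z b c : T -> C) : (size P <= n.+1)%N ->
  (forall x, upper (z x)) -> gram (kernel (pfun P)) z b c =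
  \sum_(p < n) \sum_(q < n)
    (P`_(p + q).+1)%:C * moment z b p * cj (moment z c q).
Proof.
move=> sP zu; rewrite /gram /moment.
rewrite -(sum_sep n (fun p q => (P`_(p + q).+1)%:C) (fun x p => z x ^+ p)).
apply: eq_bigr => x _; apply: eq_bigr => y _; congr (_ * _ * _).
rewrite (kernel_poly sP) //; apply: eq_bigr => p _; apply: eq_bigr => q _.
by rewrite rmorphXn.
Qed.

Definition phankel P n : 'M[C]_n := \matrix_(p, q) (P`_(p + q).+1)%:C.

Lemma phankel_herm P n : adj (phankel P n) = phankel P n.
Proof. by apply/matrixP => i j; rewrite !mxE conjc_real addnC. Qed.

Lemma has_negs_phankel P n m : (size P <= n.+1)%N -> has_negs (pfun P) m ->
  has_neg (phankel P n) m.
Proof.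
move=> sP /has_negs_exact[T [z [B [zf BE]]]].
exists (\matrix_(i, p) moment z (B i) p) => i j.
have -> : (\matrix_(i, p) moment z (B i) p *m phankel P n *m
    adj (\matrix_(i, p) moment z (B i) p)) i j = - (i == j)%:R.
  rewrite -BE (gram_poly _ _ sP) => [|x]; last by case: (zf x).
  rewrite !mxE exchange_big; apply: eq_bigr => q _ /=.
  rewrite !mxE mulr_suml; apply: eq_bigr => p _; rewrite !mxE.
  by rewrite [moment _ _ _ * _]mulrC.
by rewrite addNr normr0 invr_ge0 ler0n.
Qed.

Lemma poly_bounded P n : (size P <= n.+1)%N -> bounded_index (pfun P) n.
Proof.
move=> sP m /(has_negs_phankel sP) h.
by apply: (has_neg_le (Q := 1%:M) _ h) => x; rewrite mulmx1 => ->; rewrite /form !mul0mx mxE.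
Qed.

Lemma pfun_symmetric P : real_symmetric (pfun P).
Proof. by move=> z _; rewrite /pfun /= poly_evalJ. Qed.

Lemma kappa_minusP P : neg_index (pfun P) (kappa_minus P).
Proof.
have [k hk] := neg_index_exists (poly_bounded (leqSpred (size P))).
have ex : exists q, [set q | gen_nevanlinna q (pfun P)] q.
  exists k; apply/gen_nevanlinnaE; split=> //.
    exact: meromorphic_poly.
  exact: pfun_symmetric.
by have /gen_nevanlinnaE[] := xgetPex 0%N ex.
Qed.

(** Both numbers count squares of one Hankel form of order n, negative and
    positive ones. *)
Lemma kappa_minusN P n : (size P <= n.+1)%N ->
  (kappa_minus P + kappa_minus (- P) <= n)%N.
Proof.
move=> sP; apply: (has_negD (phankel_herm P n)).
  by apply: has_negs_phankel => //; apply/kappa_minusP.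
have -> : - phankel P n = phankel (- P) n.
  by apply/matrixP => i j; rewrite !mxE coefN rmorphN.
by apply: has_negs_phankel; rewrite ?size_polyN //; apply/kappa_minusP.
Qed.

Definition padd P f : sfun := fun z => sphere_add (poly_eval P z) (f z).

Lemma kernel_padd P f z w : f z != None -> f w != None ->
  kernel (padd P f) z w = kernel (pfun P) z w + kernel f z w.
Proof.
rewrite /kernel /padd; case: (f z) => // a _; case: (f w) => // b _ /=.
by rewrite rmorphD /= -mulrDl; congr (_ / _); ring.
Qed.

(** The kernel of a sum is the sum of the kernels, and the number of negative
    squares is subadditive. *)
Lemma bounded_index_padd P f b : bounded_index f b ->
  bounded_index (padd P f) (kappa_minus P + b).
Proof.
move=> fb m /has_negs_pick[n [z [[zi zf] hn]]].
have zf' i : f (z i) != None by have [_] := zf i; rewrite /padd; case: (f (z i)).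
have pE : pick_matrix (padd P f) z = pick_matrix (pfun P) z + pick_matrix f z.
  by apply/matrixP => i j; rewrite !mxE; exact: kernel_padd.
rewrite pE in hn.
apply: has_neg_sum hn; do ?exact: pick_matrix_herm.
  move=> k hk; apply/kappa_minusP/has_negs_pick; exists n, z; split=> //.
  by split=> // i; case: (zf i).
move=> k hk; apply/fb/has_negs_pick; exists n, z; split=> //.
by split=> // i; split=> //; case: (zf i).
Qed.

End PolynomialKernels.

Section Asymptotics.
Local Open Scope complex_scope.
Variable R : realType.
Local Notation C := R[i].
Local Notation cj := (@conjc R).
Local Notation sfun := (C -> option C).
Implicit Types (f g : sfun) (P : {poly R}).

Definition axis (y : R) : C := 0 +i* y.

Lemma axisE y : axis y = 'i * y%:C.
Proof. by rewrite /axis; simpc. Qed.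

Lemma near_pos : \forall y \near +oo, (0 : R) < y.
Proof. exact: nbhs_pinfty_gt (num_real 0). Qed.

Lemma cvgc_dilate (u : R -> C) l t : 0 < t -> cvgc +oo u l ->
  cvgc +oo (fun y => u (y * t)) l.
Proof.
move=> t0 ul; have yt : (fun y : R => y * t) @ +oo --> +oo.
  by apply: gt0_cvgMly => //; exact: cvg_id.
exact: (cvg_comp _ _ yt ul).
Qed.

Lemma near_dilate (Q : R -> Prop) t : 0 < t -> (\forall y \near +oo, Q y) ->
  \forall y \near +oo, Q (y * t).
Proof.
move=> t0 hQ; have yt : (fun y : R => y * t) @ +oo --> +oo.
  by apply: gt0_cvgMly => //; exact: cvg_id.
exact: (yt _ hQ).
Qed.

Definition finite_axis f := \forall y \near +oo, f (axis y) != None.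

Definition axis_small f := finite_axis f /\
  cvgc +oo (fun y => fin_part (f (axis y)) * (y^-1)%:C) 0.

(** The Vandermonde matrix of the points i, 2 i, ..., n i. *)
Definition axis_vander n : 'M[C]_n := \matrix_(a, q) (axis a.+1%:R) ^+ q.

Lemma axis_vander_unit n : axis_vander n \in unitmx.
Proof.
have -> : axis_vander n = (Vandermonde n (\row_(a < n) axis a.+1%:R))^T.
  by apply/matrixP => a q; rewrite !mxE.
rewrite unitmx_tr unitmxE det_Vandermonde unitfE.
apply/prodf_neq0 => i _; apply/prodf_neq0 => j ij; rewrite !mxE.
rewrite subr_eq0 eq_complex /= eqxx /= eqr_nat eqSS.
by rewrite eq_sym neq_ltn ij.
Qed.

Lemma cvg_kernel_decay g (u w : R -> C) (a b : R) : (0 <= a) -> (0 <= b) ->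
  a + b != 0 ->
  cvgc +oo (fun y => u y * (y^-1)%:C) (axis a) ->
  cvgc +oo (fun y => w y * (y^-1)%:C) (axis b) ->
  cvgc +oo (fun y => fin_part (g (u y)) * (y^-1)%:C) 0 ->
  cvgc +oo (fun y => fin_part (g (w y)) * (y^-1)%:C) 0 ->
  cvgc +oo (fun y => kernel g (u y) (w y)) 0.
Proof.
move=> a0 b0 ab ua wb gu gw.
pose d y := u y * (y^-1)%:C - cj (w y * (y^-1)%:C).
pose e y := fin_part (g (u y)) * (y^-1)%:C - cj (fin_part (g (w y)) * (y^-1)%:C).
have dl : cvgc +oo d (axis a - cj (axis b)) by exact: cvgcB ua (cvg_conjc wb).
have d0 : axis a - cj (axis b) != 0.
  rewrite eq_complex /= opprK subrr eqxx /=; exact: ab.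
have el : cvgc +oo e (0 - cj 0) by exact: cvgcB gu (cvg_conjc gw).
have c0 : 0 - cj 0 = 0 by rewrite conjc0 subrr.
have ede : cvgc +oo (fun y => e y * (d y)^-1) 0.
  rewrite -[X in cvgc _ _ X](mul0r (axis a - cj (axis b))^-1) -{1}c0.
  exact: cvgcM el (cvgcV d0 dl).
apply: (cvgc_eq _ ede); apply: filterS near_pos => y y0.
have yn : (y^-1)%:C != 0 by rewrite (fmorph_eq0 (real_complex R)) invr_eq0 gt_eqF.
by rewrite /e /d !conjcM conjc_real -!mulrBl invfM mulrACA divff // mulr1.
Qed.

Lemma gram_padd P g (T : finType) (z b c : T -> C) :
  (forall x, g (z x) != None) ->
  gram (kernel (padd P g)) z b c =
  gram (kernel (pfun P)) z b c + gram (kernel g) z b c.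
Proof.
move=> gz; rewrite /gram -big_split; apply: eq_bigr => x _ /=.
rewrite -big_split; apply: eq_bigr => y _ /=.
by rewrite kernel_padd // mulrDr mulrDl.
Qed.

(** The form of P depends only on the moments \sum_x b_x z_x ^ p with p < n. At
    the far points i y (a + 1), a < n, any moments can be prescribed with
    coefficients that stay bounded, as the p-th moment grows like y ^ p, and
    there the kernel of g tends to 0. So far points can cancel the moments of
    the family that witnesses the negative squares of g, and can copy the
    moments of a family that witnesses those of P; in the limit the two parts
    do not interact. *)
Lemma has_negs_padd P g m1 m2 : axis_small g -> has_negs g m1 ->
  has_negs (pfun P) m2 -> has_negs (padd P g) (m1 + m2).
Proof.
move=> [gfin gsmall] /has_negs_exact[T [z1 [B1 [zf1 BE1]]]]
  /has_negs_exact[T2 [z2 [B2 [zf2 BE2]]]].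
pose n := size P; have sP : (size P <= n.+1)%N by exact: leqnSn.
pose W := invmx (axis_vander n).
have WV (p q : 'I_n) : \sum_a W p a * (axis (a : 'I_n).+1%:R) ^+ q = (p == q)%:R.
  have /matrixP /(_ p q) := mulVmx (axis_vander_unit n); rewrite !mxE => <-.
  by apply: eq_bigr => a _; rewrite !mxE.
pose cc (i : 'I_m1 + 'I_m2) p : C :=
  match i with inl k => - moment z1 (B1 k) p | inr k => moment z2 (B2 k) p end.
pose z y (x : T + 'I_n) : C :=
  match x with inl x => z1 x | inr a => axis (y * a.+1%:R) end.
pose b1 (i : 'I_m1 + 'I_m2) x : C := if i is inl k then B1 k x else 0.
pose B y i (x : T + 'I_n) : C := match x with
  | inl x => b1 i x
  | inr a => \sum_(p < n) cc i p * (y^-1)%:C ^+ p * W p a end.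
pose B0 i (x : T + 'I_n) : C := match x with
  | inl x => b1 i x
  | inr a => \sum_(p < n) cc i p * 0 ^+ p * W p a end.
pose tau (x : T + 'I_n) : R := if x is inr a then a.+1%:R else 0.
have tau0 x : 0 <= tau x by case: x => //= a; rewrite ler0n.
have an0 (a : 'I_n) : (0 : R) < a.+1%:R by rewrite ltr0n.
have zlim x : cvgc +oo (fun y => z y x * (y^-1)%:C) (axis (tau x)).
  case: x => [x|a] /=.
    have -> : axis 0 = z1 x * 0 by rewrite mulr0.
    exact: cvgcM (cvgc_cst _) (@cvg_invy R).
  apply: (cvgc_eq _ (cvgc_cst _)); apply: filterS near_pos => y y0.
  rewrite !axisE -mulrA -rmorphM mulrAC divff ?mul1r //.
  by rewrite gt_eqF.
have glim x : cvgc +oo (fun y => fin_part (g (z y x)) * (y^-1)%:C) 0.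
  case: x => [x|a] /=.
    rewrite -[X in cvgc _ _ X](mulr0 (fin_part (g (z1 x)))).
    exact: cvgcM (cvgc_cst _) (@cvg_invy R).
  have h : cvgc +oo (fun y => fin_part (g (axis (y * a.+1%:R))) *
      ((y * a.+1%:R)^-1)%:C * (a.+1%:R)%:C) (0 * (a.+1%:R)%:C).
    exact: cvgcM (cvgc_dilate (an0 a) gsmall) (cvgc_cst _).
  rewrite mul0r in h; apply: (cvgc_eq _ h); apply: filterS near_pos => y y0.
  rewrite -mulrA -rmorphM; congr (_ * _%:C).
  by rewrite invfM -mulrA mulVf ?mulr1 // gt_eqF.
have klim x x' : tau x + tau x' != 0 ->
    cvgc +oo (fun y => kernel g (z y x) (z y x')) 0.
  move=> h; exact: cvg_kernel_decay (tau0 x) (tau0 x') h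
    (zlim x) (zlim x') (glim x) (glim x').
have Blim i x : cvgc +oo (fun y => B y i x) (B0 i x).
  case: x => [x|a] /=; first exact: cvgc_cst.
  apply: cvg_sumc => p.
  exact: cvgcM (cvgcM (cvgc_cst _) (cvgcX (@cvg_invy R))) (cvgc_cst _).
have zfin x : \forall y \near +oo, upper (z y x) /\ g (z y x) != None.
  case: x => [x|a] /=; first by apply: nearW => y; exact: zf1.
  apply: filterS2 near_pos (near_dilate (an0 a) gfin) => y y0 gy; split=> //.
  by rewrite /upper /= mulr_gt0.
pose mm (i : 'I_m1 + 'I_m2) q : C :=
  if i is inr k then moment z2 (B2 k) q else 0.
have momE y i (q : 'I_n) : 0 < y -> moment (z y) (B y i) q = mm i q.
  move=> y0; have yn : (y^-1)%:C != 0.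
    by rewrite (fmorph_eq0 (real_complex R)) invr_eq0 gt_eqF.
  rewrite /moment big_sumType /=.
  have -> : \sum_a (\sum_(p < n) cc i p * (y^-1)%:C ^+ p * W p a) *
      axis (y * a.+1%:R) ^+ q = cc i q.
    transitivity (\sum_(p < n) cc i p * (y^-1)%:C ^+ p * y%:C ^+ q * (p == q)%:R).
      under eq_bigr do rewrite mulr_suml.
      rewrite exchange_big; apply: eq_bigr => p _ /=.
      rewrite -WV mulr_sumr; apply: eq_bigr => a _.
      by rewrite !axisE rmorphM /= !exprMn; ring.
    rewrite (bigD1 q) //= big1 ?addr0 => [|p pq]; last first.
      by rewrite (negPf pq) mulr0.
    rewrite eqxx mulr1 -mulrA -exprMn -rmorphM mulVf ?gt_eqF //.
    by rewrite rmorph1 expr1n mulr1.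
  case: i => k /=; first by rewrite /moment addrN.
  by rewrite big1 ?add0r // => x _; rewrite mul0r.
have -> : (m1 + m2)%N = #|{: 'I_m1 + 'I_m2}| by rewrite card_sum !card_ord.
apply: (@has_negs_lim _ _ (+oo : set_system R) _ _ _ _ z B).
  by move=> x; apply: filterS (zfin x) => y [? gn]; split=> //; rewrite /padd; case: (g _) gn.
pose K := kernel g.
pose gP i j := \sum_(p < n) \sum_(q < n) (P`_(p + q).+1)%:C * mm i p * cj (mm j q).
pose bg1 i j := bigram K z1 (b1 i) z1 (b1 j).
have lim0 i j : gP i j + bg1 i j = - (i == j)%:R.
  rewrite /gP /bg1 /bigram /mm /b1; case: i j => [k|k] [l|l].
  - rewrite big1 ?add0r => [|p _]; last by apply: big1 => q _; rewrite mulr0 mul0r.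
    exact: BE1.
  - rewrite big1 ?add0r => [|p _]; last by apply: big1 => q _; rewrite mulr0 mul0r.
    rewrite big1 ?oppr0 // => x _; rewrite big1 // => y _.
    by rewrite /comp conjc0 mulr0.
  - rewrite big1 ?add0r => [|p _]; last by apply: big1 => q _; rewrite conjc0 mulr0.
    rewrite big1 ?oppr0 // => x _; rewrite big1 // => y _.
    by rewrite /comp !mul0r.
  - rewrite -[RHS]BE2 -(gram_poly _ _ sP) => [|x]; last by case: (zf2 x).
    rewrite [X in _ + X]big1 ?addr0 // => x _; rewrite big1 // => y _.
    by rewrite /comp !mul0r.
move=> i j.
pose D y := bigram K (z y \o inl) (B y i \o inl) (z y \o inr) (B y j \o inr) +
  (bigram K (z y \o inr) (B y i \o inr) (z y \o inl) (B y j \o inl) +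
  bigram K (z y \o inr) (B y i \o inr) (z y \o inr) (B y j \o inr)).
have tl a : tau (inr a) != 0 by rewrite gt_eqF.
have blim (X Y : finType) (ix : X -> T + 'I_n) (iy : Y -> T + 'I_n) :
    (forall x y, tau (ix x) + tau (iy y) != 0) ->
    cvgc +oo (fun y => bigram K (z y \o ix) (B y i \o ix) (z y \o iy) (B y j \o iy)) 0.
  move=> h.
  have -> : (0 : C) = \sum_x \sum_x' B0 i (ix x) * 0 * cj (B0 j (iy x')).
    by rewrite big1 // => x _; rewrite big1 // => y _; rewrite mulr0 mul0r.
  apply: cvg_bigram => [x x'|x|x'].
  - exact: klim (h x x').
  - exact: Blim.
  - exact: Blim.
have Dlim : cvgc +oo D 0.
  rewrite -[X in cvgc _ _ X]addr0 -{2}[0]addr0.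
  apply: cvgcD; first by apply: blim => x a; rewrite add0r.
  apply: cvgcD; first by apply: blim => a x; rewrite addr0.
  by apply: blim => a b; rewrite gt_eqF // addr_gt0 //= ltr0n.
have Tlim : cvgc +oo (fun y => gP i j + bg1 i j + D y) (- (i == j)%:R).
  rewrite -lim0 -[X in cvgc _ _ X]addr0; exact: cvgcD (cvgc_cst _) Dlim.
apply: (cvgc_eq _ Tlim).
have zfin' : \forall y \near +oo, forall x, upper (z y x) /\ g (z y x) != None.
  exact: filter_forall.
apply: filterS2 near_pos zfin' => y y0 zy.
rewrite gram_padd => [|x]; last by case: (zy x).
rewrite (gram_poly _ _ sP) => [|x]; last by case: (zy x).
rewrite -addrA; congr (_ + _).
  by apply: eq_bigr => p _; apply: eq_bigr => q _; rewrite !momE.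
by rewrite gram_sum -[RHS]addrA.
Qed.

(** The assumption g(i y) = o(y) says that g does not compete with P at
    infinity; then the indices add up. *)
Lemma neg_index_padd P g k : axis_small g -> neg_index g k ->
  neg_index (padd P g) (kappa_minus P + k).
Proof.
move=> gs gk m; split; first exact: (bounded_index_padd (neg_index_bounded gk)).
move=> mk; apply: has_negs_le mk _; rewrite addnC.
by apply: has_negs_padd => //; [apply/gk|apply/kappa_minusP].
Qed.

End Asymptotics.

(** * Behaviour on the imaginary axis *)

Section AxisLimits.
Local Open Scope complex_scope.
Variable R : realType.
Local Notation C := R[i].
Local Notation cj := (@conjc R).
Local Notation sfun := (C -> option C).
Implicit Types (f g : sfun) (P m : {poly R}).

Definition axis_lim f a := finite_axis f /\
  cvgc +oo (fun y => fin_part (f (axis y))) a.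

Definition axis_inv (y : R) : C := (axis y)^-1.

Lemma cvg_axis_inv : cvgc +oo axis_inv 0.
Proof.
have -> : (0 : C) = 'i^-1 * 0 by rewrite mulr0.
have h : cvgc +oo (fun y : R => 'i^-1 * (y^-1)%:C) ('i^-1 * 0 : C).
  exact: cvgcM (cvgc_cst _) (@cvg_invy R).
apply: (cvgc_eq _ h); apply: nearW => y.
by rewrite /axis_inv axisE invfM fmorphV.
Qed.

Lemma axis_neq0 (y : R) : 0 < y -> axis y != 0.
Proof. by move=> y0; rewrite eq_complex /= negb_and (gt_eqF y0) orbT. Qed.

Lemma lead_coefC_neq0 P : P != 0 -> (lead_coef P)%:C != 0.
Proof. by rewrite (fmorph_eq0 (real_complex R)) lead_coef_eq0. Qed.

Lemma poly_axis P : P != 0 -> exists r : R -> C,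
  cvgc +oo r (lead_coef P)%:C /\
  forall y, 0 < y -> poly_eval P (axis y) = axis y ^+ (size P).-1 * r y.
Proof.
move=> P0; set d := (size P).-1.
have dP : size P = d.+1 by rewrite prednK // size_poly_gt0.
exists (fun y => \sum_(i < d.+1) (P`_i)%:C * axis_inv y ^+ (d - i)); split.
  have -> : (lead_coef P)%:C = \sum_(i < d.+1) (P`_i)%:C * 0 ^+ (d - i).
    rewrite big_ord_recr /= subnn mulr1 big1 ?add0r // => i _.
    by rewrite -(subnSK (ltn_ord i)) exprS mul0r mulr0.
  apply: cvg_sumc => i.
  exact: cvgcM (cvgc_cst _) (cvgcX cvg_axis_inv).
move=> y y0.
rewrite /poly_eval (horner_coef_wide _ (_ : size _ <= d.+1)%N); last first.
  by rewrite size_map_poly dP.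
rewrite mulr_sumr; apply: eq_bigr => i _; rewrite coef_map /=.
have id : (i <= d)%N by rewrite -ltnS.
have -> : axis y ^+ d = axis y ^+ (d - i) * axis y ^+ i by rewrite -exprD subnK.
rewrite /axis_inv exprVn; field.
by rewrite expf_neq0 // axis_neq0.
Qed.

Lemma near_poly_neq0 P : P != 0 -> \forall y \near +oo, poly_eval P (axis y) != 0.
Proof.
move=> P0; have [r [rl rE]] := poly_axis P0.
apply: filterS2 (@near_pos R) (cvgc_neq rl (lead_coefC_neq0 P0)) => y y0 r0.
by rewrite rE // mulf_neq0 // expf_neq0 // axis_neq0.
Qed.

Lemma cvg_poly_inv P : P != 0 ->
  cvgc +oo (fun y => (poly_eval P (axis y))^-1)
    (if (size P <= 1)%N then (lead_coef P)%:C^-1 else 0).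
Proof.
move=> P0; have [r [rl rE]] := poly_axis P0; set d := (size P).-1 in rE.
have dP : size P = d.+1 by rewrite prednK // size_poly_gt0.
have lc0 := lead_coefC_neq0 P0.
have h : cvgc +oo (fun y => axis_inv y ^+ d * (r y)^-1)
    (0 ^+ d * (lead_coef P)%:C^-1).
  exact: cvgcM (cvgcX cvg_axis_inv) (cvgcV lc0 rl).
have -> : (if (size P <= 1)%N then (lead_coef P)%:C^-1 else 0) =
    0 ^+ d * (lead_coef P)%:C^-1.
  rewrite dP; case: (d) => [|e]; first by rewrite expr0 mul1r.
  by rewrite exprS !mul0r.
apply: (cvgc_eq _ h); apply: filterS (@near_pos R) => y y0.
by rewrite rE // invfM exprVn.
Qed.

Lemma axis_lim_padd P f (a c : C) : axis_lim f a ->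
  cvgc +oo (fun y => (poly_eval P (axis y))^-1) c -> a * c = 0 -> P != 0 ->
  (\forall y \near +oo, padd P f (axis y) != None /\ padd P f (axis y) != Some 0)
  /\ axis_lim (@ninv R \o padd P f) (- c).
Proof.
move=> [ff fl] Pc ac P0.
pose q y := 1 + fin_part (f (axis y)) * (poly_eval P (axis y))^-1.
have ql : cvgc +oo q 1.
  rewrite -[X in cvgc _ _ X]addr0 -ac; exact: cvgcD (cvgc_cst _) (cvgcM fl Pc).
have q0 : \forall y \near +oo, q y != 0 by exact: cvgc_neq ql (oner_neq0 _).
have pE : \forall y \near +oo, exists2 a, padd P f (axis y) = Some a &
    a != 0 /\ - a^-1 = - ((poly_eval P (axis y))^-1 * (q y)^-1).
  apply: filterS3 (near_poly_neq0 P0) q0 ff => y Py; rewrite /q /padd.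
  case: (f (axis y)) => // b /= qy _; eexists; first by [].
  have -> : poly_eval P (axis y) + b =
      poly_eval P (axis y) * (1 + b * (poly_eval P (axis y))^-1) by field.
  by rewrite mulf_neq0 // invfM.
split; [|split].
- by apply: filterS pE => y [b -> [b0 _]]; split=> //; apply/eqP => -[/eqP]; rewrite (negPf b0).
- by apply: filterS pE => y [b /= -> [/negPf /= -> _]].
have h : cvgc +oo (fun y => - ((poly_eval P (axis y))^-1 * (q y)^-1)) (- (c * 1^-1)).
  exact: cvgcN (cvgcM Pc (cvgcV (oner_neq0 _) ql)).
rewrite invr1 mulr1 in h; apply: (cvgc_eq _ h).
by apply: filterS pE => y [b /= -> [/negPf /= -> <-]].
Qed.

Lemma axis_lim_ninv f a : axis_lim f a -> a != 0 ->
  (\forall y \near +oo, f (axis y) != None /\ f (axis y) != Some 0)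
  /\ axis_lim (@ninv R \o f) (- a^-1).
Proof.
move=> [ff fl] a0.
have pE : \forall y \near +oo, exists2 a, f (axis y) = Some a &
    a != 0 /\ - a^-1 = - (fin_part (f (axis y)))^-1.
  apply: filterS2 (cvgc_neq fl a0) ff => y.
  by case: (f (axis y)) => // b /= b0 _; exists b.
split; [|split].
- by apply: filterS pE => y [b -> [b0 _]]; split=> //; apply/eqP => -[/eqP]; rewrite (negPf b0).
- by apply: filterS pE => y [b /= -> [/negPf /= -> _]].
apply: (cvgc_eq _ (cvgcN (cvgcV a0 fl))).
by apply: filterS pE => y [b /= -> [/negPf /= -> _]].
Qed.

Lemma poly_evalC (c : R) z : poly_eval c%:P z = c%:C.
Proof. by rewrite /poly_eval map_polyC hornerC. Qed.

Lemma poly_evalXM P z : poly_eval ('X * P) z = z * poly_eval P z.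
Proof. by rewrite /poly_eval rmorphM /= map_polyX hornerM hornerX. Qed.

Lemma poly_evalN P z : poly_eval (- P) z = - poly_eval P z.
Proof. by rewrite /poly_eval rmorphN /= hornerN. Qed.

Lemma poly_evalZX (c : R) z : poly_eval (c *: 'X) z = z * c%:C.
Proof. by rewrite /poly_eval map_polyZ map_polyX hornerZ hornerX mulrC. Qed.

Lemma axis_lim_paddC (c : R) f a : axis_lim f a ->
  axis_lim (padd c%:P f) (c%:C + a).
Proof.
move=> [ff fl]; split.
  by apply: filterS ff => y; rewrite /padd; case: (f (axis y)).
apply: (cvgc_eq _ (cvgcD (cvgc_cst c%:C) fl)).
by apply: filterS ff => y; rewrite /padd poly_evalC; case: (f (axis y)).
Qed.

Lemma axis_lim_small f a : axis_lim f a -> axis_small f.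
Proof.
move=> [ff fl]; split; first exact: ff.
rewrite -[X in cvgc _ _ X](mulr0 a).
exact: cvgcM fl (@cvg_invy R).
Qed.

(** The function z f(z), which governs the second index of the class. *)
Definition pscale f : sfun := fun z => sphere_scale z (f z).

Lemma pscale_small f : axis_lim f 0 -> axis_small (pscale f).
Proof.
move=> [ff fl]; split.
  by apply: filterS ff => y; rewrite /pscale; case: (f (axis y)).
have h : cvgc +oo (fun y => 'i * fin_part (f (axis y))) ('i * 0 : C).
  exact: cvgcM (cvgc_cst _) fl.
rewrite mulr0 in h; apply: (cvgc_eq _ h).
apply: filterS2 (@near_pos R) ff => y y0; rewrite /pscale axisE.
case: (f _) => //= b _.
rewrite fmorphV; field.
by rewrite (fmorph_eq0 (real_complex R)) gt_eqF.
Qed.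

Lemma pscale_meromorphic f : meromorphic f -> meromorphic (pscale f).
Proof.
move=> fm; apply: (@meromorphic_scale _ f (fun z => z)) => [z|z z0|//].
  exact: (@derivable_id _ (C^o)).
exact: nonreal_neq0.
Qed.

Lemma pscale_symmetric f : real_symmetric f -> real_symmetric (pscale f).
Proof.
move=> fs z z0; rewrite /pscale fs //; case: (f z) => //= a.
by rewrite conjcM.
Qed.

Lemma pscale_isolated_zeros f : isolated_zeros f -> isolated_zeros (pscale f).
Proof.
move=> fz z z0; apply: filterS2 (near_dnbhs (near_nonreal z0)) (fz z z0) => w w0.
rewrite /pscale; case: (f w) => [a|] //= a0; apply/eqP => -[/eqP].
by rewrite mulf_eq0 (negPf (nonreal_neq0 w0)) /= => /eqP aE; rewrite aE eqxx in a0.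
Qed.

End AxisLimits.

(** * One step of the continued fraction, and the indices *)

Section StepIndex.
Local Open Scope complex_scope.
Variable R : realType.
Local Notation C := R[i].
Local Notation cj := (@conjc R).
Local Notation sfun := (C -> option C).
Implicit Types (f g : sfun) (P m : {poly R}) (l : R).

Definition ninvf f : sfun := @ninv R \o f.

(** The map f |-> 1 / (- z m + 1 / (l + f)), see [stepE], decomposed into
    additions of polynomials and the map w |-> - 1 / w, since both operations
    have a known effect on the index. *)
Definition step m l f : sfun :=
  ninvf (padd ('X * m) (ninvf (padd l%:P f))).

Definition unstep m l f : sfun :=
  padd (- l%:P) (ninvf (padd (- ('X * m)) (ninvf f))).

Lemma ninvfK : involutive ninvf.
Proof. by move=> f; apply: funext => z; exact: ninvK. Qed.

Lemma paddNK P : cancel (padd P) (padd (- P)).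
Proof.
move=> f; apply: funext => z.
by rewrite /padd poly_evalN sphere_addNK.
Qed.

Lemma paddKN P : cancel (padd (- P)) (padd P).
Proof. by move=> f; rewrite -{1}[P]opprK paddNK. Qed.

Lemma stepK m l : cancel (step m l) (unstep m l).
Proof. by move=> f; rewrite /unstep /step ninvfK paddNK ninvfK paddNK. Qed.

Lemma unstepK m l : cancel (unstep m l) (step m l).
Proof. by move=> f; rewrite /unstep /step paddKN ninvfK paddKN ninvfK. Qed.

(** The step as it acts on z f(z): the factor z moves from the first polynomial
    to the second one. *)
Definition stepS m l g : sfun :=
  ninvf (padd m (ninvf (padd (l *: 'X) g))).

Lemma stepE m l f z : step m l f z =
  sphere_inv (sphere_add (- (z * poly_eval m z))
    (sphere_inv (sphere_add l%:C (f z)))).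
Proof.
rewrite /step /ninvf /padd /= poly_evalXM poly_evalC.
case: (sphere_add _ (f z)) => [a|] /=; last first.
  by rewrite !addr0 oppr_eq0; case: ifP => //= _; rewrite invrN.
have [_|a0] := eqVneq a 0 => //=.
have -> : - (z * poly_eval m z) + a^-1 = - (z * poly_eval m z - a^-1).
  by rewrite opprB addrC.
by rewrite oppr_eq0; case: ifP => //= _; rewrite invrN.
Qed.

Lemma pscale_step m l f z : z != 0 ->
  pscale (step m l f) z = stepS m l (pscale f) z.
Proof.
move=> z0; rewrite /pscale /stepS /step /ninvf /padd /=.
rewrite poly_evalXM poly_evalC poly_evalZX.
have inv_z (a : C) : z * (- a^-1) = - (z^-1 * a)^-1.
  by rewrite invfM invrK mulrN.
have sc w : sphere_scale z (ninv w) = ninv (sphere_scale z^-1 w).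
  case: w => [a|] /=; last by rewrite mulr0.
  rewrite mulf_eq0 invr_eq0 (negPf z0) /=; case: ifP => //= _.
  by rewrite inv_z.
rewrite sc; congr ninv.
have ad a w : sphere_scale z^-1 (sphere_add (z * a) w) =
    sphere_add a (sphere_scale z^-1 w).
  by case: w => //= b; rewrite mulrDr mulKf.
rewrite ad; congr sphere_add.
case: (f z) => [a|] /=; last by rewrite mulr0.
rewrite -mulrDr mulf_eq0 (negPf z0) /=; case: ifP => //= _.
by rewrite invfM mulrN.
Qed.

Lemma kappa_minusC l : kappa_minus l%:P = 0%N.
Proof.
apply/eqP; rewrite -leqn0.
apply: (poly_bounded (P := l%:P) (n := 0)); first exact: size_polyC_leq1.
by apply/kappa_minusP.
Qed.

(** Membership in the class with the indices kappa and k, with both indices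
    expressed by [neg_index]. *)
Record solves kappa k f : Prop := Solves {
  solves_mero : meromorphic f;
  solves_sym : real_symmetric f;
  solves_index : neg_index f kappa;
  solves_indexS : neg_index (pscale f) k }.

Lemma meromorphic_padd P f : meromorphic f -> meromorphic (padd P f).
Proof. by move=> fm; apply: meromorphic_add fm; exact: derivable_poly. Qed.

Lemma paddC_index l f k : axis_lim f 0 -> neg_index f k ->
  neg_index (padd l%:P f) k.
Proof.
move=> fl fk; have := neg_index_padd l%:P (axis_lim_small fl) fk.
by rewrite kappa_minusC.
Qed.

(** None of the intermediate functions vanishes or has a pole far up on the
    imaginary axis, which is what [bounded_isolated_zeros] asks for. *)
Lemma step_axis m l f : m != 0 -> l != 0 -> axis_lim f 0 ->
  [/\ \forall y \near +oo, padd l%:P f (axis y) != None /\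
        padd l%:P f (axis y) != Some 0,
      \forall y \near +oo, ninvf (padd l%:P f) (axis y) != None /\
        ninvf (padd l%:P f) (axis y) != Some 0,
      axis_small (ninvf (padd l%:P f)),
      \forall y \near +oo,
        padd ('X * m) (ninvf (padd l%:P f)) (axis y) != None /\
        padd ('X * m) (ninvf (padd l%:P f)) (axis y) != Some 0
    & axis_lim (step m l f) 0].
Proof.
move=> m0 l0 fl; have g1 := axis_lim_paddC l fl; rewrite addr0 in g1.
have lC : l%:C != 0 by rewrite (fmorph_eq0 (real_complex R)).
have [n1 g2] := axis_lim_ninv g1 lC.
have lV : - l%:C^-1 != 0 by rewrite oppr_eq0 invr_eq0.
have [n2 _] := axis_lim_ninv g2 lV.
have Xm0 : 'X * m != 0 by rewrite mulf_neq0 ?polyX_eq0.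
have sXm : (size ('X * m)%R <= 1)%N = false.
  by rewrite mulrC size_mulX // ltnS leqn0 size_poly_eq0 (negPf m0).
have PV := cvg_poly_inv Xm0; rewrite sXm in PV.
have [n3 g3] := axis_lim_padd g2 PV (mulr0 _) Xm0.
rewrite oppr0 in g3.
by split; [exact: n1|exact: n2|exact: axis_lim_small g2|exact: n3|exact: g3].
Qed.

Lemma stepS_axis m l f : m != 0 -> l != 0 -> axis_lim f 0 ->
  [/\ \forall y \near +oo, padd (l *: 'X) (pscale f) (axis y) != None /\
        padd (l *: 'X) (pscale f) (axis y) != Some 0,
      \forall y \near +oo, ninvf (padd (l *: 'X) (pscale f)) (axis y) != None /\
        ninvf (padd (l *: 'X) (pscale f)) (axis y) != Some 0,
      axis_small (ninvf (padd (l *: 'X) (pscale f)))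
    & \forall y \near +oo,
        padd m (ninvf (padd (l *: 'X) (pscale f))) (axis y) != None /\
        padd m (ninvf (padd (l *: 'X) (pscale f))) (axis y) != Some 0].
Proof.
move=> m0 l0 fl; have [n1 n2 _ _ _] := step_axis m0 l0 fl.
set h1 := padd (l *: 'X) (pscale f).
have h1E y : 0 < y -> h1 (axis y) = sphere_scale (axis y) (padd l%:P f (axis y)).
  move=> y0; rewrite /h1 /padd /pscale poly_evalZX poly_evalC.
  by case: (f _) => //= a; rewrite mulrDr.
have n1' : \forall y \near +oo, h1 (axis y) != None /\ h1 (axis y) != Some 0.
  apply: filterS2 (@near_pos R) n1 => y y0; rewrite h1E //.
  case: (padd _ _ _) => [a|] /=; last by case.
  move=> [_ a0]; split=> //; apply: contra a0 => /eqP[/eqP].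
  by rewrite mulf_eq0 (negPf (axis_neq0 y0)) => /eqP ->.
have n2' : \forall y \near +oo, ninvf h1 (axis y) != None /\
    ninvf h1 (axis y) != Some 0.
  apply: filterS n1' => y; rewrite /ninvf /=.
  case: (h1 _) => [a|] /=; last by case.
  move=> [_ a0]; have -> : (a == 0) = false.
    by apply/negP => /eqP aE; rewrite aE eqxx in a0.
  split=> //; apply/eqP => -[/eqP]; rewrite oppr_eq0 invr_eq0 => /eqP aE.
  by rewrite aE eqxx in a0.
have h2 : axis_lim (ninvf h1) 0.
  have [f2 l2] : axis_lim (ninvf (padd l%:P f)) (- l%:C^-1).
    have g1 := axis_lim_paddC l fl; rewrite addr0 in g1.
    have lC : l%:C != 0 by rewrite (fmorph_eq0 (real_complex R)).
    exact: (axis_lim_ninv g1 lC).2.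
  split; first by apply: filterS n2' => y [].
  have h : cvgc +oo (fun y => axis_inv y * fin_part (ninvf (padd l%:P f) (axis y)))
      (0 * - l%:C^-1) by exact: cvgcM (@cvg_axis_inv R) l2.
  rewrite mul0r in h; apply: (cvgc_eq _ h).
  apply: filterS2 (@near_pos R) n1 => y y0; rewrite /ninvf /= h1E //.
  case: (padd _ _ _) => [a|] /=; last by case.
  move=> [_ a0]; rewrite mulf_eq0 (negPf (axis_neq0 y0)) /=.
  by case: ifP => /= _; rewrite ?mulr0 // invfM mulrN.
have [n3 _] := axis_lim_padd h2 (cvg_poly_inv m0) (mul0r _) m0.
by split; [exact: n1'|exact: n2'|exact: axis_lim_small h2|exact: n3].
Qed.

Lemma solves_step m l f kappa k : m != 0 -> l != 0 -> axis_lim f 0 ->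
  solves kappa k f ->
  solves (kappa_minus ('X * m) + kappa)
    (kappa_minus m + (kappa_minus (l *: 'X) + k)) (step m l f).
Proof.
move=> m0 l0 fl [fm fs fi fiS].
have [n1 n2 s2 n3 f0l] := step_axis m0 l0 fl.
have [t1 t2 u2 t3] := stepS_axis m0 l0 fl.
have i1 := paddC_index l fl fi.
have m1 := meromorphic_padd l%:P fm.
have y1 := real_symmetric_add l%:P fs.
have z1 := bounded_isolated_zeros m1 y1 (neg_index_bounded i1) n1.
have i2 := neg_index_ninv m1 z1 i1.
have m2 := meromorphic_ninv m1 z1.
have y2 := real_symmetric_ninv y1.
have i3 := neg_index_padd ('X * m) s2 i2.
have m3 := meromorphic_padd ('X * m) m2.
have y3 := real_symmetric_add ('X * m) y2.
have z3 := bounded_isolated_zeros m3 y3 (neg_index_bounded i3) n3.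
have i4 := neg_index_ninv m3 z3 i3.
have m4 := meromorphic_ninv m3 z3.
have y4 := real_symmetric_ninv y3.
split; [exact: m4|exact: y4|exact: i4|].
have j1 := neg_index_padd (l *: 'X) (pscale_small fl) fiS.
have p1 := meromorphic_padd (l *: 'X) (pscale_meromorphic fm).
have q1 := real_symmetric_add (l *: 'X) (pscale_symmetric fs).
have r1 := bounded_isolated_zeros p1 q1 (neg_index_bounded j1) t1.
have j2 := neg_index_ninv p1 r1 j1.
have p2 := meromorphic_ninv p1 r1.
have q2 := real_symmetric_ninv q1.
have j3 := neg_index_padd m u2 j2.
have p3 := meromorphic_padd m p2.
have q3 := real_symmetric_add m q2.
have r3 := bounded_isolated_zeros p3 q3 (neg_index_bounded j3) t3.
have j4 := neg_index_ninv p3 r3 j3.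
apply: (neg_index_eq _ j4) => z zu.
exact: esym (pscale_step m l f (nonreal_neq0 (upper_nonreal zu))).
Qed.

(** Undoing the operations one by one gives finite bounds for both indices of
    f. Hence f has indices, and [solves_step] tells how they are related to
    those of the given function. *)
Lemma solves_unstep m l f kappa k : m != 0 -> l != 0 -> axis_lim f 0 ->
  solves kappa k (step m l f) ->
  exists kappa' k', [/\ solves kappa' k' f,
    kappa = (kappa_minus ('X * m) + kappa')%N
    & k = (kappa_minus m + (kappa_minus (l *: 'X) + k'))%N].
Proof.
move=> m0 l0 fl [m4 y4 i4 j4].
have [n1 n2 s2 n3 f0l] := step_axis m0 l0 fl.
have [t1 t2 u2 t3] := stepS_axis m0 l0 fl.
have n4 : \forall y \near +oo, step m l f (axis y) != None /\
    step m l f (axis y) != Some 0.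
  apply: filterS n3 => y; rewrite /step /ninvf /=.
  case: (padd _ _ _) => [a|] /=; last by case.
  move=> [_ a0]; have -> : (a == 0) = false.
    by apply/negP => /eqP aE; rewrite aE eqxx in a0.
  split=> //; apply/eqP => -[/eqP]; rewrite oppr_eq0 invr_eq0 => /eqP aE.
  by rewrite aE eqxx in a0.
have z4 := bounded_isolated_zeros m4 y4 (neg_index_bounded i4) n4.
have b3 := bounded_index_ninv m4 z4 (neg_index_bounded i4).
have m3 := meromorphic_ninv m4 z4.
have y3 := real_symmetric_ninv y4.
rewrite -/(ninvf (step m l f)) [X in ninvf X]/step ninvfK in b3 m3 y3.
have b2 := bounded_index_padd (P := - ('X * m)) b3.
have m2 := meromorphic_padd (- ('X * m)) m3.
have y2 := real_symmetric_add (- ('X * m)) y3.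
rewrite -/(padd _ _) in y2; rewrite paddNK in b2 m2 y2.
have z2 := bounded_isolated_zeros m2 y2 b2 n2.
have b1 := bounded_index_ninv m2 z2 b2.
have m1 := meromorphic_ninv m2 z2.
have y1 := real_symmetric_ninv y2.
rewrite -/(ninvf _) ninvfK in b1 m1 y1.
have b0 := bounded_index_padd (P := - l%:P) b1.
have fm := meromorphic_padd (- l%:P) m1.
have fs := real_symmetric_add (- l%:P) y1.
rewrite -/(padd _ _) in fs; rewrite paddNK in b0 fm fs.
have p4 := pscale_meromorphic m4.
have q4 := pscale_symmetric y4.
have r4 := pscale_isolated_zeros z4.
have c3 := bounded_index_ninv p4 r4 (neg_index_bounded j4).
have p3 := meromorphic_ninv p4 r4.
have q3 := real_symmetric_ninv q4.
set h1 := padd (l *: 'X) (pscale f) in t1 t2 u2 t3.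
have eq3 z : nonreal z -> (@ninv R \o pscale (step m l f)) z = padd m (ninvf h1) z.
  move=> z0 /=; rewrite (pscale_step m l f (nonreal_neq0 z0)) /stepS /ninvf /= ninvK //.
have c3' : bounded_index (padd m (ninvf h1)) k.
  by move=> p /(has_negs_eq (fun z zu => esym (eq3 z (upper_nonreal zu)))) /c3.
have p3' := meromorphic_eq eq3 p3.
have q3' := real_symmetric_eq eq3 q3.
have c2 := bounded_index_padd (P := - m) c3'.
have p2 := meromorphic_padd (- m) p3'.
have q2 := real_symmetric_add (- m) q3'.
rewrite -/(padd _ _) in q2; rewrite paddNK in c2 p2 q2.
have r2 := bounded_isolated_zeros p2 q2 c2 t2.
have c1 := bounded_index_ninv p2 r2 c2.
rewrite -/(ninvf _) ninvfK in c1.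
have c0 := bounded_index_padd (P := - (l *: 'X)) c1.
rewrite paddNK in c0.
have [kappa' fi] := neg_index_exists b0.
have [k' fiS] := neg_index_exists c0.
have fsol : solves kappa' k' f by split.
have [_ _ gi gj] := solves_step m0 l0 fl fsol.
exists kappa', k'; split; first exact: fsol.
  exact: neg_index_uniq i4 gi.
exact: neg_index_uniq j4 gj.
Qed.

Lemma gen_stieltjesP kappa k f : gen_stieltjes kappa%:Z k%:Z f <-> solves kappa k f.
Proof.
split=> [[/gen_nevanlinnaE[fm fs fi] /gen_nevanlinnaE[_ _ fj]]|[fm fs fi fj]].
  by split.
split; apply/gen_nevanlinnaE.
  by split; [exact: fm|exact: fs|exact: fi].
by split; [exact: pscale_meromorphic|exact: pscale_symmetric|exact: fj].
Qed.

Lemma solves_eq kappa k f g : (forall z, nonreal z -> f z = g z) ->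
  solves kappa k f -> solves kappa k g.
Proof.
move=> fg [fm fs fi fj].
have fgu z : upper z -> f z = g z by move=> /upper_nonreal /fg.
split.
- exact: meromorphic_eq fg fm.
- exact: real_symmetric_eq fg fs.
- exact: neg_index_eq fgu fi.
- by apply: (neg_index_eq _ fj) => z zu; rewrite /pscale fgu.
Qed.

Lemma solves0 : solves 0 0 (fun=> Some 0).
Proof.
have z0 : neg_index (fun _ : C => Some 0) 0.
  move=> m; split; last by rewrite leqn0 => /eqP ->; exact: has_negs0.
  move=> h; have h' : has_negs (pfun (0 : {poly R})) m.
    by apply: (has_negs_eq _ h) => z _; rewrite /pfun /= /poly_eval rmorph0 horner0.
  have s0 : (size (0%R : {poly R}) <= 1)%N by rewrite size_poly0.
  exact: (@poly_bounded _ _ 0%N s0 _ h').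
split.
- apply: (@meromorphic_eq _ (pfun (0 : {poly R}))); last exact: meromorphic_poly.
  by move=> z _; rewrite /pfun /= /poly_eval rmorph0 horner0.
- by move=> z _ /=; rewrite oppr0.
- exact: z0.
- by apply: (neg_index_eq _ z0) => z _; rewrite /pscale /= mulr0.
Qed.

Lemma axis_lim0 : axis_lim (fun=> Some 0 : option C) 0.
Proof. by split; [exact: nearW|exact: cvgc_cst]. Qed.

End StepIndex.

(** * Negative eigenvalues *)

Section Eigenvalues.
Local Open Scope complex_scope.
Variable R : realType.
Local Notation C := R[i].

Definition toCmx n (A : 'M[R]_n) : 'M[C]_n := map_mx (real_complex R) A.

Lemma toCmx_herm n (A : 'M[R]_n) : A^T = A -> adj (toCmx A) = toCmx A.
Proof.
move=> As; apply/matrixP => i j; rewrite !mxE conjc_real.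
by rewrite -[in RHS]As mxE.
Qed.

Lemma char_poly_conj (K : fieldType) n (P A : 'M[K]_n) : P \in unitmx ->
  char_poly (P *m A *m invmx P) = char_poly A.
Proof.
move=> Pu; pose Q := map_mx polyC P; pose Q' := map_mx polyC (invmx P).
have QQ : Q *m Q' = 1%:M by rewrite -map_mxM mulmxV // map_mx1.
rewrite /char_poly.
have -> : char_poly_mx (P *m A *m invmx P) = Q *m char_poly_mx A *m Q'.
  rewrite /char_poly_mx !map_mxM /= mulmxBr mulmxBl; congr (_ - _).
  by rewrite scalar_mxC -mulmxA QQ mulmx1.
rewrite !det_mulmx mulrAC -det_mulmx QQ det1 mul1r //.
Qed.

Lemma nu_minus_count n (A : 'M[R]_n) (s : seq R) :
  char_poly A = \prod_(x <- s) ('X - x%:P) ->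
  nu_minus A = count (fun x => x < 0) s.
Proof.
rewrite /nu_minus => ->; set p := \prod_(x <- s) _.
have p0 : p != 0.
  rewrite /p -size_poly_eq0 size_prod_XsubC //.
have memr x : (x \in rootsR p) = (x \in s).
  have := roots_on_rootsR p0 => /(_ x); rewrite in_itv /= => <-.
  by rewrite root_prod_XsubC.
under eq_bigr do rewrite mu_prod_XsubC.
transitivity (\sum_(x <- undup s | (x < 0)%R) count_mem x s)%N.
  apply: perm_big; apply: uniq_perm => [||x].
  - exact: uniq_roots.
  - exact: undup_uniq.
  - by rewrite memr mem_undup.
rewrite -sum1_count.
rewrite (eq_bigr (fun x => \sum_(y <- s | y == x) 1)%N) => [|x _]; last first.
  by rewrite sum1_count.
rewrite (exchange_big_dep (fun y => y < 0)) /=; last by move=> x y x0 /eqP ->.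
rewrite big_seq_cond [RHS]big_seq_cond; apply: eq_bigr => y /andP[ys y0].
rewrite big_mkcond (bigD1_seq y) ?undup_uniq ?mem_undup //= y0 eqxx.
by rewrite big1 // => x xy; rewrite [y == x]eq_sym (negPf xy) andbF.
Qed.

(** By the spectral theorem the characteristic polynomial splits with the real
    diagonal entries d as its roots, and those of - A are - d; if A is
    invertible, no d is zero. *)
Lemma nu_minus_neg n (A : 'M[R]_n) : A^T = A ->
  has_neg (toCmx A) (nu_minus A) /\
  (\det A != 0 -> (nu_minus A + nu_minus (- A))%N = n).
Proof.
move=> As; have [P [d [Pu adjP AE]]] := hermitian_diag (toCmx_herm As).
pose s := [seq d 0 i | i <- enum 'I_n].
have sE (F : R -> {poly R}) : \prod_(x <- s) F x = \prod_(i < n) F (d 0 i).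
  by rewrite big_map big_enum.
have cpA : char_poly A = \prod_(x <- s) ('X - x%:P).
  apply: (map_poly_inj (real_complex R)); rewrite map_char_poly -/(toCmx A) AE.
  rewrite adjP char_poly_conj // char_poly_trig; last first.
    by apply/is_trig_mxP => i j ij; rewrite !mxE -val_eqE ltn_eqF.
  rewrite sE rmorph_prod; apply: eq_bigr => i _.
  by rewrite !mxE eqxx mulr1n rmorphB /= map_polyX map_polyC.
have cpN : char_poly (- A) = \prod_(x <- map -%R s) ('X - x%:P).
  apply: (map_poly_inj (real_complex R)); rewrite map_char_poly.
  have -> : map_mx (real_complex R) (- A) = P *m (- diag_mx (map_mx (real_complex R) d)) *m invmx P.
    rewrite mulmxN mulNmx -adjP -AE.
    by apply/matrixP => i j; rewrite !mxE rmorphN.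
  rewrite char_poly_conj // char_poly_trig; last first.
    by apply/is_trig_mxP => i j ij; rewrite !mxE -val_eqE ltn_eqF // mulr0n oppr0.
  rewrite big_map sE rmorph_prod; apply: eq_bigr => i _.
  rewrite !mxE eqxx mulr1n rmorphB /= map_polyX map_polyC /=.
  by congr ('X - _%:P); rewrite [RHS]rmorphN.
have cnt (p : pred R) : count p s = #|[set i | p (d 0 i)]%SET|.
  rewrite count_map -sum1_count -sum1_card big_enum_cond /=.
  by apply: eq_bigl => i; rewrite inE.
split.
  rewrite (nu_minus_count cpA) cnt.
  have [B BE] := diag_has_neg Pu (leqnn #|[set i | (d 0 i < 0)%R]%SET|).
  by exists B => i j; rewrite AE BE !mxE addNr normr0 invr_ge0 ler0n.
move=> detA; rewrite (nu_minus_count cpA) (nu_minus_count cpN).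
have d0 i : d 0 i != 0.
  apply/eqP => di; move/eqP: detA; apply.
  apply: (complexI (R := R)); rewrite -[LHS]/(real_complex R (\det A)) -det_map_mx.
  rewrite -/(toCmx A) AE !det_mulmx det_diag (bigD1 i) //= mxE di.
  by rewrite mul0r mulr0 mul0r.
have -> : count (fun x => x < 0) (map -%R s) = count (predC (fun x => x < 0)) s.
  rewrite [LHS]count_map !cnt; congr #|pred_of_set _|; apply/setP => i.
  by rewrite !inE /= oppr_lt0 -leNgt lt_def d0.
by rewrite count_predC size_map size_enum_ord.
Qed.

End Eigenvalues.

(** * Moments and Hankel matrices *)

Section HankelBound.
Local Open Scope complex_scope.
Variable R : realType.
Local Notation C := R[i].
Local Notation cj := (@conjc R).
Local Notation sfun := (C -> option C).
Implicit Types (f g : sfun) (s : nat -> R).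

Definition spoly s K : {poly R} := \poly_(j < K) s j.

(** The moment expansion with K moments, as a limit in the variable u = 1 / z.
    *)
Definition expands s K f := finite_axis f /\
  cvgc +oo (fun y => (fin_part (f (axis y)) +
     poly_eval ('X * spoly s K) (axis_inv y)) * axis y ^+ K) 0.

Definition hankelC s n : 'M[C]_n := \matrix_(i, j) (s (i + j)%N)%:C.

Lemma axis_invD (y t : R) : axis_inv (y * t) = axis_inv t * (y^-1)%:C.
Proof. by rewrite /axis_inv !axisE rmorphM /= fmorphV -!invfM; congr (_^-1); ring. Qed.

Lemma upper_axis (y : R) : 0 < y -> upper (axis y).
Proof. by []. Qed.

Lemma kernel_expand (Q : {poly R}) K f z w (rho : C -> C) : upper z -> upper w ->
  (size Q <= K.+1)%N ->
  fin_part (f z) = - poly_eval Q z^-1 + rho z ->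
  fin_part (f w) = - poly_eval Q w^-1 + rho w ->
  kernel f z w =
  \sum_(a < K) \sum_(b < K) (Q`_(a + b).+1)%:C * z^-1 ^+ a.+1 * (cj w^-1) ^+ b.+1
  + (rho z - cj (rho w)) / (z - cj w).
Proof.
move=> zu wu sQ fz fw; rewrite /kernel fz fw.
have z0 := nonreal_neq0 (upper_nonreal zu).
have w0 := nonreal_neq0 (upper_nonreal wu).
have d0 := upper_subJ zu wu.
rewrite rmorphD rmorphN /= -poly_evalJ.
have -> : - poly_eval Q z^-1 + rho z - (- poly_eval Q (cj w^-1) + cj (rho w)) =
  - (poly_eval Q z^-1 - poly_eval Q (cj w^-1)) + (rho z - cj (rho w)) by ring.
rewrite mulrDl; congr (_ + _).
rewrite (@horner_sub _ _ K); last by rewrite size_map_poly.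
set S := \sum_(a < K) _.
have -> : \sum_(a < K) \sum_(b < K) (Q`_(a + b).+1)%:C * z^-1 ^+ a.+1 * (cj w^-1) ^+ b.+1
   = z^-1 * cj w^-1 * S.
  rewrite mulr_sumr; apply: eq_bigr => a _; rewrite mulr_sumr; apply: eq_bigr => b _.
  by rewrite coef_map !exprS /=; ring.
rewrite fmorphV /=.
have c0 : cj w != 0 by rewrite conjc_eq0.
by field; rewrite z0 c0 d0.
Qed.

(** At the points z_i = i y (i + 1), i < n, the kernel of f is close to
    \sum_(a, b) s_(a + b) z ^ (- a - 1) w^* ^ (- b - 1). With weights that
    invert the Vandermonde matrix of the numbers 1 / z_i, the Gram matrix of f
    tends to C S C^*, where S is the Hankel matrix and C exhibits m negative
    squares of S. The weights grow like y ^ n, so that the remainder, which is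
    o(y ^ (- K - 1)) in the kernel, disappears if 2 n <= K + 1. *)
Lemma has_negs_hankel s K f n m : (0 < n)%N -> (n.*2 <= K.+1)%N ->
  expands s K f -> has_neg (hankelC s n) m -> has_negs f m.
Proof.
move=> n0 nK [ffin fexp] hn.
have herm : adj (hankelC s n) = hankelC s n.
  by apply/matrixP => i j; rewrite !mxE conjc_real addnC.
have [Cm CmE] := has_neg_exact herm hn.
have nK' : (n <= K)%N by rewrite -ltnS (leq_trans _ nK) // -addnn -[n.+1]addn1 leq_add2l.
pose Q := 'X * spoly s K.
have sQ : (size Q <= K.+1)%N.
  rewrite /Q mulrC; apply: (leq_trans (size_polyMleq _ _)).
  by rewrite size_polyX addn2 /= ltnS size_poly.
have QE a b : Q`_(a + b).+1 = if (a + b < K)%N then s (a + b)%N else 0.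
  by rewrite /Q mulrC coefMX /= coef_poly.
pose x (i : 'I_n) : C := axis_inv i.+1%:R.
have x0 i : x i != 0 by rewrite invr_eq0 axis_neq0 // ltr0n.
have Vu : (\matrix_(i, a) x i ^+ a : 'M[C]_n) \in unitmx.
  have -> : (\matrix_(i, a) x i ^+ a : 'M[C]_n) = (Vandermonde n (\row_i x i))^T.
    by apply/matrixP => i a; rewrite !mxE.
  rewrite unitmx_tr unitmxE det_Vandermonde unitfE.
  apply/prodf_neq0 => i _; apply/prodf_neq0 => j ij; rewrite !mxE.
  rewrite subr_eq0 (inj_eq invr_inj) eq_complex /= eqxx /= eqr_nat eqSS.
  by rewrite eq_sym neq_ltn ij.
pose W := invmx (\matrix_(i, a) x i ^+ a : 'M[C]_n).
have WV (p q : 'I_n) : \sum_i W p i * x i ^+ q = (p == q)%:R.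
  have /matrixP /(_ p q) := mulVmx Vu; rewrite !mxE => <-.
  by apply: eq_bigr => a _; rewrite !mxE.
pose z (y : R) (i : 'I_n) := axis (y * i.+1%:R).
have ip (i : 'I_n) : (0 : R) < i.+1%:R by rewrite ltr0n.
have zu y i : 0 < y -> upper (z y i) by move=> y0; rewrite /upper /= mulr_gt0.
have zV y i : (z y i)^-1 = x i * (y^-1)%:C by exact: axis_invD.
(* The coefficients at the points z y i; their moments M y k a tend to the
   entries of C for a < n, and to 0 for a >= n. *)
pose F y (k : 'I_m) (i : 'I_n) : C :=
  \sum_(p < n) Cm k p * W p i * (x i)^-1 * y%:C ^+ p.+1.
pose rho (w : C) : C := fin_part (f w) + poly_eval Q w^-1.
pose M y k a := \sum_i F y k i * (z y i)^-1 ^+ a.+1.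
pose Minf k a : C := if insub a is Some i then Cm k i else 0.
have cjX (y : R) j : cj (y%:C ^+ j) = y%:C ^+ j.
  by rewrite rmorphXn; congr (_ ^+ _); exact: conjc_real.
have yV (y : R) : 0 < y -> y%:C * (y^-1)%:C = 1.
  by move=> y0; rewrite -rmorphM mulfV ?gt_eqF.
have ME k a y : 0 < y -> M y k a = \sum_(p < n)
    Cm k p * (y%:C ^+ p.+1 * (y^-1)%:C ^+ a.+1) * \sum_i W p i * x i ^+ a.
  move=> y0; rewrite /M /F; under eq_bigr do rewrite mulr_suml.
  rewrite exchange_big; apply: eq_bigr => p _ /=.
  rewrite mulr_sumr; apply: eq_bigr => i _.
  rewrite zV exprMn [x i ^+ a.+1]exprS; have := x0 i; set xx := x i => xx0.
  by field.
have Mlim k a : cvgc +oo (fun y => M y k a) (Minf k a).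
  rewrite /Minf; case: insubP => [i _ <-|an].
    apply: (cvgc_eq _ (cvgc_cst _)); apply: filterS (@near_pos R) => y y0.
    rewrite (ME _ _ y y0) (bigD1 i) //= [X in _ + X]big1 ?addr0 => [|p pi].
      by rewrite WV eqxx -exprMn yV // expr1n !mulr1.
    by rewrite WV (negPf pi) mulr0.
  rewrite -leqNgt in an.
  have h : cvgc +oo (fun y => \sum_(p < n)
      Cm k p * (y^-1)%:C ^+ (a - p) * \sum_i W p i * x i ^+ a)
      (\sum_(p < n) Cm k p * 0 ^+ (a - p) * \sum_i W p i * x i ^+ a).
    apply: cvg_sumc => p.
    exact: cvgcM (cvgcM (cvgc_cst _) (cvgcX (@cvg_invy R))) (cvgc_cst _).
  rewrite [X in cvgc _ _ X]big1 in h; last first.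
    move=> p _; have pa : (p < a)%N by rewrite (leq_trans (ltn_ord p)).
    by rewrite -(subnSK pa) exprS mul0r mulr0 mul0r.
  apply: (cvgc_eq _ h); apply: filterS (@near_pos R) => y y0.
  rewrite (ME _ _ y y0); apply: eq_bigr => p _; congr (_ * _ * _).
  have pa : (p <= a)%N by rewrite ltnW // (leq_trans (ltn_ord p)).
  have -> : (y^-1)%:C ^+ a.+1 = (y^-1)%:C ^+ (a - p) * (y^-1)%:C ^+ p.+1.
    by rewrite -exprD addnS subnK.
  by rewrite mulrCA -exprMn yV // expr1n mulr1.
have rhol i : cvgc +oo (fun y => rho (z y i) * y%:C ^+ K) 0.
  have h : cvgc +oo (fun y => rho (z y i) * axis (y * i.+1%:R) ^+ K *
      (axis i.+1%:R ^+ K)^-1) (0 * (axis i.+1%:R ^+ K)^-1).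
    exact: cvgcM (cvgc_dilate (ip i) fexp) (cvgc_cst _).
  rewrite mul0r in h; apply: (cvgc_eq _ h); apply: nearW => y.
  rewrite -mulrA; congr (_ * _).
  have -> : axis (y * i.+1%:R) = y%:C * axis i.+1%:R.
    by rewrite !axisE rmorphM /=; ring.
  by rewrite exprMn mulfK // expf_neq0 // axis_neq0.
pose E y i j := (rho (z y i) - cj (rho (z y j))) / (z y i - cj (z y j)).
pose ci (i j : 'I_n) : C := (axis i.+1%:R - cj (axis j.+1%:R))^-1.
have Elim i j : cvgc +oo (fun y => y%:C ^+ n.*2 * E y i j) 0.
  have h : cvgc +oo (fun y => (rho (z y i) * y%:C ^+ K -
      cj (rho (z y j) * y%:C ^+ K)) * ((y^-1)%:C ^+ (K.+1 - n.*2) * ci i j))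
      ((0 - cj 0) * (0 ^+ (K.+1 - n.*2) * ci i j)).
    exact: cvgcM (cvgcB (rhol i) (cvg_conjc (rhol j)))
      (cvgcM (cvgcX (@cvg_invy R)) (cvgc_cst _)).
  have c0 : 0 - cj 0 = 0 :> C by rewrite conjc0 subrr.
  rewrite c0 mul0r in h; apply: (cvgc_eq _ h).
  apply: filterS (@near_pos R) => y y0; rewrite /E.
  have yn : y%:C != 0 by rewrite (fmorph_eq0 (real_complex R)) gt_eqF.
  have -> : z y i - cj (z y j) = y%:C * (axis i.+1%:R - cj (axis j.+1%:R)).
    by apply/eqP; rewrite eq_complex /=; apply/andP; split; apply/eqP; ring.
  rewrite conjcM cjX -mulrBl /ci invfM.
  have e : y%:C ^+ K * (y^-1)%:C ^+ (K.+1 - n.*2) = y%:C ^+ n.*2 * (y%:C)^-1.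
    apply: (mulfI (expf_neq0 (K.+1 - n.*2) yn)).
    rewrite mulrCA -exprMn yV // expr1n mulr1 mulrA -exprD subnK //.
    by rewrite exprS mulrAC mulfV // mul1r.
  rewrite -[LHS]mulrA [_ ^+ K * _]mulrA e; ring.
pose Fs y k i := \sum_(p < n) Cm k p * W p i * (x i)^-1 * (y^-1)%:C ^+ (n - p.+1).
pose Finf k i := \sum_(p < n) Cm k p * W p i * (x i)^-1 * 0 ^+ (n - p.+1).
have Flim k i : cvgc +oo (fun y => Fs y k i) (Finf k i).
  apply: cvg_sumc => p.
  exact: cvgcM (cvgc_cst _) (cvgcX (@cvg_invy R)).
have FE y k i : 0 < y -> F y k i = Fs y k i * y%:C ^+ n.
  move=> y0; rewrite /Fs mulr_suml; apply: eq_bigr => p _.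
  rewrite -[RHS]mulrA; congr (_ * _).
  have -> : y%:C ^+ n = y%:C ^+ (n - p.+1) * y%:C ^+ p.+1.
    by rewrite -exprD subnK.
  by rewrite mulrA -exprMn [(y^-1)%:C * _]mulrC yV // expr1n mul1r.
rewrite -(card_ord m).
apply: (@has_negs_lim _ _ (+oo : set_system R) _ f _ _ z F).
  move=> i; apply: filterS2 (@near_pos R) (near_dilate (ip i) ffin) => y y0 fy.
  by split; [exact: zu|exact: fy].
move=> k l.
have gramE y : 0 < y -> gram (kernel f) (z y) (F y k) (F y l) =
    \sum_(a < K) \sum_(b < K) (Q`_(a + b).+1)%:C * M y k a * cj (M y l b) +
    \sum_i \sum_j Fs y k i * (y%:C ^+ n.*2 * E y i j) * cj (Fs y l j).
  move=> y0; rewrite /M -(sum_sep K (fun a b => (Q`_(a + b).+1)%:C)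
    (fun i a => (z y i)^-1 ^+ a.+1)) /gram -big_split; apply: eq_bigr => i _ /=.
  rewrite -big_split; apply: eq_bigr => j _ /=.
  rewrite (@kernel_expand Q K f _ _ rho (zu y i y0) (zu y j y0) sQ); last 2 first.
  - by rewrite /rho; ring.
  - by rewrite /rho; ring.
  rewrite mulrDr mulrDl; congr (_ + _).
    congr (_ * _ * _); apply: eq_bigr => a _; apply: eq_bigr => b _.
    by rewrite rmorphXn.
  rewrite !FE // conjcM cjX -addnn exprD /E; ring.
have lim1 : cvgc +oo (fun y => \sum_i \sum_j
    Fs y k i * (y%:C ^+ n.*2 * E y i j) * cj (Fs y l j)) 0.
  have h : cvgc +oo (fun y => \sum_i \sum_j
      Fs y k i * (y%:C ^+ n.*2 * E y i j) * cj (Fs y l j))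
      (\sum_i \sum_j Finf k i * 0 * cj (Finf l j)).
    apply: cvg_bigram => [i j|i|j]; [exact: Elim|exact: Flim|exact: Flim].
  rewrite [X in cvgc _ _ X]big1 in h; first exact: h.
  by move=> i _; rewrite big1 // => j _; rewrite mulr0 mul0r.
have lim2 : cvgc +oo (fun y => \sum_(a < K) \sum_(b < K)
    (Q`_(a + b).+1)%:C * M y k a * cj (M y l b))
    (\sum_(a < K) \sum_(b < K) (Q`_(a + b).+1)%:C * Minf k a * cj (Minf l b)).
  apply: cvg_sumc => a; apply: cvg_sumc => b.
  exact: cvgcM (cvgcM (cvgc_cst _) (Mlim k a)) (cvg_conjc (Mlim l b)).
have limE : \sum_(a < K) \sum_(b < K) (Q`_(a + b).+1)%:C * Minf k a * cj (Minf l b)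
    = - (k == l)%:R.
  have -> : - (k == l)%:R = (Cm *m hankelC s n *m adj Cm) k l.
    by rewrite CmE !mxE.
  pose G a b := (Q`_(a + b).+1)%:C * Minf k a * cj (Minf l b).
  have Mn j a : (n <= a)%N -> Minf j a = 0.
    by move=> na; rewrite /Minf insubN // -leqNgt.
  have MI j (a : 'I_n) : Minf j a = Cm j a by rewrite /Minf valK.
  transitivity (\sum_(a < n) \sum_(b < n) G a b).
    rewrite (big_ord_widen K (fun a => \sum_(b < n) G a b) nK') [RHS]big_mkcond.
    apply: eq_bigr => a _; case: ifP => [an|/negbT]; last first.
      rewrite -leqNgt => na; rewrite big1 // => b _.
      by rewrite (Mn k a) // mulr0 mul0r.
    rewrite (big_ord_widen K (fun b => G a b) nK') [RHS]big_mkcond.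
    apply: eq_bigr => b _; case: ifP => [bn|/negbT] //.
    by rewrite -leqNgt => nb; rewrite (Mn l b) // conjc0 mulr0.
  rewrite !mxE exchange_big; apply: eq_bigr => b _ /=.
  rewrite !mxE mulr_suml; apply: eq_bigr => a _; rewrite !mxE /G !MI QE.
  have -> : (a + b < K)%N.
    rewrite -ltnS (leq_trans _ nK) // -addnn -addnS -addSn leq_add //.
  by rewrite [Cm k a * _]mulrC.
have lim : cvgc +oo (fun y =>
    \sum_(a < K) \sum_(b < K) (Q`_(a + b).+1)%:C * M y k a * cj (M y l b) +
    \sum_i \sum_j Fs y k i * (y%:C ^+ n.*2 * E y i j) * cj (Fs y l j))
    (- (k == l)%:R).
  rewrite -limE -[X in cvgc _ _ X]addr0; exact: cvgcD lim2 lim1.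
apply: (cvgc_eq _ lim); apply: filterS (@near_pos R) => y y0.
by rewrite (gramE y y0).
Qed.

End HankelBound.

(** * From the imaginary axis to sectors *)

Section Nontangential.
Local Open Scope complex_scope.
Variable R : realType.
Local Notation C := R[i].
Local Notation cj := (@conjc R).
Local Notation sfun := (C -> option C).
Implicit Types (f g : sfun).

(** The norm of R[i] takes its values in R[i]; this is the real number behind
    it, on which order and field decision procedures apply. *)
Definition rn (z : C) : R := Num.sqrt (complex.Re z ^+ 2 + complex.Im z ^+ 2).

Lemma rnE z : `|z| = (rn z)%:C.
Proof. exact: normc_def. Qed.

Lemma rn_ge0 z : 0 <= rn z.
Proof. exact: sqrtr_ge0. Qed.

Lemma rnM z w : rn (z * w) = rn z * rn w.
Proof. by apply: (complexI (R := R)); rewrite -[LHS]rnE normrM !rnE rmorphM. Qed.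

Lemma rnV z : rn z^-1 = (rn z)^-1.
Proof. by apply: (complexI (R := R)); rewrite -[LHS]rnE normfV rnE fmorphV. Qed.

Lemma rnD z w : rn (z + w) <= rn z + rn w.
Proof. by rewrite -lecR rmorphD /= -!rnE ler_normD. Qed.

Lemma rnN z : rn (- z) = rn z.
Proof. by apply: (complexI (R := R)); rewrite -!rnE normrN. Qed.

Lemma rnJ z : rn (cj z) = rn z.
Proof. by apply: (complexI (R := R)); rewrite -!rnE normcJ. Qed.

Lemma rn_eq0 z : (rn z == 0) = (z == 0).
Proof.
by rewrite -(inj_eq (@complexI R)) -rnE normr_eq0.
Qed.

Lemma rn_real (x : R) : rn x%:C = `|x|.
Proof. by rewrite /rn /= expr0n addr0 sqrtr_sqr. Qed.

Lemma rn_nat n : rn n%:R = n%:R.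
Proof. by rewrite -(rmorph_nat (real_complex R)) rn_real ger0_norm. Qed.

Lemma rn_axis (y : R) : 0 <= y -> rn (axis y) = y.
Proof. by move=> y0; rewrite /rn /= expr0n add0r sqrtr_sqr ger0_norm. Qed.

Lemma rnB z w : rn z - rn w <= rn (z - w).
Proof. by rewrite lerBlDr -{1}[z](subrK w) rnD. Qed.

Lemma rnC z w : rn (z - w) = rn (w - z).
Proof. by rewrite -rnN opprB. Qed.

Lemma rn_sum (I : finType) (F : I -> C) : rn (\sum_i F i) <= \sum_i rn (F i).
Proof.
elim/big_ind2: _ => [|x a y b xa yb|//]; first by rewrite (eqP (_ : rn 0 == 0)) ?rn_eq0.
by apply: le_trans (rnD _ _) _; exact: lerD.
Qed.

Lemma le_rnE z (e : R) : (`|z| <= e%:C) = (rn z <= e).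
Proof. by rewrite rnE lecR. Qed.

(** A sector is described by Im z >= c |z|. *)
Definition large_far f (c d : R) := forall M : R, exists z w : C,
  [/\ f z = Some w, d < rn w, c * rn z <= complex.Im z & M < rn z].

(** Let |f(z)| > d at a far point z of the sector, r = |z|, and let f(i r) be
    small. The mixed entry k of the kernel at z and i r is at least of order
    |f(z)| / r, while the entry at z is at most |f(z)| / (c r) and the entry at
    i r is o(1 / r). So the two points carry a negative square, and they are
    too far from a given finite family to disturb its negative squares. *)
Lemma has_negs_far f c d m : 0 < c -> 0 < d -> axis_lim f 0 ->
  large_far f c d -> has_negs f m -> has_negs f m.+1.
Proof.
move=> c0 d0 [ff fl] far /has_negs_exact[T [z1 [B1 [zf BE]]]].
(* The tolerance for m + 1 negative squares. The new vector has the coefficient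
   a at z and beta at i r, where beta ^ 2 = Q r and 2 a beta k = - 1. Its
   diagonal terms are at most 4 / (Q c d) at z and eta Q at i r; the constants
   Q and eta make both at most tau / 2. *)
pose tau : R := (2 * m.+2)%:R^-1.
have tau0 : 0 < tau by rewrite invr_gt0 ltr0n.
pose Q := 8 / (c * d * tau).
have cdt0 : 0 < c * d * tau by rewrite !mulr_gt0.
have Q0 : 0 < Q by rewrite divr_gt0.
have Q8 : Q * (c * d * tau) = 8 by rewrite divfK // gt_eqF.
move: Q Q0 Q8 => Q Q0 Q8.
have Q2 : 0 < 2 * Q by rewrite mulr_gt0.
pose eta := Num.min (d / 2) (tau / (2 * Q)).
have eta0 : 0 < eta by rewrite lt_min !divr_gt0 // mulr_gt0.
pose v x := rn (fin_part (f (z1 x))).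
pose cst k := \sum_x rn (B1 k x) * (4 * (v x / d + 1) + 2 * (v x + eta) * Q).
have far_r : \forall r \near +oo, [/\ 0 < r, f (axis r) != None,
    rn (fin_part (f (axis r))) <= eta, forall x, 2 * rn (z1 x) <= r &
    forall k, (cst k / tau) ^+ 2 <= Q * r].
  have n1 : \forall r \near +oo, rn (fin_part (f (axis r))) <= eta.
    apply: filterS (cvgc_le fl eta0) => r.
    by rewrite subr0 le_rnE.
  have n2 : \forall r \near +oo, forall x, 2 * rn (z1 x) <= r.
    apply: filter_forall => x; exact: nbhs_pinfty_ge (num_real _).
  have n3 : \forall r \near +oo, forall k, (cst k / tau) ^+ 2 <= Q * r.
    apply: filter_forall => k.
    have := nbhs_pinfty_ge (num_real (Q^-1 * (cst k / tau) ^+ 2)).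
    by apply: filterS => r; rewrite ler_pdivrMl.
  apply: filterS2 (filterI (@near_pos R) ff) (filterI n1 (filterI n2 n3)).
  by move=> r [r0 fr] [? [? ?]]; split.
have [M [_ HM]] := far_r.
have [z [w [fz dw cz Mz]]] := far M.
have [r rE] : exists r, rn z = r by exists (rn z).
rewrite rE in cz Mz.
have [r0 fr ve rx rQ] := HM _ Mz; move=> {HM far_r far Mz}.
pose u := fin_part (f (axis r)).
have fu : f (axis r) = Some u by rewrite /u; case: (f (axis r)) fr.
have w0 : 0 < rn w by apply: lt_trans dw.
have etad : eta <= d / 2 by rewrite ge_min lexx.
have etaQ : eta * Q <= tau / 2.
  have : eta <= tau / (2 * Q) by rewrite ge_min lexx orbT.
  by rewrite ler_pdivlMr // => h; lra.
have zu : upper z by apply: lt_le_trans cz; rewrite mulr_gt0.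
have iu : upper (axis r) by exact: r0.
have [beta beta2 beta0] : exists2 b : R, b ^+ 2 = Q * r & 0 < b.
  exists (Num.sqrt (Q * r)); last by rewrite sqrtr_gt0 mulr_gt0.
  by rewrite sqr_sqrtr // ltW // mulr_gt0.
have [k kK] : exists k, kernel f z (axis r) = k by exists (kernel f z (axis r)).
have kE : k = (w - cj u) / (z - cj (axis r)) by rewrite -kK /kernel fz.
have kden : rn (z - cj (axis r)) <= 2 * r.
  have := rnD z (- cj (axis r)); rewrite rnN rnJ (rn_axis (ltW r0)) rE => h; lra.
have kden0 : 0 < rn (z - cj (axis r)).
  by rewrite lt_neqAle rn_ge0 andbT eq_sym rn_eq0 upper_subJ.
have knum : rn w / 2 <= rn (w - cj u).
  have := rnB w (cj u); rewrite rnJ; move: ve etad dw; rewrite -/u; lra.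
have kge : rn w / (4 * r) <= rn k.
  rewrite kE rnM rnV ler_pdivlMr //.
  rewrite mulrAC ler_pdivrMr ?mulr_gt0 //.
  have : rn w * rn (z - cj (axis r)) <= rn w * (2 * r) by rewrite ler_wpM2l // ltW.
  nra.
have k0 : 0 < rn k by apply: lt_le_trans kge; rewrite divr_gt0 ?mulr_gt0.
have kn0 : k != 0 by rewrite -rn_eq0 gt_eqF.
pose a : C := - (2 * beta%:C * k)^-1.
have ra : rn a <= 2 * r / (beta * rn w).
  rewrite /a rnN rnV !rnM rn_real (ger0_norm (ltW beta0)) rn_nat.
  rewrite ler_pdivlMr ?mulr_gt0 // mulrC ler_pdivrMr ?mulr_gt0 //.
  have h : rn w <= rn k * (4 * r) by move: kge; rewrite ler_pdivrMr ?mulr_gt0.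
  have := ler_wpM2l (ltW beta0) h; lra.
have az : beta%:C != 0 by rewrite (fmorph_eq0 (real_complex R)) gt_eqF.
have ak : a * beta%:C * k = - 2^-1.
  by rewrite /a; field; rewrite az kn0 ?pnatr_eq0.
pose z2 (x : T + bool) : C :=
  match x with inl x => z1 x | inr b => if b then z else axis r end.
pose B2 (i : 'I_m + unit) (x : T + bool) : C :=
  match i, x with
  | inl i, inl x => B1 i x
  | inl _, inr _ => 0
  | inr _, inl _ => 0
  | inr _, inr b => if b then a else beta%:C
  end.
exists ('I_m + unit)%type, (T + bool)%type, z2, B2; split.
- by rewrite card_sum card_ord card_unit addn1.
- case=> [x|[]] /=; [exact: zf|by rewrite fz|by rewrite fu].
have ft (X : C) : rn X <= tau -> `|X| <= tolerance R m.+1.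
  rewrite -le_rnE /tolerance => /le_trans; apply.
  by rewrite fmorphV rmorph_nat.
have far_old x (p : C) : rn p = r -> r / 2 <= rn (z1 x - cj p).
  move=> pr; have := rnB (cj p) (z1 x); rewrite rnJ pr rnC => h.
  by have := rx x; move: (rn_ge0 (z1 x)); lra.
have cross x (p fp : C) : rn p = r -> f p = Some fp ->
    rn (kernel f (z1 x) p) <= (v x + rn fp) * (2 / r).
  move=> pr fpE; rewrite /kernel rnM rnV fpE /=.
  apply: ler_pM; rewrite ?rn_ge0 ?invr_ge0 ?rn_ge0 //.
    by apply: le_trans (rnD _ _) _; rewrite rnN rnJ.
  have h := far_old x p pr.
  have h0 : 0 < rn (z1 x - cj p) by apply: lt_le_trans h; rewrite divr_gt0.
  by rewrite -[2 / r]invrK invf_div lef_pV2 ?posrE ?divr_gt0.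
have rir : rn (axis r) = r by rewrite rn_axis // ltW.
have ue : rn u <= eta by [].
have v0 x : 0 <= v x by exact: rn_ge0.
have br : beta / r = Q / beta.
  by apply: (mulIf (lt0r_neq0 r0)); rewrite divfK ?gt_eqF // mulrAC -beta2 expr2 mulfK ?gt_eqF.
have cross1 x : rn (kernel f (z1 x) z) * rn a <= 4 * (v x / d + 1) / beta.
  apply: (@le_trans _ _ ((v x + rn w) * (2 / r) * (2 * r / (beta * rn w)))).
    by apply: ler_pM; rewrite ?rn_ge0 // cross.
  have -> : (v x + rn w) * (2 / r) * (2 * r / (beta * rn w)) =
      4 * (v x / rn w + 1) / beta.
    by field; rewrite !gt_eqF.
  rewrite ler_pM2r ?invr_gt0 // ler_pM2l // lerD2r ler_wpM2l //.
  by rewrite lef_pV2 ?posrE // ltW.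
have cross2 x : rn (kernel f (z1 x) (axis r)) * beta <= 2 * (v x + eta) * Q / beta.
  rewrite -[2 * _ * Q / beta]mulrA -br.
  apply: (@le_trans _ _ ((v x + rn u) * (2 / r) * beta)).
    by apply: ler_wpM2r; [exact: ltW|exact: cross].
  have -> : (v x + rn u) * (2 / r) * beta = 2 * (v x + rn u) * (beta / r) by ring.
  by apply: ler_wpM2r; [rewrite divr_ge0 ?ltW|rewrite ler_pM2l // lerD2l].
pose c2 (b : bool) : C := if b then a else beta%:C.
pose p2 (b : bool) : C := if b then z else axis r.
have old_new i : rn (bigram (kernel f) z1 (B1 i) p2 c2) <= tau.
  apply: (@le_trans _ _ (cst i / beta)).
    rewrite /bigram /cst mulr_suml; apply: le_trans (rn_sum _) _.
    apply: ler_sum => x _.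
    have -> : \sum_y B1 i x * kernel f (z1 x) (p2 y) * cj (c2 y) = B1 i x *
        (kernel f (z1 x) z * cj a + kernel f (z1 x) (axis r) * cj beta%:C).
      rewrite big_bool -[c2 true]/a -[c2 false]/(beta%:C).
      by rewrite -[p2 true]/z -[p2 false]/(axis r) mulrDr !mulrA.
    rewrite rnM -mulrA; apply: ler_wpM2l; first exact: rn_ge0.
    apply: le_trans (rnD _ _) _; rewrite mulrDl; apply: lerD.
      by rewrite rnM rnJ; exact: cross1.
    by rewrite rnM rnJ rn_real (ger0_norm (ltW beta0)); exact: cross2.
  rewrite ler_pdivrMr // -ler_pdivrMl // mulrC.
  by have := rQ i; rewrite -beta2; move: (cst i / tau) => q; nra.
have z0l (T1 T2 : finType) (zz b : T1 -> C) (ww cc : T2 -> C) :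
    (forall x, b x = 0) -> bigram (kernel f) zz b ww cc = 0.
  by move=> b0; apply: big1 => x _; apply: big1 => y _; rewrite b0 !mul0r.
have z0r (T1 T2 : finType) (zz b : T1 -> C) (ww cc : T2 -> C) :
    (forall x, cc x = 0) -> bigram (kernel f) zz b ww cc = 0.
  by move=> b0; apply: big1 => x _; apply: big1 => y _; rewrite b0 conjc0 mulr0.
have new_new : rn (bigram (kernel f) p2 c2 p2 c2 + 1) <= tau.
  have -> : bigram (kernel f) p2 c2 p2 c2 + 1 =
      a * kernel f z z * cj a + (beta ^+ 2)%:C * kernel f (axis r) (axis r).
    rewrite /bigram !big_bool -[c2 true]/a -[c2 false]/(beta%:C).
    rewrite -[p2 true]/z -[p2 false]/(axis r) conjc_real rmorphXn /= kK.
    have kC : kernel f (axis r) z = cj k by rewrite -kK kernelC.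
    rewrite kC.
    have ak' : cj a * beta%:C * cj k = - 2^-1.
      rewrite -[beta%:C]conjc_real -!conjcM ak rmorphN fmorphV.
      congr (- _^-1); exact: conjc_nat.
    have -> : a * kernel f z z * cj a + a * k * beta%:C +
        (beta%:C * cj k * cj a + beta%:C * kernel f (axis r) (axis r) * beta%:C) + 1 =
        a * kernel f z z * cj a + beta%:C ^+ 2 * kernel f (axis r) (axis r) +
        (a * beta%:C * k + cj a * beta%:C * cj k + 1) by ring.
    rewrite ak ak'; have -> : - 2^-1 - 2^-1 + 1 = 0 :> C by field.
    by rewrite addr0.
  apply: le_trans (rnD _ _) _.
  rewrite [rn (a * _ * _)]rnM [rn (a * _)]rnM rnJ [rn ((beta ^+ 2)%:C * _)]rnM rn_real.
  have t1 : rn a * rn (kernel f z z) * rn a <= tau / 2.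
    have kzz : rn (kernel f z z) <= rn w / (c * r).
      rewrite /kernel fz rnM rnV.
      have h1 : rn (w - cj w) <= 2 * rn w.
        by have := rnD w (- cj w); rewrite rnN rnJ; lra.
      have h2 : 2 * (c * r) <= rn (z - cj z).
        have -> : z - cj z = 2 * (0 +i* 1) * (complex.Im z)%:C.
          by rewrite subcJ; ring.
        rewrite !rnM rn_nat rn_real (_ : rn (0 +i* 1) = 1) ?mulr1; last first.
          by rewrite /rn /= expr0n expr1n add0r sqrtr1.
        rewrite ger0_norm ?(ltW zu) // ler_pM2l //.
      have cr : 0 < c * r by rewrite mulr_gt0.
      have h3 : 0 < rn (z - cj z) by apply: lt_le_trans h2; rewrite mulr_gt0.
      rewrite ler_pdivlMr // mulrAC ler_pdivrMr //.
      have := ler_wpM2l (ltW w0) h2; have := ler_wpM2r (ltW cr) h1; lra.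
    apply: (@le_trans _ _ (2 * r / (beta * rn w) * (rn w / (c * r)) *
        (2 * r / (beta * rn w)))).
      apply: ler_pM => //; rewrite ?mulr_ge0 ?rn_ge0 //.
      by apply: ler_pM; rewrite ?rn_ge0.
    have -> : 2 * r / (beta * rn w) * (rn w / (c * r)) * (2 * r / (beta * rn w))
        = 4 / (Q * c * rn w).
      have -> : Q = beta ^+ 2 / r by rewrite beta2 mulfK ?gt_eqF.
      by field; rewrite !gt_eqF.
    have Qcw : 0 < Q * c * rn w by rewrite !mulr_gt0.
    rewrite ler_pdivrMr //.
    have Qct : 0 < Q * c * tau by rewrite !mulr_gt0.
    have := ler_wpM2l (ltW Qct) (ltW dw); lra.
  have t2 : `|beta ^+ 2| * rn (kernel f (axis r) (axis r)) <= tau / 2.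
    rewrite beta2 ger0_norm ?mulr_ge0 ?(ltW Q0) ?(ltW r0) //.
    have -> : kernel f (axis r) (axis r) = (u - cj u) / (2 * (0 +i* 1) * r%:C).
      rewrite /kernel fu; congr (_ / _).
      by rewrite /axis subcJ /=; ring.
    rewrite rnM rnV !rnM rn_nat rn_real (_ : rn (0 +i* 1) = 1) ?mulr1; last first.
      by rewrite /rn /= expr0n expr1n add0r sqrtr1.
    rewrite (ger0_norm (ltW r0)).
    have h1 : rn (u - cj u) <= 2 * eta.
      by have := rnD u (- cj u); rewrite rnN rnJ; lra.
    have -> : Q * r * (rn (u - cj u) / (2 * r)) = Q * rn (u - cj u) / 2.
      by field; rewrite gt_eqF.
    rewrite ler_pM2r ?invr_gt0 //; apply: le_trans (ler_wpM2l (ltW Q0) h1) _.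
    have -> : Q * (2 * eta) = eta * Q * 2 by ring.
    by rewrite -ler_pdivlMr.
  by lra.
case=> [i|[]] [j|[]].
- rewrite gram_sum (z0l _ _ (z2 \o inr)) // (z0l _ _ (z2 \o inr)) //.
  rewrite (z0r _ _ (z2 \o inl) _ (z2 \o inr)) // !addr0.
  rewrite (_ : bigram _ _ _ _ _ = - (i == j)%:R); last exact: BE.
  by rewrite addNr normr0 invr_ge0 ler0n.
- rewrite gram_sum (z0l _ _ (z2 \o inr)) // (z0l _ _ (z2 \o inr)) //.
  rewrite (z0r _ _ (z2 \o inl) _ (z2 \o inl)) // !addr0 add0r.
  by apply: ft; exact: old_new.
- rewrite gram_sum (z0l _ _ (z2 \o inl)) // (z0l _ _ (z2 \o inl)) //.
  rewrite (z0r _ _ (z2 \o inr) _ (z2 \o inr)) // !addr0 add0r.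
  by apply: ft; rewrite bigramC rnJ; exact: old_new.
- rewrite gram_sum (z0l _ _ (z2 \o inl)) // (z0l _ _ (z2 \o inl)) //.
  rewrite (z0r _ _ (z2 \o inr) _ (z2 \o inl)) // !add0r.
  by apply: ft; exact: new_new.
Qed.

End Nontangential.

Section AxisToSector.
Local Open Scope complex_scope.
Variable R : realType.
Local Notation C := R[i].
Local Notation cj := (@conjc R).
Local Notation sfun := (C -> option C).
Implicit Types (f g : sfun).

(** Otherwise there are far points in a sector where |f| exceeds a fixed
    number, and [has_negs_far] produces one negative square after the other. If
    such a point is a pole, |f| is large at the points slightly above it. *)
Lemma bounded_nontangential f b : meromorphic f -> bounded_index f b ->
  axis_lim f 0 -> nontangential_o1 f.
Proof.
move=> fm fb fl e e0 d d0; apply: contrapT => nM.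
have pi0 : pi / 2 < pi :> R by rewrite ltr_pdivrMr // ltr_pMr ?pi_gt0 // ltr1n.
have far : large_far f (sin e) (d / 2) /\ 0 < sin e.
  have ex (M : R) : exists r t, [/\ M < r, e < t < pi - e &
      ~ exists2 w : C, f ((r * cos t) +i* (r * sin t)) = Some w & `|w| <= d%:C].
    apply: contrapT => h; apply: nM; exists M => r t Mr et.
    by apply: contrapT => h'; apply: h; exists r, t.
  have epi : e < pi / 2.
    have [_ [t [_ /andP[et tp] _]]] := ex 0; lra.
  have se : 0 < sin e by apply: sin_gt0_pi; rewrite e0 /= (lt_trans epi).
  split=> // M.
  have [r [t [Mr /andP[et tp] bad]]] := ex (Num.max M 0).
  have r0 : 0 < r by apply: le_lt_trans Mr; rewrite le_max lexx orbT.
  have Mr' : M < r by apply: le_lt_trans Mr; rewrite le_max lexx.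
  have st : sin e <= sin t.
    have mono (x : R) : e <= x -> x <= pi / 2 -> sin e <= sin x.
      move=> ex' xp; rewrite leNgt ltr_sin; first by rewrite -leNgt.
        by rewrite in_itv /=; apply/andP; split; lra.
      by rewrite in_itv /=; apply/andP; split; lra.
    have [tl|tg] := leP t (pi / 2); first by apply: mono => //; exact: ltW.
    have -> : sin t = sin (pi - t) by rewrite addrC sinDpi sinN opprK.
    by apply: mono; lra.
  set z := (r * cos t) +i* (r * sin t) in bad.
  have rz : rn z = r.
    rewrite /rn /= !exprMn -mulrDr cos2Dsin2 mulr1 sqrtr_sqr ger0_norm // ltW //.
  have Iz : sin e * r <= complex.Im z by rewrite /= mulrC ler_pM2l.
  have zu : upper z by apply: lt_le_trans Iz; rewrite mulr_gt0.
  case fz: (f z) => [w|].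
    exists z, w; split; rewrite ?rz //.
    rewrite ltNge; apply/negP => wd; apply: bad; exists w => //.
    by rewrite le_rnE (le_trans wd) // ler_pdivrMr // ler_pMr // ler1n.
  have [/nbhs_singleton[]|[_ fn /holomorphic_atE fi]] := fm z (upper_nonreal zu).
    by rewrite fz.
  pose p w := fin_part (sphere_inv (f w)).
  have pz : (p : C -> C^o) @ (z : C^o) --> (0 : C^o).
    have [_ pd] := nbhs_singleton fi.
    by have := derivable_cvg pd; rewrite /= fz.
  have pz' : \forall w \near (z : C^o), `|p w - 0| <= (d^-1)%:C.
    by apply: (@cvgc_le _ _ _ _ p 0 d^-1 pz); rewrite invr_gt0.
  have big : \forall w \near (z : C^o)^', exists2 x, f w = Some x & d / 2 < rn x.
    apply: filterS3 fn (near_dnbhs pz') (near_dnbhs fi) => w.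
    rewrite /p subr0; case: (f w) => // x _ /=; case: eqP => [_ _ [] //|/eqP x0 /= xd _].
    exists x => //; move: xd; rewrite le_rnE rnV lef_pV2 ?posrE //; last first.
      by rewrite lt_neqAle rn_ge0 andbT eq_sym rn_eq0.
    by apply: lt_le_trans; rewrite ltr_pdivrMr // ltr_pMr // ltr1n.
  have pos : \forall s \near (0 : R)^'+, 0 < s by exact: nbhs_right_gt.
  have [s [s0 [x fx dx]]] := @filter_ex R (0 : R)^'+ _ _ (filterI pos (near_up big)).
  exists (z + 0 +i* s), x.
  have s1 : sin e <= 1 by exact: sin_le1.
  have up : rn (z + 0 +i* s) <= r + s.
    by apply: le_trans (rnD _ _) _; rewrite rz -/(axis s) rn_axis // ltW.
  have lo : r <= rn (z + 0 +i* s).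
    rewrite -rz /rn /= addr0 ler_wsqrtr // lerD2l.
    have : 0 < complex.Im z by []. rewrite /=. nra.
  split=> //.
    apply: (@le_trans _ _ (sin e * (r + s))); first by rewrite ler_pM2l.
    by move: Iz; rewrite /=; nra.
  exact: lt_le_trans lo.
have all m : has_negs f m.
  elim: m => [|m IH]; first exact: has_negs0.
  by apply: (has_negs_far far.2 _ fl far.1 IH); rewrite divr_gt0.
by have := fb _ (all b.+1); rewrite ltnn.
Qed.

Lemma nontangential_axis f : nontangential_o1 f -> axis_lim f 0.
Proof.
move=> h; have pi4 : 0 < pi / 4 :> R by rewrite divr_gt0 ?pi_gt0.
have ax (d : R) : 0 < d -> \forall y \near +oo,
    exists2 w, f (axis y) = Some w & `|w| <= d%:C.
  move=> d0; have [M HM] := h _ pi4 d d0.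
  have : \forall y \near +oo, M < y by exact: nbhs_pinfty_gt (num_real _).
  apply: filterS => y My; have := HM y (pi / 2) My.
  rewrite cos_pihalf sin_pihalf mulr0 mulr1; apply.
  by have := @pi_gt0 R; move=> p0; apply/andP; split; lra.
split; first by apply: filterS (ax 1 ltr01) => y [w ->].
apply/cvgrPdist_le => e' /posc_real[-> e0].
by apply: filterS (ax _ e0) => y [w -> wd]; rewrite sub0r normrN.
Qed.

End AxisToSector.

(** * Hankel determinants and the Schur recursion for truncated series *)

Section TruncatedSeries.
Variable K : fieldType.
Implicit Types (p q r S L M : {poly K}).

Lemma dvdXnP k p : reflect (forall i, (i < k)%N -> p`_i = 0) ('X^k %| p).
Proof.
apply: (iffP idP) => [/dvdpP[q ->] i ik|h]; first by rewrite coefMXn ik.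
rewrite -[p](poly_take_drop k) dvdp_addl ?dvdp_mulIr //.
suff -> : take_poly k p = 0 by rewrite dvdp0.
by apply/polyP => i; rewrite coef_take_poly coef0; case: ifP => // /h ->.
Qed.

Lemma dvdXn_small k p : 'X^k %| p -> (size p <= k)%N -> p = 0.
Proof.
move=> /dvdXnP h sp; apply/polyP => i; rewrite coef0.
have [/h//|ki] := ltnP i k; apply: nth_default; exact: leq_trans ki.
Qed.

Lemma dvdXn_mulr k p q : q`_0 != 0 -> 'X^k %| p * q -> 'X^k %| p.
Proof.
move=> q0; rewrite Gauss_dvdpl // coprimep_expl // coprimep_sym coprimepX.
by rewrite /root horner_coef0.
Qed.

Lemma dvdXnD k j p : ('X^(k + j) %| 'X^k * p) = ('X^j %| p).
Proof. by rewrite exprD dvdp_mul2l // -size_poly_eq0 size_polyXn. Qed.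

Lemma size_divXn k n p : (size ('X^k * p)%R <= k + n)%N -> (size p <= n)%N.
Proof.
have [->|p0] := eqVneq p 0; first by rewrite size_poly0.
by rewrite mulrC size_mulXn // leq_add2l.
Qed.

(** A solution of the Pade problem q S = p modulo 'X^(2 i - 1 + e) with q of
    degree less than i and p of degree less than i - 1 + e. *)
Definition pade e i S := exists q p, [/\ q != 0, (size q <= i)%N,
  (size p <= i.-1 + e)%N & 'X^(i.-1 + e + i) %| q * S - p].

Definition hank e (s : seq K) i : 'M[K]_i :=
  \matrix_(a < i, b < i) s`_(a + b + e).

(** The coefficients of q, in reversed order, form a vector in the kernel of
    the Hankel matrix: the equations say that the coefficients of q S vanish in
    the i degrees from i - 1 + e on. *)
Lemma hank_det0 e s i : (0 < i)%N -> \det (hank e s i) = 0 <-> pade e i (Poly s).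
Proof.
case: i => // i _.
have cf (q : {poly K}) (v : 'rV[K]_i.+1) k :
    (forall j, q`_j = if (j < i.+1)%N then v 0 (inord (i - j)) else 0) ->
    (q * Poly s)`_(i + e + k) = \sum_a v 0 a * s`_(a + k + e).
  move=> qv; rewrite coefM.
  rewrite (eq_bigr (fun j : 'I_(i + e + k).+1 => if (j < i.+1)%N then
    v 0 (inord (i - j)) * s`_(i + e + k - j) else 0)); last first.
    by move=> j _; rewrite qv coef_Poly; case: ifP; rewrite ?mul0r.
  have le : (i.+1 <= (i + e + k).+1)%N by rewrite ltnS -addnA leq_addr.
  rewrite -big_mkcond -(big_ord_widen _ (fun j =>
    v 0 (inord (i - j)) * s`_(i + e + k - j)) le).
  rewrite (reindex_inj rev_ord_inj); apply: eq_bigr => a _ /=.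
  rewrite subSS subKn ?inord_val; last by rewrite -ltnS.
  congr (_ * s`_ _); have : (a <= i)%N by rewrite -ltnS.
  by move: (nat_of_ord a) => b bi; rewrite -!addnA; lia.
split=> [/eqP/det0P[v v0 vA]|[q [p [q0 sq sp h]]]].
  pose q := \poly_(j < i.+1) v 0 (inord (i - j)).
  have qE j : q`_j = if (j < i.+1)%N then v 0 (inord (i - j)) else 0.
    by rewrite coef_poly.
  exists q, (take_poly (i + e) (q * Poly s)); split.
  - apply/eqP => q0; move/eqP: v0; apply; apply/rowP => a; rewrite mxE.
    have := qE (i - a)%N; rewrite q0 coef0 ltnS leq_subr subKn ?inord_val //.
    by rewrite -ltnS.
  - exact: size_poly.
  - exact: size_take_poly.
  apply/dvdXnP => j; rewrite coefB coef_take_poly.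
  case: ifP => [_ _|/negbT]; first by rewrite subrr.
  rewrite -leqNgt => ij jl; rewrite subr0.
  have jE : j = (i + e + (j - (i + e)))%N by rewrite subnKC.
  have ki : (j - (i + e) < i.+1)%N by rewrite ltn_subLR.
  rewrite jE (cf _ v) //; have /rowP /(_ (Ordinal ki)) := vA.
  rewrite mxE [RHS]mxE => vk; rewrite -[RHS]vk.
  by apply: eq_bigr => a _; rewrite !mxE.
apply/eqP/det0P; exists (\row_a q`_(i - a)).
  apply/eqP => /rowP v0; move/eqP: q0; apply; apply/polyP => j; rewrite coef0.
  have [ji|ij] := ltnP j i.+1; last by rewrite nth_default // (leq_trans sq).
  have := v0 (inord (i - j)); rewrite !mxE inordK ?ltnS ?leq_subr // subKn //.
apply/rowP => k; rewrite !mxE.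
have := dvdXnP _ _ h (i + e + k)%N; rewrite ltn_add2l => /(_ (ltn_ord k)).
rewrite coefB [p`_ _]nth_default ?subr0; last first.
  by rewrite (leq_trans sp) //= leq_addr.
rewrite (cf _ (\row_a q`_(i - a))) => [qk|j].
  by rewrite -[RHS]qk; apply: eq_bigr => a _; rewrite !mxE.
case: ltnP => [ji|ij]; last by rewrite nth_default // (leq_trans sq).
by rewrite mxE inordK ?ltnS ?leq_subr // subKn.
Qed.

(** S is the generating polynomial of the moments of f_0 and S1 that of f_1, in
    the variable u = 1 / z. With M the reversal of m, the last condition is the
    identity f_0 = 1 / (- z m + 1 / (l + f_1)) up to the order u ^ (2 n + 1),
    after f_0 = - u S, z m = M / u ^ nu and l + f_1 = L, and multiplication by
    the denominators. *)
Record schur_data nu n S M L S1 (l : K) : Prop := SchurData {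
  sd_nu : (0 < nu <= n)%N;
  sd_S : exists2 S' : {poly K}, S = 'X^(nu.-1) * S' & S'`_0 != 0;
  sd_M : M`_0 != 0;
  sd_sM : (size M <= nu)%N;
  sd_L : L = l%:P - 'X * S1;
  sd_l : l != 0;
  sd_main : 'X^(2 * n) %| S * (M * L - 'X^nu) - 'X^(nu.-1) * L }.

(** A rational approximation q S = p, i.e. f_0 close to - u p / q, turns by the
    linear fractional step into an approximation of f_1, and the degrees drop
    by nu. So the singular Hankel matrices of the next sequence are those of
    the given one, with shifted orders. *)
Lemma pade_step nu n S M L S1 l e i : schur_data nu n S M L S1 l ->
  (e <= 1)%N -> (0 < i)%N -> (nu + i <= n)%N ->
  pade e (nu + i) S <-> pade e i S1.
Proof.
move=> [/andP[nu0 nun] [S' SE S0] M0 sM LE l0 main] e1 i0 nin.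
have L0 : L`_0 != 0 by rewrite LE coefB coefC coefXM /= subr0.
pose k := ((nu + i).-1 + e + (nu + i))%N.
have k2n : (k <= 2 * n)%N by rewrite /k; lia.
have mainK : 'X^k %| S * (M * L - 'X^nu) - 'X^(nu.-1) * L.
  by apply: dvdp_trans main; rewrite dvdp_exp2l.
have kE : k = (nu.-1 + (nu + (2 * i + e)))%N by rewrite /k; lia.
split=> [[q [p [q0 sq sp h]]]|[r [p1 [r0 sr sp1 h]]]].
  have [p' pE] : exists p', p = 'X^(nu.-1) * p'.
    have : 'X^(nu.-1) %| p.
      have -> : p = q * S - (q * S - p) by ring.
      rewrite dvdp_sub //; first by rewrite SE mulrCA dvdp_mulIl.
      by apply: dvdp_trans h; rewrite dvdp_exp2l // -/k kE leq_addr.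
    by move=> /dvdpP[p' ->]; exists p'; rewrite mulrC.
  have sp' : (size p' <= i + e)%N.
    by apply: (@size_divXn nu.-1); rewrite -pE (leq_trans sp) //; move: nu0; clear; lia.
  have c1 : 'X^(nu + (2 * i + e)) %| (p' * M - q) * L - p' * 'X^nu.
    rewrite -(dvdXnD nu.-1) -kE.
    have -> : 'X^(nu.-1) * ((p' * M - q) * L - p' * 'X^nu) =
      q * (S * (M * L - 'X^nu) - 'X^(nu.-1) * L)
      - (q * S - p) * (M * L - 'X^nu) by rewrite pE; ring.
    by apply: dvdp_sub; [exact: dvdp_mull|exact: dvdp_mulr].
  have [r rE] : exists r, p' * M - q = 'X^nu * r.
    have : 'X^nu %| p' * M - q.
      apply: (dvdXn_mulr L0).
      have -> : (p' * M - q) * L = ((p' * M - q) * L - p' * 'X^nu) + p' * 'X^nu by ring.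
      rewrite dvdp_add ?dvdp_mulIr //.
      by apply: dvdp_trans c1; rewrite dvdp_exp2l // leq_addr.
    by move=> /dvdpP[r ->]; exists r; rewrite mulrC.
  have sr : (size r <= i)%N.
    apply: (@size_divXn nu); rewrite -rE.
    apply: (leq_trans (size_polyD _ _)); rewrite geq_max size_polyN sq andbT.
    apply: (leq_trans (size_polyMleq _ _)); move: sp' sM e1; clear; lia.
  have c2 : 'X^(2 * i + e) %| r * L - p'.
    rewrite -(dvdXnD nu); have -> : 'X^nu * (r * L - p') =
      (p' * M - q) * L - p' * 'X^nu by rewrite rE; ring.
    exact: c1.
  have [p1 p1E] : exists p1, l%:P * r - p' = 'X * p1.
    have : 'X^1 %| l%:P * r - p'.
      have -> : l%:P * r - p' = (r * L - p') + 'X^1 * (r * S1).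
        by rewrite LE expr1; ring.
      rewrite dvdp_add ?dvdp_mulIl //.
      by apply: dvdp_trans c2; rewrite dvdp_exp2l //; clear -i0; lia.
    by rewrite expr1 => /dvdpP[p1 ->]; exists p1; rewrite mulrC.
  exists r, p1; split=> //.
  - apply/eqP => r0; move/eqP: q0; apply.
    have p0 : p' = 0.
      apply: (@dvdXn_small (2 * i + e)); last by apply: leq_trans sp' _; clear; lia.
      by move: c2; rewrite r0 mul0r sub0r dvdpNr.
    by move: rE; rewrite p0 r0 mul0r mulr0 sub0r => /eqP; rewrite oppr_eq0 => /eqP.
  - apply: (@size_divXn 1); rewrite expr1 -p1E.
    apply: (leq_trans (size_polyD _ _)); rewrite geq_max size_polyN.
    apply/andP; split; last by apply: leq_trans sp' _; clear -i0; lia.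
    rewrite mul_polyC; apply: leq_trans (size_scale_leq _ _) _.
    by apply: leq_trans sr _; clear -i0; lia.
  have -> : (i.-1 + e + i)%N = (2 * i + e - 1)%N by clear -i0; lia.
  rewrite -(dvdXnD 1).
  have -> : (1 + (2 * i + e - 1))%N = (2 * i + e)%N by clear -i0; lia.
  have -> : 'X^1 * (r * S1 - p1) = - (r * L - p').
    by rewrite expr1 mulrBr -p1E LE; ring.
  by rewrite dvdpNr.
pose p' := l%:P * r - 'X * p1; pose q := p' * M - 'X^nu * r.
have sXp : (size ('X * p1)%R <= i + e)%N.
  have [->|pn] := eqVneq p1 0; first by rewrite mulr0 size_poly0.
  by rewrite mulrC size_mulX //; move: sp1 i0; clear; lia.
have sp' : (size p' <= i + e)%N.
  apply: (leq_trans (size_polyD _ _)); rewrite geq_max size_polyN sXp andbT.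
  by rewrite mul_polyC (leq_trans (size_scale_leq _ _)) //; move: sr; clear; lia.
have c2 : 'X^(2 * i + e) %| r * L - p'.
  have -> : r * L - p' = - ('X^1 * (r * S1 - p1)) by rewrite LE /p' expr1; ring.
  have -> : (2 * i + e)%N = (1 + (i.-1 + e + i))%N by clear -i0; lia.
  by rewrite dvdpNr dvdXnD.
exists q, ('X^(nu.-1) * p'); split.
- apply/eqP => q0; move/eqP: r0; apply.
  apply: (@dvdXn_small (2 * i + e)); last by apply: leq_trans sr _; clear; lia.
  apply: (@dvdXn_mulr _ _ (M * L - 'X^nu)).
    rewrite coefB coefM big_ord_recl big_ord0 addr0 /= coefXn.
    by rewrite (ltn_eqF nu0) subr0 mulf_neq0.
  have -> : r * (M * L - 'X^nu) = M * (r * L - p') + q by rewrite /q; ring.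
  by rewrite q0 addr0 dvdp_mull.
- apply: (leq_trans (size_polyD _ _)); rewrite geq_max size_polyN.
  apply/andP; split.
    apply: (leq_trans (size_polyMleq _ _)); move: sp' sM e1; clear; lia.
  by rewrite mulrC size_mulXn // leq_add2l.
- have [->|pn] := eqVneq p' 0; first by rewrite mulr0 size_poly0.
  have -> : ((nu + i).-1 + e)%N = (nu.-1 + (i + e))%N by clear -nu0; lia.
  by rewrite mulrC size_mulXn // leq_add2l.
apply: (dvdXn_mulr L0).
have -> : (q * S - 'X^(nu.-1) * p') * L =
  p' * (S * (M * L - 'X^nu) - 'X^(nu.-1) * L) - 'X^nu * S * (r * L - p').
  by rewrite /q; ring.
apply: dvdp_sub; first exact: dvdp_mull.
rewrite -/k kE SE.
have -> : 'X^nu * ('X^(nu.-1) * S') * (r * L - p') =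
  'X^(nu.-1) * ('X^nu * (S' * (r * L - p'))) by ring.
by rewrite !dvdXnD dvdp_mull.
Qed.

End TruncatedSeries.

Section SchurCoefficients.
Variable R : realType.
Implicit Types (s : seq R) (c t : nat -> R).

Lemma toeplitz_inv_sum c N k : c 0%N != 0 -> (k <= N)%N ->
  \sum_(i < k.+1) toeplitz_inv c N i * c (k - i)%N = (k == 0%N)%:R.
Proof.
move=> c0 kN; have Tu : toeplitz c N \in unitmx.
  rewrite -unitmx_tr unitmxE det_trig.
    rewrite unitfE; apply/prodf_neq0 => i _.
    by rewrite !mxE leqnn subnn.
  by apply/is_trig_mxP => i j ij; rewrite !mxE leqNgt ij.
have /matrixP /(_ ord0 (inord k)) := mulVmx Tu.
rewrite !mxE -val_eqE /= inordK // eq_sym => <-.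
rewrite (big_ord_widen N.+1 (fun i => toeplitz_inv c N i * c (k - i)%N)) //.
rewrite big_mkcond; apply: eq_bigr => i _.
rewrite !mxE inordK // ltnS /toeplitz_inv inord_val.
by case: ifP => _ //; rewrite mulr0.
Qed.

(** An upper triangular Toeplitz matrix is a power series truncated modulo
    'X^(N + 1). *)
Lemma toeplitz_inv_poly c N : c 0%N != 0 ->
  'X^(N.+1) %| (\poly_(i < N.+1) toeplitz_inv c N i) * (\poly_(i < N.+1) c i) - 1.
Proof.
move=> c0; apply/dvdXnP => k kN; rewrite coefB coefM coef1.
apply/eqP; rewrite subr_eq0 -(@toeplitz_inv_sum c N) //; apply/eqP.
apply: eq_bigr => i _; rewrite !coef_poly.
have -> : (i < N.+1)%N by apply: leq_ltn_trans kN; rewrite -ltnS.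
have -> : (k - i < N.+1)%N by apply: leq_ltn_trans kN; rewrite leq_subr.
by [].
Qed.

Definition last_row_mx s nu t : 'M[R]_nu :=
  \matrix_(i, p) if (i.+1 < nu)%N then s`_(i.+1 + p) else t p.

Definition hminor s nu p :=
  \det (row' ord0 (col' (inord p : 'I_nu.+1) (hankel s nu.+1))).

Lemma schur_DeltaE s nu : schur_Delta s nu.+1 =
  \poly_(p < nu.+1) ((-1) ^+ (nu + p) * hminor s nu p).
Proof.
rewrite poly_def /schur_Delta (expand_det_row _ ord_max).
apply/polyP => k; rewrite !coef_sum; apply: eq_bigr => p _; congr (_`_k).
have -> : cofactor (\matrix_(i, p) (if (i.+1 < nu.+1)%N
    then (s`_(i.+1 + p))%:P else 'X^p)) ord_max p =
    ((-1) ^+ (nu + p) * hminor s nu p)%:P.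
  rewrite /cofactor polyCM rmorphXn /= polyCN /hminor -det_map_mx inord_val.
  congr (_ * \det _).
  apply/matrixP => i j; rewrite !mxE lift_max.
  have i1 : (i.+1 < nu.+1)%N by rewrite ltnS ltn_ord.
  by rewrite i1 lift0.
by rewrite mxE ltnn mulrC mul_polyC.
Qed.

Lemma schur_m_coef s nu p : (p < nu.+1)%N -> (schur_m s nu.+1)`_p =
    (-1) ^+ nu.+2 / \det (hankel s nu.+1) * ((-1) ^+ (nu + p) * hminor s nu p).
Proof. by move=> pn; rewrite /schur_m coefZ schur_DeltaE coef_poly pn. Qed.

Lemma cofactor_last_row s nu t (p : 'I_nu.+1) :
  cofactor (last_row_mx s nu.+1 t) ord_max p = (-1) ^+ (nu + p) * hminor s nu p.
Proof.
rewrite /cofactor /hminor inord_val; congr (_ * \det _); apply/matrixP => i j.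
rewrite !mxE lift_max.
have i1 : (i.+1 < nu.+1)%N by rewrite ltnS ltn_ord.
by rewrite i1 lift0.
Qed.

(** The determinant Delta_j is linear in its last row, so pairing its
    coefficients with t amounts to replacing that row by t. *)
Lemma schur_m_pair s nu t :
  \sum_(p < nu.+1) (schur_m s nu.+1)`_p * t p =
  (-1) ^+ nu.+2 / \det (hankel s nu.+1) * \det (last_row_mx s nu.+1 t).
Proof.
rewrite (expand_det_row (last_row_mx _ _ _) ord_max) mulr_sumr.
apply: eq_bigr => p _.
rewrite schur_m_coef // mxE ltnn cofactor_last_row; ring.
Qed.

Lemma det_last_row_shift s nu k : (0 < k < nu.+1)%N ->
  \det (last_row_mx s nu.+1 (fun p => s`_(k + p))) = 0.
Proof.
case: k => // k /andP[_ kn].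
have kl : Ordinal (ltnW kn : (k < nu.+1)%N) != ord_max.
  by rewrite -val_eqE /= ltn_eqF.
apply: (determinant_alternate kl) => p; rewrite !mxE /= ltnn.
by rewrite kn.
Qed.

Lemma det_last_row0 s nu :
  \det (last_row_mx s nu.+1 (fun p => s`_p)) = (-1) ^+ nu * \det (hankel s nu.+1).
Proof.
rewrite (expand_det_row (last_row_mx _ _ _) ord_max).
rewrite (expand_det_row (hankel _ _) ord0) mulr_sumr.
apply: eq_bigr => p _; rewrite cofactor_last_row !mxE ltnn add0n.
rewrite /cofactor /hminor inord_val exprD add0n; ring.
Qed.

Lemma det_last_row_plus s nu :
  \det (last_row_mx s nu.+1 (fun p => s`_(nu.+1 + p))) =
  \det (hankel_plus s nu.+1).
Proof.
congr (\det _); apply/matrixP => i p; rewrite !mxE -[(i + p).+1]addSn.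
case: ltnP => //; rewrite ltnS => ni.
by have -> : (i : nat) = nu by apply/eqP; rewrite eqn_leq ni -ltnS ltn_ord.
Qed.

Record step_ok s nu n : Prop := StepOk {
  so_size : size s = (2 * n)%N;
  so_nu : (nu < n)%N;
  so_zero : forall i, (i < nu)%N -> s`_i = 0;
  so_lead : s`_nu != 0;
  so_det : \det (hankel s nu.+1) != 0;
  so_detp : \det (hankel_plus s nu.+1) != 0 }.

(** With u = 1 / z one has z m(z) = M(u) / u ^ (nu + 1). *)
Definition mrev s nu : {poly R} := \poly_(i < nu.+1) (schur_m s nu.+1)`_(nu - i).

(** The truncated expansion of l + f_1 in the powers of u. *)
Definition lpoly s nu : {poly R} :=
  (schur_l s nu.+1)%:P - 'X * Poly (schur_next s nu.+1).

Section OneStep.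
Variables (s : seq R) (nu n : nat).
Hypothesis ok : step_ok s nu n.

Let c p := s`_(nu + p).
Let fr := nth 0 (schur_frak s nu.+1).

(** For 0 < k the replaced last row repeats an earlier one, and for k = 0 it
    turns the determinant into that of the Hankel matrix, up to a permutation
    of the rows. *)
Lemma sum_schur_m k : (k < nu.+1)%N ->
  \sum_(p < nu.+1) (schur_m s nu.+1)`_p * s`_(k + p) = (k == 0%N)%:R.
Proof.
move=> kn; rewrite (schur_m_pair s nu (fun p => s`_(k + p))).
case: k kn => [|k] kn; last by rewrite det_last_row_shift ?mulr0.
rewrite det_last_row0 mulrACA mulVf ?(so_det ok) // mulr1.
by rewrite !exprS !mulN1r opprK -expr2 sqrr_sign.
Qed.

Lemma sum_schur_m_next :
  \sum_(p < nu.+1) (schur_m s nu.+1)`_p * s`_(nu.+1 + p) =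
  (-1) ^+ nu.+2 * \det (hankel_plus s nu.+1) / \det (hankel s nu.+1).
Proof.
rewrite (schur_m_pair s nu (fun p => s`_(nu.+1 + p))) det_last_row_plus.
by rewrite mulrAC.
Qed.

Lemma schur_m_lead : (schur_m s nu.+1)`_nu * s`_nu = 1.
Proof.
have h : _ = 1 := sum_schur_m (ltn0Sn nu); rewrite -[RHS]h big_ord_recr /=.
rewrite big1 ?add0r // => p _; rewrite add0n (so_zero ok) ?mulr0 //=.
Qed.

Lemma schur_m_size : size (schur_m s nu.+1) = nu.+1.
Proof.
apply/eqP; rewrite eqn_leq; apply/andP; split; last first.
  rewrite ltnNge; apply/negP => h; have := schur_m_lead.
  by rewrite nth_default // mul0r => /eqP; rewrite eq_sym oner_eq0.
apply: (leq_trans (size_scale_leq _ _)).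
by rewrite schur_DeltaE size_poly.
Qed.

Let N := (2 * n - nu.+1)%N.

Lemma c0_neq0 : c 0 != 0.
Proof. by rewrite /c addn0 (so_lead ok). Qed.

Let C' : {poly R} := \poly_(i < N.+1) c i.

Lemma nu_lt2n : (nu + N.+1 = 2 * n)%N.
Proof. by rewrite /N; have := so_nu ok; clear; lia. Qed.

Lemma Poly_sE : Poly s = 'X^nu * C'.
Proof.
apply/polyP => i; rewrite coef_Poly mulrC coefMXn coef_poly.
case: ltnP => [/(so_zero ok)//|ni].
case: ltnP => [_|h]; first by rewrite /c subnKC.
rewrite nth_default // (so_size ok) -nu_lt2n -(subnKC ni) leq_add2l //.
Qed.

Lemma C'0 : C'`_0 = s`_nu.
Proof. by rewrite coef_poly /c addn0. Qed.

Let A : {poly R} := \poly_(i < N.+1) toeplitz_inv c N i.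

Lemma AC_dvd : 'X^(N.+1) %| A * C' - 1.
Proof. exact: toeplitz_inv_poly c0_neq0. Qed.

Let M := mrev s nu.

Lemma MC_coef k : (k < nu.+1)%N -> (M * C')`_k = (k == 0%N)%:R.
Proof.
move=> kn; rewrite -(sum_schur_m kn) coefM.
have nN : (nu < N.+1)%N by rewrite /N; have := so_nu ok; clear; lia.
rewrite (eq_bigr (fun i : 'I_k.+1 => (schur_m s nu.+1)`_(nu - i) * s`_(k + (nu - i)))).
  rewrite [RHS](reindex_inj rev_ord_inj) /=.
  have le : (k.+1 <= nu.+1)%N by [].
  rewrite (big_ord_widen _ (fun i => (schur_m s nu.+1)`_(nu - i) * s`_(k + (nu - i))) le).
  rewrite big_mkcond; apply: eq_bigr => i _; rewrite subSS; case: ifP => // /negbT.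
  rewrite -leqNgt => ki; rewrite (so_zero ok) ?mulr0 //.
  by have := ltn_ord i; move: ki; clear; move: (nat_of_ord i) => j; lia.
move=> i _; have ik : (i <= k)%N by rewrite -ltnS.
rewrite !coef_poly (leq_ltn_trans ik kn) (leq_ltn_trans (leq_subr _ _) (leq_trans kn nN)).
congr (_ * s`_ _); move: kn ik; clear; move: (nat_of_ord i) => j; lia.
Qed.

Lemma MC_dvd : 'X^(nu.+1) %| M * C' - 1.
Proof.
by apply/dvdXnP => k kn; rewrite coefB MC_coef // coef1 subrr.
Qed.

(** Both are inverses of the series C', one modulo 'X^(N + 1) and the other
    modulo 'X^(nu + 1): the beginning of the inverse series consists of the
    coefficients of m. *)
Lemma AM_coef k : (k < nu.+1)%N -> A`_k = M`_k.
Proof.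
have C0 : C'`_0 != 0 by rewrite C'0 (so_lead ok).
have : 'X^(nu.+1) %| A - M.
  apply: (dvdXn_mulr C0); have -> : (A - M) * C' = (A * C' - 1) - (M * C' - 1) by ring.
  apply: dvdp_sub MC_dvd; apply: dvdp_trans AC_dvd; rewrite dvdp_exp2l //.
  by rewrite /N; have := so_nu ok; clear; lia.
by move=> /dvdXnP h /h /eqP; rewrite coefB subr_eq0 => /eqP.
Qed.

Let Fr := Poly (schur_frak s nu.+1).
Let N2 := (2 * n - 2 * nu.+1)%N.

Lemma fr_coef i : Fr`_i = if (i < N2.+1)%N then - A`_(nu.+1 + i) else 0.
Proof.
rewrite coef_Poly /schur_frak (so_size ok) -/N2.
case: ltnP => iN; last by rewrite nth_default ?size_mkseq.
rewrite nth_mkseq // coef_poly -/N.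
suff -> : (nu.+1 + i < N.+1)%N by [].
by move: iN; rewrite /N /N2; have := so_nu ok; clear; lia.
Qed.

Lemma A_split : A = M - 'X^(nu.+1) * Fr.
Proof.
apply/polyP => i; rewrite coefB [_ * Fr]mulrC coefMXn.
case: ltnP => ni; first by rewrite subr0 AM_coef.
rewrite fr_coef subnKC // [M`_i]coef_poly ltnNge ni /= sub0r.
case: ltnP => [_|h]; first by rewrite opprK.
rewrite oppr0 coef_poly ltnNge; case: ltnP => // h'.
by exfalso; move: h h' ni; rewrite /N /N2; have := so_nu ok; clear; lia.
Qed.

Lemma AS_dvd : 'X^(2 * n) %| A * Poly s - 'X^nu.
Proof.
rewrite Poly_sE -nu_lt2n; have -> : A * ('X^nu * C') - 'X^nu = 'X^nu * (A * C' - 1) by ring.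
by rewrite dvdXnD AC_dvd.
Qed.

(** The first entry of the Gothic sequence is a quotient of two Hankel
    determinants, which is why regularity of the sequence makes l finite. *)
Lemma fr0E : Fr`_0 * schur_l s nu.+1 = 1 /\ schur_l s nu.+1 != 0.
Proof.
have l0 : schur_l s nu.+1 != 0.
  rewrite /schur_l /=; apply: mulf_neq0; apply: mulf_neq0.
  - by rewrite signr_eq0.
  - exact: so_lead ok.
  - exact: so_det ok.
  - by rewrite invr_eq0; exact: so_detp ok.
split=> //.
have nN : (nu.+1 <= N)%N by rewrite /N; have := so_nu ok; clear; lia.
have := dvdXnP _ _ AC_dvd nu.+1; rewrite ltnS => /(_ nN).
rewrite coefB coef1 subr0 coefM big_ord_recr /= subnn.
have -> : \sum_(i < nu.+1) A`_i * C'`_(nu.+1 - i) =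
    \sum_(p < nu.+1) (schur_m s nu.+1)`_p * s`_(nu.+1 + p).
  rewrite [RHS](reindex_inj rev_ord_inj) /=; apply: eq_bigr => i _.
  rewrite AM_coef // coef_poly ltn_ord subSS coef_poly.
  have -> : (nu.+1 - i < N.+1)%N by rewrite ltnS (leq_trans (leq_subr _ _)).
  by congr (_ * s`_ _); have := ltn_ord i; clear; move: (nat_of_ord i) => j; lia.
rewrite sum_schur_m_next C'0.
have -> : A`_nu.+1 = - Fr`_0 by rewrite fr_coef /= addn0 opprK.
rewrite mulNr => /eqP; rewrite subr_eq0 => /eqP h.
apply: (mulIf (so_lead ok)); rewrite mul1r mulrAC -h /schur_l /=.
have D0 := so_det ok; have Dp0 := so_detp ok.
have -> : (-1) ^+ nu.+2 * \det (hankel_plus s nu.+1) / \det (hankel s nu.+1) *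
  ((-1) ^+ nu.+2 * s`_nu * (\det (hankel s nu.+1) / \det (hankel_plus s nu.+1))) =
  ((-1) ^+ nu.+2 * (-1) ^+ nu.+2) * s`_nu by field; rewrite D0 Dp0.
by rewrite -expr2 sqrr_sign mul1r.
Qed.

Let L := lpoly s nu.

Lemma L_E : L = \poly_(i < N2.+1) toeplitz_inv fr N2 i.
Proof.
have f0 : fr 0%N != 0.
  have := fr0E.1; rewrite coef_Poly => h; apply/eqP => h0.
  by move/eqP: h; rewrite -[X in X * _]/(fr 0%N) h0 mul0r eq_sym oner_eq0.
apply/polyP => i; rewrite coefB coefC coefXM coef_poly.
case: i => [|i] /=.
  rewrite subr0; have := toeplitz_inv_sum f0 (leq0n N2).
  rewrite big_ord1 /= => h; apply: (mulIf f0); rewrite h.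
  by rewrite mulrC -fr0E.1 coef_Poly.
rewrite sub0r coef_Poly /schur_next (so_size ok) -/N2 ltnS.
case: ltnP => iN; last by rewrite nth_default ?oppr0 // size_mkseq.
by rewrite nth_mkseq // opprK.
Qed.

Lemma LF_dvd : 'X^(N2.+1) %| L * Fr - 1.
Proof.
have f0 : fr 0%N != 0.
  have := fr0E.1; rewrite coef_Poly => h; apply/eqP => h0.
  by move/eqP: h; rewrite -[X in X * _]/(fr 0%N) h0 mul0r eq_sym oner_eq0.
rewrite L_E (_ : Fr = \poly_(i < N2.+1) fr i); first exact: toeplitz_inv_poly.
apply/polyP => i; rewrite coef_Poly coef_poly; case: ltnP => // h.
by rewrite nth_default // /schur_frak size_mkseq (so_size ok).
Qed.

Lemma schur_step_data : schur_data nu.+1 n (Poly s) M L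
  (Poly (schur_next s nu.+1)) (schur_l s nu.+1).
Proof.
split.
- by have := so_nu ok.
- by exists C'; [exact: Poly_sE|rewrite C'0 (so_lead ok)].
- rewrite coef_poly /= subn0; apply/eqP => h; have := schur_m_lead.
  by rewrite h mul0r => /eqP; rewrite eq_sym oner_eq0.
- exact: size_poly.
- by [].
- exact: fr0E.2.
have -> : Poly s * (M * L - 'X^(nu.+1)) - 'X^(nu.+1.-1) * L =
   (A * Poly s - 'X^nu) * L + 'X^(nu.+1) * Poly s * (L * Fr - 1).
  by rewrite A_split /=; ring.
rewrite dvdp_add //; first exact: dvdp_mulr AS_dvd.
have [G ->] : exists G, L * Fr - 1 = 'X^(N2.+1) * G.
  by have /dvdpP[G ->] := LF_dvd; exists G; rewrite mulrC.
rewrite Poly_sE.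
have -> : 'X^(nu.+1) * ('X^nu * C') * ('X^(N2.+1) * G) =
  ('X^(nu.+1 + nu + N2.+1)) * (C' * G) by rewrite !exprD; ring.
apply: dvdp_mulr; apply: dvdp_exp2l.
by rewrite /N2; have := so_nu ok; clear; lia.
Qed.

(** M is an inverse of the series S / 'X^nu up to an error of the exact order
    nu + 1, since Y(0) is the quotient of s_nu by l. *)
Lemma schur_step_Y : exists Y, M * Poly s = 'X^nu + 'X^(nu + nu.+1) * Y /\
  Y`_0 != 0.
Proof.
have [H HE] : exists H, A * Poly s - 'X^nu = 'X^(2 * n) * H.
  by have /dvdpP[H ->] := AS_dvd; exists H; rewrite mulrC.
exists (Fr * C' + 'X^(N2.+1) * H); split; last first.
  rewrite coefD ['X^_ * H]mulrC coefMXn /= addr0 coefM big_ord_recl big_ord0.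
  rewrite addr0 C'0 mulf_neq0 ?(so_lead ok) //.
  by apply/eqP => h; have := fr0E.1; rewrite h mul0r => /eqP; rewrite eq_sym oner_eq0.
have -> : M * Poly s = (A * Poly s - 'X^nu) + 'X^nu + 'X^(nu.+1) * Fr * Poly s.
  by rewrite A_split; ring.
rewrite HE {1}Poly_sE.
have -> : (2 * n = nu + nu.+1 + N2.+1)%N by rewrite /N2; have := so_nu ok; clear; lia.
by rewrite !exprD; ring.
Qed.

End OneStep.
End SchurCoefficients.

(** * Normal indices under the Schur recursion *)

Section SchurChain.
Variable R : realType.
Implicit Types (s : seq R) (n : nat -> nat).

(** The normal indices of the next sequence of the recursion. *)
Definition tail_indices n j := (n j.+1 - n 1%N)%N.

Lemma hankel_det0 s i : (0 < i)%N ->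
  \det (hankel s i) = 0 <-> pade 0 i (Poly s).
Proof.
move=> i0; rewrite -hank_det0 //.
suff -> : hank 0 s i = hankel s i by [].
by apply/matrixP => a b; rewrite !mxE addn0.
Qed.

Lemma hankel_plus_det0 s i : (0 < i)%N ->
  \det (hankel_plus s i) = 0 <-> pade 1 i (Poly s).
Proof.
move=> i0; rewrite -hank_det0 //.
suff -> : hank 1 s i = hankel_plus s i by [].
by apply/matrixP => a b; rewrite !mxE addn1.
Qed.

Lemma normal_indices_lt s N n i j : normal_indices s N n ->
  (i < j <= N)%N -> (n i < n j)%N.
Proof.
move=> [_ mono _ _]; elim: j => // j IH /andP[]; rewrite ltnS leq_eqVlt.
case/orP => [/eqP -> /mono //|ij jN].
by apply: ltn_trans (mono _ jN); apply: IH; rewrite ij ltnW.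
Qed.

Lemma normal_indices_le s N n i j : normal_indices s N n ->
  (i <= j <= N)%N -> (n i <= n j)%N.
Proof.
move=> h /andP[]; rewrite leq_eqVlt => /orP[/eqP -> //|ij jN].
by rewrite ltnW // (normal_indices_lt h) // ij.
Qed.

(** If s_i were the first nonzero entry with i < nu, a Pade pair (q, p) of
    order i + 1 would have 'X^i dividing p, hence p = 0, and then 'X^(i + 1)
    dividing q, hence q = 0. *)
Lemma zeros_before_normal s nu :
  (forall i, (0 < i < nu.+1)%N -> \det (hankel s i) = 0) ->
  forall i, (i < nu)%N -> s`_i = 0.
Proof.
move=> h i; elim/ltn_ind: i => i IH inu; apply/eqP; apply/negPn/negP => si.
have /(hankel_det0 s (ltn0Sn i)) [q [p [q0 sq sp dv]]] :
  \det (hankel s i.+1) = 0 by apply: h; rewrite ltn0Sn ltnS.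
move: sp dv; rewrite /= addn0 => sp dv.
have [S' SE] : exists S', Poly s = 'X^i * S'.
  have /dvdpP[S' ->] : 'X^i %| Poly s.
    by apply/dvdXnP => j ji; rewrite coef_Poly IH // (ltn_trans ji).
  by exists S'; rewrite mulrC.
have S0 : S'`_0 != 0.
  have := congr1 (fun P : {poly R} => P`_i) SE.
  by rewrite coef_Poly mulrC coefMXn ltnn subnn => <-.
have p0 : p = 0.
  apply: (@dvdXn_small _ i) => //.
  have -> : p = q * Poly s - (q * Poly s - p) by ring.
  apply: dvdp_sub; first by rewrite SE mulrCA dvdp_mulIl.
  by apply: dvdp_trans dv; rewrite dvdp_exp2l // leq_addr.
move: dv; rewrite p0 subr0 SE mulrCA dvdXnD => /(dvdXn_mulr S0) dq.
by case/eqP: q0; apply: (dvdXn_small dq).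
Qed.

Lemma first_step s N n : normal_indices s N.+1 n -> regular s N.+1 n ->
  step_ok s (n 1%N).-1 (n N.+1).
Proof.
move=> hs hr; have [n00 mono ss hdet] := hs.
have n1 : (0 < n 1)%N by rewrite -[X in (X < _)%N]n00 mono.
have n1N : (n 1 <= n N.+1)%N by apply: (normal_indices_le hs); rewrite leqnn.
have d1 : \det (hankel s (n 1%N)) != 0.
  by apply/hdet; [rewrite n1 n1N|exists 1%N].
have z i : (i < (n 1).-1)%N -> s`_i = 0.
  apply: zeros_before_normal => {}i; rewrite prednK // => /andP[i0 i1].
  apply/eqP/negPn/negP => /hdet; rewrite i0 (leq_trans (ltnW i1)) //.
  move=> /(_ isT) [j jN ij]; move: i1; rewrite -ij ltnNge.
  by rewrite (normal_indices_le hs).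
split=> //; rewrite ?prednK //; last by apply: hr.
apply/eqP => s0; case/eqP: d1.
move: z s0; rewrite -(prednK n1) /= => z s0.
rewrite (expand_det_row _ ord0) big1 // => j _; rewrite mxE add0n.
have : (j <= (n 1).-1)%N by rewrite -ltnS.
by rewrite leq_eqVlt => /orP[/eqP ->|/z ->]; rewrite ?s0 mul0r.
Qed.

(** By [pade_step] the singular Hankel matrices of the next sequence are those
    of s with orders lowered by n_1. *)
Lemma next_step s N n : normal_indices s N.+1 n -> regular s N.+1 n ->
  normal_indices (schur_next s (n 1%N)) N (tail_indices n) /\
  regular (schur_next s (n 1%N)) N (tail_indices n).
Proof.
move=> hs hr; have ok := first_step hs hr; have [n00 mono ss hdet] := hs.
have n1 : (0 < n 1)%N by rewrite -[X in (X < _)%N]n00 mono.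
have dat := schur_step_data ok; move: dat; rewrite prednK // => dat.
have le1 j : (j <= N)%N -> (n 1 <= n j.+1)%N.
  by move=> jN; apply: (normal_indices_le hs); apply/andP; split; rewrite ?ltnS.
have lt1 j : (0 < j <= N)%N -> (0 < tail_indices n j)%N.
  by move=> /andP[j0 jN]; rewrite subn_gt0 (normal_indices_lt hs) // !ltnS j0.
have leN j : (j <= N)%N -> (n 1 + tail_indices n j <= n N.+1)%N.
  by move=> jN; rewrite subnKC ?le1 // (normal_indices_le hs) // ltnS jN /= leqnn.
split; first split.
- by rewrite /tail_indices subnn.
- move=> j jN; rewrite ltn_sub2r ?mono //.
  by apply: (normal_indices_lt hs); apply/andP; split; rewrite ?ltnS.
- by rewrite size_mkseq ss mulnBr.
- move=> i /andP[i0 iN].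
  have iN' : (n 1 + i <= n N.+1)%N by rewrite -leq_subRL ?le1.
  have -> : (\det (hankel (schur_next s (n 1%N)) i) != 0) =
     (\det (hankel s (n 1%N + i)) != 0).
    congr (~~ _); apply/eqP/eqP.
      by move=> /(hankel_det0 _ i0) /(pade_step dat _ i0 iN') => /(_ isT);
        rewrite -hankel_det0 // addn_gt0 i0 orbT.
    move=> h; apply/(hankel_det0 _ i0)/(pade_step dat _ i0 iN') => //.
    by rewrite -hankel_det0 // addn_gt0 i0 orbT.
  rewrite hdet ?addn_gt0 ?n1 //; split=> [[j /andP[j0 jN] nj]|[j /andP[j0 jN] nj]].
    case: j j0 jN nj => // j _ jN nj; exists j; last by rewrite /tail_indices nj addKn.
    case: j jN nj => [|j] jN nj; last by [].
    by move: i0; rewrite -(ltn_add2l (n 1%N)) -nj addn0 ltnn.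
  by exists j.+1; [apply/andP|rewrite -nj subnKC ?le1].
- move=> j jN; have j0 := lt1 _ jN; have /andP[_ jN'] := jN.
  apply/eqP => /(hankel_plus_det0 _ j0) /(pade_step dat (leqnn _) j0 (leN _ jN')).
  rewrite -hankel_plus_det0 ?addn_gt0 ?n1 //; apply/eqP.
  by rewrite subnKC ?le1 //; apply: hr; apply/andP.
Qed.

Definition blocks s n N := [seq (mpol s n j, lnum s n j) | j <- iota 1 N].

Lemma schur_seq_tail s N n j : normal_indices s N.+1 n -> (j <= N)%N ->
  schur_seq s n j.+1 = schur_seq (schur_next s (n 1%N)) (tail_indices n) j.
Proof.
move=> hs; elim: j => [|j IH] jN.
  by rewrite /=; have [-> _ _ _] := hs; rewrite subn0.
change (schur_next (schur_seq s n j.+1) (n j.+2 - n j.+1) =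
  schur_next (schur_seq (schur_next s (n 1%N)) (tail_indices n) j)
    (tail_indices n j.+1 - tail_indices n j)).
rewrite -IH ?(ltnW jN) //; congr (schur_next _ _).
have [h1 h2] : (n 1 <= n j.+1)%N /\ (n j.+1 <= n j.+2)%N.
  by split; apply: (normal_indices_le hs); apply/andP; split; rewrite ?ltnS ?(ltnW jN) ?leqnSn.
by rewrite /tail_indices; move: h1 h2; clear; lia.
Qed.

(** The recursion can thus be run from the front: one block, followed by the
    blocks of the next sequence. *)
Lemma blocks_cons s N n : normal_indices s N.+1 n ->
  blocks s n N.+1 = (schur_m s (n 1%N), schur_l s (n 1%N)) ::
    blocks (schur_next s (n 1%N)) (tail_indices n) N.
Proof.
move=> hs; rewrite /blocks /= /mpol /lnum /=; congr (_ :: _).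
  by have [-> _ _ _] := hs; rewrite subn0.
rewrite -[2%N]/(1 + 1)%N iotaDl -map_comp; apply/eq_in_map => j.
rewrite mem_iota => /andP[j0 jN] /=; case: j j0 jN => // j _ jN.
rewrite [(j.+1).-1]/= (schur_seq_tail hs); last by rewrite -ltnS ltnW.
suff -> : (n j.+2 - n j.+1 = tail_indices n j.+1 - tail_indices n j)%N by [].
have jN' : (j < N)%N by rewrite -ltnS.
have [h1 h2] : (n 1 <= n j.+1)%N /\ (n j.+1 <= n j.+2)%N.
  by split; apply: (normal_indices_le hs); apply/andP; split; rewrite ?ltnS ?(ltnW jN') ?leqnSn.
by rewrite /tail_indices; move: h1 h2; clear; lia.
Qed.

End SchurChain.

(** * The matrices W and the continued fraction *)

Section Moebius.
Variable K : fieldType.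
Implicit Types (A B : 'M[K]_2) (v : 'cV[K]_2) (w : option K).

Definition ratio v : option K :=
  if v 1 0 == 0 then None else Some (v 0 0 / v 1 0).

Definition homog w : 'cV[K]_2 :=
  \col_i if w is Some t then (if i == 0 then t else 1) else (i == 0)%:R.

Lemma ord2P (i : 'I_2) : i = 0 \/ i = 1.
Proof. by case: i => [[|[|//]] h]; [left|right]; apply: val_inj. Qed.

Lemma mulmx2E A v i : (A *m v) i 0 = A i 0 * v 0 0 + A i 1 * v 1 0.
Proof.
rewrite mxE big_ord_recl big_ord1; congr (_ * v _ _ + _ i _ * v _ _);
  exact: val_inj.
Qed.

Lemma moebiusE A w : moebius A w = ratio (A *m homog w).
Proof.
rewrite /ratio !mulmx2E !mxE /=; case: w => [t|] /=; last first.
  by rewrite !mulr0 !addr0 !mulr1.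
by rewrite !mulr1.
Qed.

Lemma homog_neq0 w : homog w != 0.
Proof.
apply/eqP => /matrixP h; case: w h => [t|] h.
  by have := h 1 0; rewrite !mxE /= => /eqP; rewrite oner_eq0.
by have := h 0 0; rewrite !mxE /= => /eqP; rewrite oner_eq0.
Qed.

Lemma moebius_ratio A v : v != 0 -> moebius A (ratio v) = ratio (A *m v).
Proof.
move=> v0; rewrite /ratio !mulmx2E; have [v1|v1] := eqVneq (v 1 0) 0.
  have v00 : v 0 0 != 0.
    apply: contra_neq v0 => v00; apply/matrixP => i j; rewrite (ord1 j) mxE.
    by have [->|->] := ord2P i.
  rewrite v1 /= !mulr0 !addr0 mulf_eq0 (negPf v00) orbF; case: eqP => // a0.
  by congr Some; rewrite -mulf_div divff // mulr1.
rewrite /=; have -> : A 1 0 * (v 0 0 / v 1 0) + A 1 1 =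
    (A 1 0 * v 0 0 + A 1 1 * v 1 0) / v 1 0 by field.
rewrite mulf_eq0 invr_eq0 (negPf v1) orbF; case: eqP => // a0.
have -> : A 0 0 * (v 0 0 / v 1 0) + A 0 1 =
    (A 0 0 * v 0 0 + A 0 1 * v 1 0) / v 1 0 by field.
by congr Some; rewrite invfM invrK mulrACA mulVf // mulr1.
Qed.

(** In homogeneous coordinates a linear fractional transformation is the
    product with a matrix; B has to be invertible for B v to remain a point of
    the sphere. *)
Lemma moebiusM A B w : B \in unitmx ->
  moebius (A *m B) w = moebius A (moebius B w).
Proof.
move=> Bu; rewrite [moebius B w]moebiusE moebius_ratio ?mulmxA -?moebiusE //.
apply: contra_neq (homog_neq0 w) => h.
by rewrite -[homog w](mulKmx Bu) h mulmx0.
Qed.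

Lemma moebius_shift (a : K) w : moebius (mx2 1 a 0 1) w = sphere_add a w.
Proof.
case: w => [t|]; rewrite /moebius !mxE /= ?eqxx //.
by rewrite mul0r add0r oner_eq0 mul1r divr1 addrC.
Qed.

Lemma moebius_lower (a : K) w :
  moebius (mx2 1 0 a 1) w = sphere_inv (sphere_add a (sphere_inv w)).
Proof.
case: w => [t|]; rewrite /moebius !mxE /=; last by rewrite addr0 div1r.
have [->|t0] := eqVneq t 0 => /=.
  by rewrite mulr0 add0r oner_eq0 mulr0 addr0 mul0r.
have -> : a * t + 1 = t * (a + t^-1) by field.
rewrite mulf_eq0 (negPf t0) mul1r addr0; case: eqP => // a0.
by rewrite invfM mulrA mulfV // mul1r.
Qed.

Lemma mx2_unit_upper (a : K) : mx2 1 a 0 1 \in unitmx.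
Proof.
suff h : mx2 1 a 0 1 *m mx2 1 (- a) 0 1 = 1%:M by have [] := mulmx1_unit h.
apply/matrixP => i j; rewrite !mxE big_ord_recl big_ord1 !mxE.
by have [->|->] := ord2P i; have [->|->] := ord2P j; rewrite /=; ring.
Qed.

Lemma mx2_unit_lower (a : K) : mx2 1 0 a 1 \in unitmx.
Proof.
suff h : mx2 1 0 a 1 *m mx2 1 0 (- a) 1 = 1%:M by have [] := mulmx1_unit h.
apply/matrixP => i j; rewrite !mxE big_ord_recl big_ord1 !mxE.
by have [->|->] := ord2P i; have [->|->] := ord2P j; rewrite /=; ring.
Qed.

End Moebius.

Section Chain.
Local Open Scope complex_scope.
Variable R : realType.
Local Notation C := R[i].
Implicit Types (bs : seq ({poly R} * R)) (f : C -> option C).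

(** The solution with the parameter f; one step for each pair (m_j, l_j). *)
Definition chain bs f := foldr (fun b => step b.1 b.2) f bs.

Lemma chain_onto bs f : exists g, chain bs g = f.
Proof.
elim: bs f => [|b bs IH] f; first by exists f.
have [g gE] := IH (unstep b.1 b.2 f); exists g.
by rewrite /= gE unstepK.
Qed.

Lemma cfrac_chain s n N f z :
  cfrac s n N z (f z) = chain (blocks s n N) f z.
Proof.
rewrite /cfrac /blocks; elim: (iota 1 N) => //= j r ->.
by rewrite stepE.
Qed.

Lemma moebius_cfrac s n N z (w : option C) :
  moebius (Wmx s n N z) w = cfrac s n N z w.
Proof.
rewrite /Wmx /cfrac /index_iota subn1 /=.
have [] // : \prod_(j <- iota 1 N) (Mmx s n j z *m Lmx s n j) \in unitmx /\
  moebius (\prod_(j <- iota 1 N) (Mmx s n j z *m Lmx s n j)) w =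
  foldr (fun j w => sphere_inv (sphere_add (- (z * poly_eval (mpol s n j) z))
             (sphere_inv (sphere_add (lnum s n j)%:C w)))) w (iota 1 N).
elim: (iota 1 N) => [|j r [IHu IHm]].
  rewrite big_nil unitmx1; split=> //; rewrite moebiusE mul1mx /=.
  by case: w => [t|]; rewrite /ratio !mxE /= ?eqxx // oner_eq0 divr1.
rewrite big_cons; set P := \prod_(i <- r) _ in IHu IHm *.
rewrite -[_ * P]/((Mmx s n j z *m Lmx s n j) *m P).
have Lu : Lmx s n j \in unitmx by apply: mx2_unit_upper.
have Mu : Mmx s n j z \in unitmx by apply: mx2_unit_lower.
split; first by rewrite !unitmx_mul Mu Lu.
rewrite moebiusM // moebiusM // moebius_shift /=.
by rewrite /Mmx moebius_lower IHm.
Qed.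

End Chain.

(** * The moment expansion under one step *)

Section ExpansionStep.
Local Open Scope complex_scope.
Variable R : realType.
Local Notation C := R[i].
Local Notation sfun := (C -> option C).
Implicit Types (f : sfun) (P Q m : {poly R}) (l : R) (z : C).

Lemma poly_evalM P Q z : poly_eval (P * Q) z = poly_eval P z * poly_eval Q z.
Proof. by rewrite /poly_eval rmorphM hornerM. Qed.

Lemma poly_evalD P Q z : poly_eval (P + Q) z = poly_eval P z + poly_eval Q z.
Proof. by rewrite /poly_eval rmorphD hornerD. Qed.

Lemma poly_evalXn k z : poly_eval 'X^k z = z ^+ k.
Proof. by rewrite /poly_eval map_polyXn hornerXn. Qed.

Lemma cvg_poly_axis_inv P :
  cvgc +oo (fun y => poly_eval P (axis_inv y)) (P`_0)%:C.
Proof.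
elim/poly_ind: P => [|P c IH].
  rewrite coef0; apply: (cvgc_eq _ (cvgc_cst 0)); apply: nearW => y.
  by rewrite /poly_eval rmorph0 horner0.
pose proof (cvgcD (cvgcM IH (@cvg_axis_inv R)) (cvgc_cst c%:C)) as h.
rewrite coefD coefMX coefC /= add0r; rewrite mulr0 add0r in h.
apply: (cvgc_eq _ h); apply: nearW => y.
by rewrite poly_evalD [P * _]mulrC poly_evalXM poly_evalC mulrC.
Qed.

Lemma step_value m l f z a : f z = Some a ->
  1 - z * poly_eval m z * (l%:C + a) != 0 ->
  step m l f z = Some ((l%:C + a) / (1 - z * poly_eval m z * (l%:C + a))).
Proof.
move=> fz; rewrite stepE fz /=; set w := l%:C + a; set c := z * _ => d0.
have [->|w0] := eqVneq w 0; first by rewrite /= mul0r.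
have e : - c + w^-1 = (1 - c * w) / w by field.
by rewrite /= e mulf_eq0 invr_eq0 (negPf d0) (negPf w0) /= invf_div.
Qed.

Lemma unstep_value m l f z b : step m l f z = Some b ->
  1 + z * poly_eval m z * b != 0 ->
  f z = Some (b / (1 + z * poly_eval m z * b) - l%:C).
Proof.
rewrite -{2}(stepK m l f); move: (step m l f) => g gz.
rewrite /unstep /ninvf /padd /= gz !poly_evalN poly_evalXM poly_evalC.
set c := z * _ => d0; have [->|b0] := eqVneq b 0.
  by rewrite /ninv eqxx /= mul0r sub0r addr0.
rewrite /ninv (negPf b0) /=.
have -> : - c + - b^-1 = - ((1 + c * b) / b) by field.
rewrite oppr_eq0 mulf_eq0 invr_eq0 (negPf d0) (negPf b0) /=.
by rewrite invrN opprK invf_div addrC.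
Qed.

Lemma expands_axis_lim (s : nat -> R) K f : expands s K f -> axis_lim f 0.
Proof.
move=> [ff h]; split; first exact: ff.
pose proof (@cvg_axis_inv R) as u.
pose proof (cvgcB (cvgcM h (cvgcX (k := K) u)) (@cvg_poly_axis_inv ('X * spoly s K))) as h1.
rewrite mul0r coefXM /= subr0 in h1.
apply: (cvgc_eq _ h1); apply: filterS (@near_pos R) => y y0.
by rewrite -mulrA -exprMn /axis_inv mulfV ?axis_neq0 // expr1n mulr1 addrK.
Qed.

Lemma spoly_seq (s : seq R) : spoly (nth 0 s) (size s) = Poly s.
Proof.
apply/polyP => i; rewrite coef_poly coef_Poly; case: ltnP => // h.
by rewrite nth_default.
Qed.

Section Step.
Variables (s : seq R) (nu n : nat) (f : sfun).
Hypothesis ok : step_ok s nu n.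

Let m := schur_m s nu.+1.
Let l := schur_l s nu.+1.
Let s1 := schur_next s nu.+1.
Let M := mrev s nu.
Let L := lpoly s nu.

Lemma size_schur_next : size s1 = (2 * (n - nu.+1))%N.
Proof. by rewrite /s1 /schur_next size_mkseq (so_size ok) mulnBr. Qed.

Lemma schur_m_axis y : 0 < y ->
  axis y * poly_eval m (axis y) = poly_eval M (axis_inv y) / axis_inv y ^+ nu.+1.
Proof.
move=> y0; have z0 := axis_neq0 y0.
rewrite /poly_eval (horner_coef_wide _ (_ : size _ <= nu.+1)%N); last first.
  by rewrite size_map_poly (schur_m_size ok).
rewrite (horner_coef_wide _ (_ : size _ <= nu.+1)%N); last first.
  by rewrite size_map_poly size_poly.
rewrite /axis_inv exprVn invrK exprSr mulrA [RHS]mulrC; congr (_ * _).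
rewrite [LHS](reindex_inj rev_ord_inj) mulr_suml; apply: eq_bigr => i _.
have inu : (i <= nu)%N by rewrite -ltnS.
rewrite /= subSS !coef_map /= coef_poly ltn_ord exprVn.
have -> : axis y ^+ nu = axis y ^+ (nu - i) * axis y ^+ i by rewrite -exprD subnK.
by field; rewrite expf_neq0.
Qed.

(** The two congruences of the recursion with their remainders Z and Y,
    multiplied by u. *)
Lemma step_identities : exists Z Y : {poly R}, Y`_0 != 0 /\ forall u,
  let ev P := poly_eval P u in
  u * ev (Poly s) * (ev M * ev L - u ^+ nu.+1) - u ^+ nu.+1 * ev L =
    u ^+ (2 * n).+1 * ev Z /\
  u * ev M * ev (Poly s) = u ^+ nu.+1 + u ^+ (2 * nu.+1) * ev Y.
Proof.
have [_ _ _ _ _ _ /dvdpP[Z ZE]] := schur_step_data ok.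
have [Y [YE Y0]] := schur_step_Y ok.
exists Z, Y; split=> // u; move: ZE YE; rewrite -/M -/L /=.
move: M L (Poly s) => M' L' S ZE YE.
have h1 := congr1 (fun P => poly_eval P u) ZE.
have h2 := congr1 (fun P => poly_eval P u) YE; split.
  move: h1; rewrite !(poly_evalM, poly_evalD, poly_evalN, poly_evalXn) => h1.
  have -> : u ^+ (2 * n).+1 * poly_eval Z u = u * (poly_eval Z u * u ^+ (2 * n)).
    by rewrite exprS; ring.
  rewrite -h1.
  by rewrite exprS; ring.
move: h2; rewrite !(poly_evalM, poly_evalD, poly_evalN, poly_evalXn) => h2.
rewrite -mulrA h2 mulrDr -exprS mulrA -exprS; congr (_ + u ^+ _ * _); lia.
Qed.

Lemma cvgL : cvgc +oo (fun y => poly_eval L (axis_inv y)) l%:C.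
Proof.
have := @cvg_poly_axis_inv L.
by rewrite /L /lpoly coefB coefC coefXM /= subr0.
Qed.

Lemma L_eval u : poly_eval L u = l%:C - u * poly_eval (Poly s1) u.
Proof.
by rewrite /L /lpoly poly_evalD poly_evalN poly_evalC poly_evalXM.
Qed.

(** If eps = f_1 + u S_1, the remainder f_0 + u S is - (u ^ (2 n + 1) Z + u ^
    (2 nu + 2) Y eps) / (u ^ (nu + 1) - M (L + eps)), by the two identities,
    and the denominator tends to - M(0) l, which is not 0. *)
Lemma expands_stepW : expands (nth 0 s1) (size s1) f ->
  expands (nth 0 s) (size s) (step m l f).
Proof.
move=> h1; have fl := expands_axis_lim h1; have [ff {}h1] := h1.
rewrite spoly_seq size_schur_next in h1.
have [Z [Y [Y0 id]]] := step_identities.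
have l0 : l != 0 := (fr0E ok).2.
have M0 : M`_0 != 0 := sd_M (schur_step_data ok).
have m0 : m != 0 by rewrite -size_poly_eq0 (schur_m_size ok).
have [_ _ _ _ [f0f f0l]] := step_axis m0 l0 fl.
split; first exact: f0f.
rewrite spoly_seq (so_size ok).
set e := fun y : R => _ in h1.
pose proof (@cvg_axis_inv R) as ul.
pose proof (cvgcM h1 (cvgcX (k := (2 * (n - nu.+1))%N) ul)) as eps.
rewrite mul0r in eps.
pose proof (cvgcB (cvgcX (k := nu.+1) ul)
   (cvgcM (@cvg_poly_axis_inv M) (cvgcD cvgL eps))) as den.
have d0 : 0 ^+ nu.+1 - (M`_0)%:C * (l%:C + 0) != 0.
  by rewrite exprS mul0r sub0r addr0 oppr_eq0 mulf_neq0 //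
    (fmorph_eq0 (real_complex R)).
pose proof (cvgcD (cvgcM ul (@cvg_poly_axis_inv Z)) (cvgcM h1 (@cvg_poly_axis_inv Y))) as num.
pose proof (cvgcN (cvgcM num (cvgcV d0 den))) as res.
rewrite !mul0r addr0 mul0r oppr0 in res.
apply: (cvgc_eq _ res).
apply: filterS3 (@near_pos R) ff (cvgc_neq den d0) => y y0 fy.
have z0 := axis_neq0 y0; set u := axis_inv y.
have u0 : u != 0 by rewrite invr_eq0.
have [i1 i2] := id u; rewrite /e.
case fE : (f (axis y)) fy => [a|] // _; rewrite /= poly_evalXM -/u.
have zu : axis y = u^-1 by rewrite invrK.
have zuX k : axis y ^+ k = (u ^+ k)^-1 by rewrite zu exprVn.
rewrite !zuX -[_ / u ^+ _ * u ^+ _]mulrA mulVf ?expf_neq0 // mulr1.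
set eps' := a + _.
have wE : l%:C + a = poly_eval L u + eps' by rewrite L_eval /eps'; ring.
move=> dn.
have cE := schur_m_axis y0.
have den0 : 1 - axis y * poly_eval m (axis y) * (l%:C + a) != 0.
  rewrite cE wE; have -> : 1 - poly_eval M u / u ^+ nu.+1 * (poly_eval L u + eps') =
    (u ^+ nu.+1 - poly_eval M u * (poly_eval L u + eps')) / u ^+ nu.+1.
    by field; rewrite expf_neq0.
  by rewrite mulf_neq0 // invr_eq0 expf_neq0.
rewrite (step_value fE den0) /= cE wE poly_evalXM.
have aE : (2 * n = 2 * nu.+1 + 2 * (n - nu.+1))%N.
  by have := so_nu ok; clear; lia.
move: i1 i2; rewrite [u ^+ (2 * n).+1]exprS aE exprD mul2n -addnn exprD.
have := expf_neq0 (2 * (n - nu.+1)) u0; have := expf_neq0 nu.+1 u0.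
clearbody eps'.
move: dn; move: (poly_eval M u) (poly_eval L u) (poly_eval (Poly s) u).
move: (poly_eval Z u) (poly_eval Y u) (u ^+ nu.+1) (u ^+ (2 * (n - nu.+1))).
move=> Zu Yu p q Mu Lu Su dn p0 q0 i1 i2.
have num' : p * (Lu + eps') + u * Su * (p - Mu * (Lu + eps')) =
    - ((u * Zu + eps' / q * Yu) * (p * p * q)).
  apply/eqP; rewrite -subr_eq0.
  have -> : p * (Lu + eps') + u * Su * (p - Mu * (Lu + eps')) -
      - ((u * Zu + eps' / q * Yu) * (p * p * q)) =
    - (u * Su * (Mu * Lu - p) - p * Lu - u * (p * p * q) * Zu) -
    eps' * (u * Mu * Su - (p + p * p * Yu)) by field.
  by rewrite i1 i2; apply/eqP; ring.
have -> : (Lu + eps') / (1 - Mu / p * (Lu + eps')) =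
    p * (Lu + eps') / (p - Mu * (Lu + eps')).
  have -> : 1 - Mu / p * (Lu + eps') = (p - Mu * (Lu + eps')) / p by field.
  by rewrite invf_div mulrA [_ * p]mulrC.
have -> : p * (Lu + eps') / (p - Mu * (Lu + eps')) + u * Su =
    (p * (Lu + eps') + u * Su * (p - Mu * (Lu + eps'))) /
    (p - Mu * (Lu + eps')) by rewrite mulrDl mulfK.
rewrite num' !mulNr [_ * (p * p * q) / _]mulrAC mulfK //.
by rewrite !mulf_neq0.
Qed.

(** If delta = f_0 + u S, the remainder f_1 + u S_1 is (u ^ (2 n + 1) Z + delta
    (u ^ (nu + 1) - L M)) / (M delta - u ^ (2 nu + 2) Y). The denominator is of
    the exact order 2 nu + 2 as Y(0) is not 0, which explains the loss of 2 nu
    + 2 moments. *)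
Lemma expands_step_inv : expands (nth 0 s) (size s) (step m l f) ->
  expands (nth 0 s1) (size s1) f.
Proof.
move=> [ff h1].
rewrite spoly_seq (so_size ok) in h1.
have [Z [Y [Y0 id]]] := step_identities.
set d := fun y : R => _ in h1.
pose proof (@cvg_axis_inv R) as ul.
pose proof (cvgcB (cvgcM (cvgcM (@cvg_poly_axis_inv M) h1)
  (cvgcX (k := (2 * (n - nu.+1))%N) ul)) (@cvg_poly_axis_inv Y)) as den.
rewrite mulr0 mul0r sub0r in den.
have d0 : - (Y`_0)%:C != 0 by rewrite oppr_eq0 (fmorph_eq0 (real_complex R)).
pose proof (cvgcD (cvgcM h1 (cvgcB (cvgcX (k := nu.+1) ul)
  (cvgcM cvgL (@cvg_poly_axis_inv M)))) (cvgcM ul (@cvg_poly_axis_inv Z))) as num.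
pose proof (cvgcM num (cvgcV d0 den)) as res.
rewrite !mul0r addr0 mul0r in res.
have fE : \forall y \near +oo, exists2 a, f (axis y) = Some a &
    (d y * (axis_inv y ^+ nu.+1 - poly_eval L (axis_inv y) *
       poly_eval M (axis_inv y)) + axis_inv y * poly_eval Z (axis_inv y)) /
    (poly_eval M (axis_inv y) * d y * axis_inv y ^+ (2 * (n - nu.+1)) -
       poly_eval Y (axis_inv y)) =
    (a + poly_eval ('X * Poly s1) (axis_inv y)) * axis y ^+ (2 * (n - nu.+1)).
  apply: filterS3 (@near_pos R) ff (cvgc_neq den d0) => y y0 fy.
  have z0 := axis_neq0 y0; have cE := schur_m_axis y0.
  rewrite /d poly_evalXM; set u := axis_inv y.
  have u0 : u != 0 by rewrite invr_eq0.
  have [i1 i2] := id u.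
  case gE : (step m l f (axis y)) fy => [b|] // _; rewrite /= poly_evalXM -/u.
  have zu : axis y = u^-1 by rewrite invrK.
  have zuX k : axis y ^+ k = (u ^+ k)^-1 by rewrite zu exprVn.
  have aE : (2 * n = 2 * nu.+1 + 2 * (n - nu.+1))%N.
    by have := so_nu ok; clear; lia.
  rewrite !zuX; move: i1 i2.
  rewrite [u ^+ (2 * n).+1]exprS aE exprD mul2n -addnn exprD.
  have := expf_neq0 (2 * (n - nu.+1)) u0; have := expf_neq0 nu.+1 u0.
  have := unstep_value gE; rewrite cE; have := L_eval u.
  move: (poly_eval M u) (poly_eval L u) (poly_eval (Poly s) u).
  move: (poly_eval Z u) (poly_eval Y u) (u ^+ nu.+1) (u ^+ (2 * (n - nu.+1))).
  move: (poly_eval _ u) => S1.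
  move=> Zu Yu p q Mu Lu Su LE fE p0 q0 i1 i2.
  set D := Mu * _ * _ - _ => D0.
  have DE : p + Mu * b = p * p * D.
    apply/eqP; rewrite -subr_eq0.
    have -> : p + Mu * b - p * p * D = - (u * Mu * Su - (p + p * p * Yu)).
      by rewrite /D; field; rewrite p0 q0.
    by rewrite i2 subrr oppr0.
  have bE : 1 + Mu / p * b = p * D.
    have -> : 1 + Mu / p * b = (p + Mu * b) / p by field.
    by rewrite DE; field.
  exists (b / (1 + Mu / p * b) - l%:C).
    by apply: fE; rewrite bE mulf_neq0.
  have -> : b / (1 + Mu / p * b) - l%:C + u * S1 = b / (p * D) - Lu.
    by rewrite bE LE; ring.
  have rE : p * Yu * Lu - u * Su = u * (p * q) * Zu.
    apply: (mulIf p0); apply/eqP; rewrite -subr_eq0.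
    have -> : (p * Yu * Lu - u * Su) * p - u * (p * q) * Zu * p =
      (u * Su * (Mu * Lu - p) - p * Lu - u * (p * p * q) * Zu) -
      Lu * (u * Mu * Su - (p + p * p * Yu)) by ring.
    by rewrite i1 i2 !subrr mulr0 subrr.
  have -> : (b / (p * D) - Lu) / q = (b - Lu * p * D) / (p * q) / D.
    by field; rewrite p0 q0 D0.
  congr (_ / D).
  apply: (mulIf (mulf_neq0 p0 q0)); rewrite divfK ?mulf_neq0 //.
  apply/eqP; rewrite -subr_eq0.
  have -> : ((b + u * Su) / (p * p * q) * (p - Lu * Mu) + u * Zu) * (p * q) -
     (b - Lu * p * D) = - ((p * Yu * Lu - u * Su) - u * (p * q) * Zu).
    by rewrite /D; field; rewrite p0 q0.
  by rewrite rE subrr oppr0.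
split; first by apply: filterS fE => y [a ->].
rewrite spoly_seq size_schur_next.
by apply: (cvgc_eq _ res); apply: filterS fE => y [a -> ->].
Qed.

End Step.
End ExpansionStep.

(** * Chains of steps *)

Section SolutionChains.
Local Open Scope complex_scope.
Variable R : realType.
Local Notation C := R[i].
Local Notation cj := (@conjc R).
Local Notation sfun := (C -> option C).
Implicit Types (s : seq R) (f tau : sfun) (P m : {poly R}) (bs : seq ({poly R} * R)).

Lemma expandsP (s : seq R) f :
  moment_expansion s f <-> expands (nth 0 s) (size s) f.
Proof.
have sumE (y : R) : poly_eval ('X * spoly (nth 0 s) (size s)) (axis_inv y) =
    \sum_(j < size s) (s`_j)%:C / axis y ^+ j.+1.
  rewrite poly_evalXM /poly_eval (horner_coef_wide _ (_ : size _ <= size s)%N).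
    rewrite mulr_sumr; apply: eq_bigr => j _.
    by rewrite coef_map coef_poly ltn_ord /= /axis_inv exprVn exprS invfM; ring.
  by rewrite size_map_poly size_poly.
have normE (y : R) (a : C) (e : R) : 0 < y ->
  (`|a * axis y ^+ size s| <= e%:C) = (`|a| <= e%:C * `|axis y ^- size s|).
  move=> y0; rewrite normfV ler_pdivlMr ?normrM // normr_gt0 expf_neq0 //.
  exact: axis_neq0.
split=> [h|[ff h] e e0].
  split.
    by apply: filterS (h 1 ltr01) => y [w]; rewrite -/(axis y) => ->.
  apply/cvgrPdist_le => e /posc_real[-> e0].
  apply: filterS2 (@near_pos R) (h _ e0) => y y0 [w].
  rewrite -/(axis y) => -> /= hw.
  by rewrite sub0r normrN normE // sumE.
pose proof (cvgc_le h e0) as h1.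
apply: filterS3 (@near_pos R) ff h1 => y y0; rewrite -/(axis y).
case: (f (axis y)) => [w|] //= _; rewrite subr0 normE // sumE => hw.
by exists w.
Qed.

Lemma expands_eq (c : nat -> R) K f g : (forall z, nonreal z -> f z = g z) ->
  expands c K f -> expands c K g.
Proof.
move=> fg [ff h]; have fgy y : 0 < y -> f (axis y) = g (axis y).
  by move=> y0; apply: fg; apply: upper_nonreal; exact: upper_axis.
split; first by apply: filterS2 (@near_pos R) ff => y /fgy ->.
by apply: (cvgc_eq _ h); apply: filterS (@near_pos R) => y /fgy ->.
Qed.

Lemma expands_nil f : expands (nth 0 [::]) 0 f <-> axis_lim f 0.
Proof.
have e0 (y : R) : poly_eval ('X * spoly (nth 0 [::]) 0) (axis_inv y) = 0.
  by rewrite poly_evalXM /spoly poly_def big_ord0 /poly_eval rmorph0 horner0 mulr0.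
split=> -[ff h]; split; first exact: ff.
- by apply: (cvgc_eq _ h); apply: nearW => y; rewrite e0 expr0 addr0 mulr1.
- exact: ff.
- by apply: (cvgc_eq _ h); apply: nearW => y; rewrite e0 expr0 addr0 mulr1.
Qed.

(** Each step trades the moments of one block for a block of the continued
    fraction, so that after the last one no condition but smallness remains. *)
Lemma expands_blocks s N n tau : normal_indices s N n -> regular s N n ->
  expands (nth 0 s) (size s) (chain (blocks s n N) tau) <-> axis_lim tau 0.
Proof.
elim: N s n => [|N IH] s n hs hr.
  have [n0 _ ss _] := hs; rewrite n0 muln0 in ss.
  by rewrite (size0nil ss); exact: expands_nil.
have ok := first_step hs hr; have [hs1 hr1] := next_step hs hr.
have n1 : (0 < n 1)%N by have [n0 mono _ _] := hs; rewrite -[X in (X < _)%N]n0 mono.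
rewrite -(IH _ _ hs1 hr1) (blocks_cons hs) /chain /= -/(chain _ _).
have st := expands_stepW ok; have st' := expands_step_inv ok.
rewrite (prednK n1) in st st'.
by split; [exact: st'|exact: st].
Qed.

Definition proper_block (b : {poly R} * R) := (b.1 != 0) && (b.2 != 0).

Lemma blocks_proper s N n : normal_indices s N n -> regular s N n ->
  all proper_block (blocks s n N).
Proof.
elim: N s n => // N IH s n hs hr.
have ok := first_step hs hr; have [hs1 hr1] := next_step hs hr.
have n1 : (0 < n 1)%N by have [n0 mono _ _] := hs; rewrite -[X in (X < _)%N]n0 mono.
rewrite (blocks_cons hs) /= IH // andbT /proper_block /=.
have sm := schur_m_size ok; have [_ l0] := fr0E ok.
rewrite (prednK n1) in sm l0.
by rewrite l0 andbT -size_poly_eq0 sm -lt0n.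
Qed.

Lemma blocks_size s N n : normal_indices s N n -> regular s N n ->
  (\sum_(b <- blocks s n N) size b.1 = n N)%N.
Proof.
elim: N s n => [|N IH] s n hs hr.
  by rewrite big_nil; have [-> _ _ _] := hs.
have ok := first_step hs hr; have [hs1 hr1] := next_step hs hr.
have n1 : (0 < n 1)%N by have [n0 mono _ _] := hs; rewrite -[X in (X < _)%N]n0 mono.
rewrite (blocks_cons hs) big_cons (IH _ _ hs1 hr1) /=.
have sm := schur_m_size ok; rewrite (prednK n1) in sm.
rewrite sm /tail_indices subnKC // (normal_indices_le hs) //.
by apply/andP.
Qed.

(** What the blocks contribute to the index of f, and, in [chain_indexS], to
    that of z f(z). *)
Definition chain_index bs := (\sum_(b <- bs) kappa_minus ('X * b.1))%N.
Definition chain_indexS bs :=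
  (\sum_(b <- bs) (kappa_minus b.1 + kappa_minus (b.2 *: 'X)))%N.

Lemma solves_chain bs tau a b : all proper_block bs -> axis_lim tau 0 ->
  solves a b tau ->
  axis_lim (chain bs tau) 0 /\
  solves (chain_index bs + a) (chain_indexS bs + b) (chain bs tau).
Proof.
move=> + tl ts; rewrite /chain_index /chain_indexS.
elim: bs => [|[m l] bs IH] /= ok; first by rewrite !big_nil.
move: ok => /andP[/andP[/= m0 l0] ok]; have [cl cs] := IH ok.
have [_ _ _ _ sl] := step_axis m0 l0 cl; split; first exact: sl.
by rewrite !big_cons -!addnA /=; exact: solves_step.
Qed.

Lemma solves_unchain bs tau a b : all proper_block bs -> axis_lim tau 0 ->
  solves a b (chain bs tau) ->
  exists a' b', [/\ solves a' b' tau, a = (chain_index bs + a')%N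
    & b = (chain_indexS bs + b')%N].
Proof.
move=> + tl; rewrite /chain_index /chain_indexS.
elim: bs a b => [|[m l] bs IH] a b /= ok; first by rewrite !big_nil; exists a, b.
move: ok => /andP[/andP[/= m0 l0] ok] cs.
have cl : axis_lim (chain bs tau) 0.
  elim: (bs) ok => [|[m' l'] bs' IH'] //= /andP[/andP[/= m0' l0'] /IH' cl'].
  by have [_ _ _ _ sl] := step_axis m0' l0' cl'.
have [a1 [b1 [s1 -> ->]]] := solves_unstep m0 l0 cl cs.
have [a' [b' [s' -> ->]]] := IH _ _ ok s1.
by exists a', b'; rewrite !big_cons !addnA.
Qed.

(** The kernel of - 'X is the constant - 1. *)
Lemma kappa_minus_NX : kappa_minus (- 'X : {poly R}) = 1%N /\
  kappa_minus ('X : {poly R}) = 0%N.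
Proof.
have sX : (size ('X : {poly R}) <= 2)%N by rewrite size_polyX.
have sNX : (size (- 'X : {poly R}) <= 2)%N by rewrite size_polyN size_polyX.
have le1 := kappa_minusN sX.
suff h : (1 <= kappa_minus (- 'X : {poly R}))%N.
  move: h le1; move: (kappa_minus (- 'X)) (kappa_minus 'X) => p q; clear; lia.
apply/(kappa_minusP (- 'X : {poly R})).
exists 'I_1, 'I_1, (fun=> axis 1), (fun _ _ => 1); split.
- by rewrite card_ord.
- by move=> x; split=> //; exact: upper_axis ltr01.
move=> i j; rewrite (@gram_poly _ _ 1) //; last by move=> x; exact: upper_axis ltr01.
rewrite !big_ord1 coefN coefX /moment !big_ord1 !expr0 (ord1 i) (ord1 j).
rewrite !eqxx !mulr1 conjc1 mulr1 rmorphN rmorph1 addNr normr0.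
by rewrite /tolerance invr_ge0 ler0n.
Qed.

(** The block (- 1, 1) raises only the first index by one, and the block (1, -
    1) only the second one; the chain starts from the function 0. *)
Lemma parameter_exists (a b : nat) : exists tau, solves a b tau /\ axis_lim tau 0.
Proof.
pose bs := nseq a (- 1 : {poly R}, 1 : R) ++ nseq b (1 : {poly R}, - 1 : R).
have ok : all proper_block bs.
  by rewrite all_cat !all_nseq /proper_block /= !oppr_eq0 !oner_neq0 !orbT.
have [cl cs] := solves_chain ok (@axis_lim0 R) (@solves0 R).
exists (chain bs (fun=> Some 0)); split; last exact: cl.
have [kN kX] := kappa_minus_NX.
have k1 : kappa_minus (1 : {poly R}) = 0%N by rewrite -[1]polyC1 kappa_minusC.
have kN1 : kappa_minus (- 1 : {poly R}) = 0%N.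
  by rewrite -[1]polyC1 -polyCN kappa_minusC.
have i1 : chain_index bs = a.
  rewrite /chain_index big_cat !big_nseq /= mulrN1 mulr1 kN kX !iter_addn_0.
  by rewrite mul1n mul0n addn0.
have i2 : chain_indexS bs = b.
  rewrite /chain_indexS big_cat !big_nseq /= k1 kN1 scale1r scaleN1r kX kN !iter_addn_0.
  by rewrite mul0n mul1n.
by rewrite i1 i2 !addn0 in cs.
Qed.

End SolutionChains.

(** * The indices of the moment sequence, and the theorem *)

Section IndexFormulas.
Local Open Scope complex_scope.
Variable R : realType.
Local Notation C := R[i].
Local Notation sfun := (C -> option C).
Implicit Types (s : seq R) (f tau : sfun) (P m : {poly R}).
Implicit Types (bs : seq ({poly R} * R)).

(** The function z f(z) + s_0 has the moments s_1, s_2, ..., and adding a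
    constant does not change the index. *)
Lemma hankel_bound (c : nat -> R) f n a b : (0 < n)%N -> axis_lim f 0 ->
  solves a b f -> expands c (2 * n) f ->
  (forall p, has_neg (hankelC c n) p -> (p <= a)%N) /\
  (forall p, has_neg (hankelC (fun i => c i.+1) n) p -> (p <= b)%N).
Proof.
move=> n0 fl [_ _ fi fj] fe; split=> p hp.
  apply/(fi p); apply: (has_negs_hankel n0 _ fe hp).
  by rewrite -mul2n.
have gi := neg_index_padd (c 0%N)%:P (pscale_small fl) fj.
rewrite kappa_minusC add0n in gi.
apply/(gi p); apply: (@has_negs_hankel _ (fun i => c i.+1) (2 * n).-1 _ n p n0 _ _ hp).
  by rewrite prednK ?muln_gt0 // -mul2n.
have [ff h] := fe; split.
  by apply: filterS ff => y; rewrite /padd /pscale; case: (f (axis y)).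
apply: (cvgc_eq _ h); apply: filterS2 (@near_pos R) ff => y y0.
have z0 := axis_neq0 y0; rewrite /padd /pscale poly_evalC.
have -> : (2 * n)%N = (2 * n).-1.+1 by rewrite prednK ?muln_gt0.
have -> : 'X * spoly c (2 * n).-1.+1 =
    'X * ((c 0%N)%:P + 'X * spoly (fun i => c i.+1) (2 * n).-1).
  congr (_ * _); apply/polyP => i; rewrite coefD coefC coefXM !coef_poly.
  by case: i => [|i]; rewrite ?addr0 ?add0r.
case: (f (axis y)) => //= w _; rewrite exprS !poly_evalXM poly_evalD poly_evalC.
by rewrite poly_evalXM /axis_inv; field.
Qed.

Definition opp_block (b : {poly R} * R) := (- b.1, - b.2).

Definition negf f : sfun := fun z => omap -%R (f z).

Lemma step_opp m l f : step (- m) (- l) (negf f) = negf (step m l f).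
Proof.
apply: funext => z; rewrite /negf !stepE poly_evalN.
case: (f z) => [a|] /=; last first.
  by rewrite !addr0 mulrN oppr_eq0; case: ifP => //= _; rewrite invrN.
rewrite rmorphN -opprD oppr_eq0; case: ifP => _ /=; first by rewrite oppr0.
rewrite invrN mulrN -opprD oppr_eq0; case: ifP => //= _.
by rewrite invrN.
Qed.

Lemma chain_opp bs f :
  chain [seq opp_block b | b <- bs] (negf f) = negf (chain bs f).
Proof. by elim: bs => //= b bs IH; rewrite IH step_opp. Qed.

Lemma expands_opp (c : nat -> R) K f : expands c K f ->
  expands (fun i => - c i) K (negf f).
Proof.
move=> [ff h]; split.
  by apply: filterS ff => y; rewrite /negf; case: (f (axis y)).
pose proof (cvgcN h) as h'; rewrite oppr0 in h'.
apply: (cvgc_eq _ h'); apply: filterS ff => y; rewrite /negf.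
have -> : spoly (fun i => - c i) K = - spoly c K.
  by apply/polyP => i; rewrite coefN !coef_poly; case: ifP; rewrite ?oppr0.
case: (f (axis y)) => //= w _.
by rewrite !poly_evalXM poly_evalN; ring.
Qed.

(** The degrees of the polynomials of a block (m, l), namely deg m + 1 for z m
    and deg m, 1 for m, z l, add up to the size of the block in both cases. *)
Lemma chain_index_opp bs : all (@proper_block R) bs ->
  (chain_index bs + chain_index [seq opp_block b | b <- bs] <= \sum_(b <- bs) size b.1)%N /\
  (chain_indexS bs + chain_indexS [seq opp_block b | b <- bs] <= \sum_(b <- bs) size b.1)%N.
Proof.
rewrite /chain_index /chain_indexS; elim: bs => [|[m l] bs IH] /=; first by rewrite !big_nil.
move=> /andP[/andP[/= m0 l0] /IH[h1 h2]]; rewrite !big_cons /=.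
have sm : (0 < size m)%N by rewrite size_poly_gt0.
have k1 : (kappa_minus ('X * m) + kappa_minus ('X * - m) <= size m)%N.
  rewrite mulrN; apply: kappa_minusN.
  by apply: leq_trans (size_polyMleq _ _) _; rewrite size_polyX.
have k2 : (kappa_minus m + kappa_minus (- m) <= (size m).-1)%N.
  by apply: kappa_minusN; rewrite prednK.
have k3 : (kappa_minus (l *: 'X) + kappa_minus (- l *: 'X) <= 1)%N.
  rewrite scaleNr; apply: kappa_minusN.
  by apply: leq_trans (size_scale_leq _ _) _; rewrite size_polyX.
split; first by rewrite addnACA leq_add.
rewrite addnACA; apply: leq_add h2; rewrite addnACA; apply: leq_trans (leq_add k2 k3) _.
by rewrite addn1 prednK.
Qed.

(** The moments bound the numbers of negative eigenvalues of S and of - S by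
    the indices of a solution and of its opposite. These two indices add up to
    at most n_N and the two numbers to exactly n_N, so the bounds are attained.
    The same holds for the shifted matrix and z f(z). *)
Lemma nu_minus_hankel s N n : (0 < N)%N ->
  normal_indices s N n -> regular s N n ->
  nu_minus (hankel s (n N)) = chain_index (blocks s n N) /\
  nu_minus (hankel_plus s (n N)) = chain_indexS (blocks s n N).
Proof.
move=> N0 hs hr; set bs := blocks s n N; set S := hankel _ _; set Sp := hankel_plus _ _.
have nN0 : (0 < n N)%N.
  by have [<- _ _ _] := hs; apply: (normal_indices_lt hs); rewrite N0 leqnn.
have dS : \det S != 0.
  have [_ _ _ hdet] := hs; apply/hdet; first by rewrite nN0 leqnn.
  by exists N => //; rewrite N0 leqnn.
have dSp : \det Sp != 0 by apply: hr; rewrite N0 leqnn.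
have ok : all (@proper_block R) bs by exact: blocks_proper.
have ok' : all (@proper_block R) [seq opp_block b | b <- bs].
  rewrite all_map; apply: sub_all ok => b; rewrite /= /proper_block /=.
  by rewrite !oppr_eq0.
have [cl cs] := solves_chain ok (@axis_lim0 R) (@solves0 R).
have [cl' cs'] := solves_chain ok' (@axis_lim0 R) (@solves0 R).
have sz : size s = (2 * n N)%N by have [] := hs.
have ce := (expands_blocks (fun=> Some 0) hs hr).2 (@axis_lim0 R).
have ce' := expands_opp ce.
have n00 : negf (fun=> Some 0) = (fun=> Some 0).
  by apply: funext => z; rewrite /negf /= oppr0.
rewrite -chain_opp n00 sz in ce'; rewrite sz in ce.
have [b1 b2] := hankel_bound nN0 cl cs ce.
have [b1' b2'] := hankel_bound nN0 cl' cs' ce'.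
rewrite !addn0 in b1 b2 b1' b2'.
have symS : S^T = S by apply/matrixP => i j; rewrite !mxE addnC.
have symSp : Sp^T = Sp by apply/matrixP => i j; rewrite !mxE addnC.
have opp_sym (A : 'M[R]_(n N)) : A^T = A -> (- A)^T = - A.
  by move=> AT; apply/matrixP => i j; rewrite -[in RHS]AT !mxE.
have [nS /(_ dS) tS] := nu_minus_neg symS.
have [nSp /(_ dSp) tSp] := nu_minus_neg symSp.
have [nS' _] := nu_minus_neg (opp_sym _ symS).
have [nSp' _] := nu_minus_neg (opp_sym _ symSp).
have le1 : (nu_minus S <= chain_index bs)%N.
  apply: b1; suff -> : hankelC (nth 0 s) (n N) = toCmx S by [].
  by apply/matrixP => i j; rewrite !mxE.
have le2 : (nu_minus Sp <= chain_indexS bs)%N.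
  apply: b2; suff -> : hankelC (fun i => s`_i.+1) (n N) = toCmx Sp by [].
  by apply/matrixP => i j; rewrite !mxE.
have le1' : (nu_minus (- S) <= chain_index [seq opp_block b | b <- bs])%N.
  apply: b1'; suff -> : hankelC (fun i => - s`_i) (n N) = toCmx (- S) by [].
  by apply/matrixP => i j; rewrite !mxE.
have le2' : (nu_minus (- Sp) <= chain_indexS [seq opp_block b | b <- bs])%N.
  apply: b2'; suff -> : hankelC (fun i => - s`_i.+1) (n N) = toCmx (- Sp) by [].
  by apply/matrixP => i j; rewrite !mxE.
have [i1 i2] := chain_index_opp ok; rewrite (blocks_size hs hr) in i1 i2.
have squeeze p q p' q' : (p <= q -> p' <= q' -> q + q' <= n N -> p + p' = n N ->
    p = q)%N by clear; lia.
by split; [exact: squeeze le1 le1' i1 tS|exact: squeeze le2 le2' i2 tSp].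
Qed.

(** A class with a negative index is empty. *)
Lemma gen_stieltjes_sub (kappa k p q : nat) f :
  gen_stieltjes (kappa%:Z - p%:Z) (k%:Z - q%:Z) f <->
  exists a b, [/\ solves a b f, kappa = (p + a)%N & k = (q + b)%N].
Proof.
split=> [h|[a [b [fs -> ->]]]]; last first.
  by rewrite !PoszD [p%:Z + _]addrC [q%:Z + _]addrC !addrK; apply/gen_stieltjesP.
have neg (i j : nat) : (i < j)%N -> exists t, i%:Z - j%:Z = Negz t.
  move=> ij; exists (j - i).-1; rewrite NegzE prednK ?subn_gt0 //.
  by rewrite -subzn ?opprB // ltnW.
have pk : (p <= kappa)%N.
  by rewrite leqNgt; apply/negP => /neg[t tE]; move: h => [+ _]; rewrite tE.
have qk : (q <= k)%N.
  by rewrite leqNgt; apply/negP => /neg[t tE]; move: h => [_ +]; rewrite tE.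
exists (kappa - p)%N, (k - q)%N; rewrite !subnKC //; split=> //.
by rewrite !subzn // in h; apply/gen_stieltjesP.
Qed.

End IndexFormulas.

Theorem theorem4p3 (R : realType) (N : nat) (s : seq R) (n : nat -> nat)
    (kappa k : nat) (hN : (0 < N)%N)
    (hs : normal_indices s N n) (hreg : regular s N n) :
  let kappaN := nu_minus (hankel s (n N)) in
  let kN := nu_minus (hankel_plus s (n N)) in
  let parameter (tau : R[i] -> option R[i]) :=
    gen_stieltjes (kappa%:Z - kappaN%:Z) (k%:Z - kN%:Z) tau /\
    nontangential_o1 tau in
  (forall j, (1 <= j <= N)%N -> lnum s n j != 0) /\
  [/\ moment_solutions kappa k s !=set0 <->
        (kappaN <= kappa)%N /\ (kN <= k)%N,
      forall f : R[i] -> option R[i],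
        moment_solutions kappa k s f <->
        exists2 tau : R[i] -> option R[i], parameter tau &
          forall z, nonreal z -> f z = moebius (Wmx s n N z) (tau z),
      forall tau : R[i] -> option R[i], parameter tau ->
        forall z, nonreal z ->
          moebius (Wmx s n N z) (tau z) = cfrac s n N z (tau z)
    & kappaN = (\sum_(1 <= j < N.+1) kappa_minus ('X * mpol s n j))%N /\
      kN = (\sum_(1 <= j < N.+1) kappa_minus (mpol s n j)
            + \sum_(1 <= j < N.+1) kappa_minus (lnum s n j *: 'X))%N].
Proof.
move=> kappaN kN parameter.
have [kappaE kE] := nu_minus_hankel hN hs hreg.
rewrite -/kappaN in kappaE; rewrite -/kN in kE.
have ok := blocks_proper hs hreg.
have solE f : moment_solutions kappa k s f <->
    exists2 tau : R[i] -> option R[i], parameter tau &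
      forall z, nonreal z -> f z = moebius (Wmx s n N z) (tau z).
  split=> [[/gen_stieltjesP fs /expandsP fe]|[tau [/gen_stieltjes_sub
      [a [b [ts -> ->]]] /nontangential_axis tl] fE]].
    have [tau tauE] := chain_onto (blocks s n N) f.
    rewrite -tauE in fs fe; have tl := (expands_blocks tau hs hreg).1 fe.
    have [a [b [ts aE bE]]] := solves_unchain ok tl fs.
    exists tau; last first.
      by move=> z _; rewrite moebius_cfrac cfrac_chain tauE.
    split; last first.
      exact: bounded_nontangential (solves_mero ts)
        (neg_index_bounded (solves_index ts)) tl.
    by apply/gen_stieltjes_sub; exists a, b; rewrite kappaE kE.
  have cE z : nonreal z -> chain (blocks s n N) tau z = f z.
    by move=> z0; rewrite fE // moebius_cfrac cfrac_chain.
  have [_ cs] := solves_chain ok tl ts.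
  rewrite kappaE kE; split.
    by apply/gen_stieltjesP; exact: solves_eq cE cs.
  by apply/expandsP; apply: (expands_eq cE); apply/(expands_blocks tau hs hreg).
split=> [j jN|].
  have : (mpol s n j, lnum s n j) \in blocks s n N.
    by apply/mapP; exists j => //; rewrite mem_iota add1n ltnS.
  by move=> /(allP ok) /andP[].
split; last first.
- rewrite kappaE kE /chain_index /chain_indexS !big_map big_split /index_iota subn1 /=.
  by [].
- by move=> tau _ z _; exact: moebius_cfrac.
- exact: solE.
split=> [[f /solE[tau [/gen_stieltjes_sub[a [b [_ -> ->]]] _] _]]|[kk kk']].
  by rewrite !leq_addr.
have [tau [ts tl]] := parameter_exists R (kappa - kappaN) (k - kN).
exists (fun z => moebius (Wmx s n N z) (tau z)); apply/solE; exists tau => //.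
split.
  by apply/gen_stieltjes_sub; exists (kappa - kappaN)%N, (k - kN)%N; rewrite !subnKC.
exact: bounded_nontangential (solves_mero ts)
  (neg_index_bounded (solves_index ts)) tl.
Qed.
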